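(* Let $n\in\mathbb{N}$ and let $\rho:\mathbb{R}^n\to[0,\infty)$, $\rho\not\equiv 0$, be measurable and even (i.e. $\rho(x)=\rho(-x)$ for almost all $x\in\mathbb{R}^n$) with $\int_{\mathbb{R}^n}\rho(x)(1+|x|)\,dx<\infty$. Let $p\in[1,\infty)$. For $\varepsilon>0$ let $\mathcal{L}_\varepsilon^{\mathbb{R}^n}:W^{2,p}(\mathbb{R}^n)\to L^p(\mathbb{R}^n)$ be the nonlocal operator associated with $\rho$, and let $\mathcal{L}^{\mathbb{R}^n}u=-\operatorname{div}(M\nabla u)$ be the associated local operator (both defined in the context). Then: (a) For all $u\in W^{2,p}(\mathbb{R}^n)$, $\mathcal{L}_\varepsilon^{\mathbb{R}^n}u\to\mathcal{L}^{\mathbb{R}^n}u$ in $L^p(\mathbb{R}^n)$ as $\varepsilon\to0$. (b) There exists a constant $C>0$ such that for all $\varepsilon>0$ and all $u\in W^{3,p}(\mathbb{R}^n)$, $$\|\mathcal{L}_\varepsilon^{\mathbb{R}^n}u-\mathcal{L}^{\mathbb{R}^n}u\|_{L^p(\mathbb{R}^n)}\le C\,\varepsilon\,\|u\|_{W^{3,p}(\mathbb{R}^n)}.$$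
   Context: Set $J(x)=\rho(x)/|x|^2$ for $x\ne0$; for $\varepsilon>0$ set $\rho_\varepsilon(x)=\varepsilon^{-n}\rho(x/\varepsilon)$ and $J_\varepsilon(x)=\rho_\varepsilon(x)/|x|^2$ for $x\neq 0$. The momentum matrix is $M=\frac12\int_{\mathbb{R}^n}J(z)\,z\otimes z\,dz\in\mathbb{R}^{n\times n}$, which is symmetric and positive definite. The local operator is $\mathcal{L}^{\mathbb{R}^n}u=-\operatorname{div}(M\nabla u)=-\sum_{i,j=1}^nM_{ij}\,\partial_{x_i}\partial_{x_j}u$. Nonlocal operator: for $u\in C_c^2(\mathbb{R}^n)$ and almost all $x\in\mathbb{R}^n$, $$\mathcal{L}_\varepsilon^{\mathbb{R}^n}u(x)=\mathrm{P.V.}\int_{\mathbb{R}^n}J_\varepsilon(x-y)(u(x)-u(y))\,dy=\lim_{r\searrow0}\int_{\{|x-y|\ge r\}}J_\varepsilon(x-y)(u(x)-u(y))\,dy=\int_{\mathbb{R}^n}J_\varepsilon(x-y)\big(u(x)-u(y)-\nabla u(x)\cdot(x-y)\big)\,dy.$$ This defines a linear operator $C_c^2(\mathbb{R}^n)\to L^p(\mathbb{R}^n)$ that is bounded with respect to the $W^{2,p}(\mathbb{R}^n)$-norm, uniformly in $\varepsilon$, and $\mathcal{L}_\varepsilon^{\mathbb{R}^n}:W^{2,p}(\mathbb{R}^n)\to L^p(\mathbb{R}^n)$ denotes its unique bounded linear extension. *)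

(* Defs.v *)
From HB Require Import structures.
From mathcomp Require Import all_boot all_order all_algebra.
From mathcomp Require Import all_classical all_reals all_analysis.
From mathcomp Require Import measurable_realfun.

Set Implicit Arguments.
Unset Strict Implicit.
Unset Printing Implicit Defensive.

Import Order.TTheory GRing.Theory Num.Theory.
Import numFieldNormedType.Exports.

Local Open Scope classical_set_scope.
Local Open Scope ring_scope.

Section measurable_rV.
Context (R : realType) (n : nat).

Let coord (i : 'I_n) (x : 'rV[R]_n) : R := x ord0 i.

Let rV_set0 : g_sigma_preimage coord set0.
Proof. exact: sigma_algebra0. Qed.

Let rV_setC A : g_sigma_preimage coord A -> g_sigma_preimage coord (~` A).
Proof. exact: sigma_algebraC. Qed.

Let rV_bigcup (F : (set 'rV[R]_n)^nat) :
  (forall i, g_sigma_preimage coord (F i)) ->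
  g_sigma_preimage coord (\bigcup_i F i).
Proof. exact: sigma_algebra_bigcup. Qed.

(* The sigma-algebra generated by the coordinates, i.e. the Borel one; a set of
   the Lebesgue sigma-algebra is one of [completed_algebra_gen] below. *)
HB.instance Definition _ :=
  @isMeasurable.Build (measure_tuple_display default_measure_display)
    'rV[R]_n (g_sigma_preimage coord) rV_set0 rV_setC rV_bigcup.

End measurable_rV.

Lemma measurable_coord (R : realType) n (i : 'I_n) :
  measurable_fun [set: 'rV[R]_n] (fun x : 'rV[R]_n => x ord0 i).
Proof.
move=> _ Y mY; rewrite setTI; apply: sub_sigma_algebra => /=.
rewrite -bigcup_seq/=; exists i => /=; first by rewrite mem_index_enum.
by exists Y => //; rewrite setTI.
Qed.

Lemma measurable_fun_rVP (R : realType) d (T : measurableType d) n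
    (f : T -> 'rV[R]_n) :
  (forall i, measurable_fun [set: T] (fun t => f t ord0 i)) ->
  measurable_fun [set: T] f.
Proof.
move=> mf.
suff sub : g_sigma_preimage (fun i t => f t ord0 i) `<=` @measurable d T.
  move=> _ A mA; apply: sub.
  rewrite (g_sigma_preimage_comp (fun i (x : 'rV[R]_n) => x ord0 i) f).
  by exists A.
apply: smallest_sub; first exact: sigma_algebra_measurable.
case: n => [|n] in f mf *; first by rewrite big_ord0.
rewrite -bigcup_mkord_ord; apply: bigcup_sub => i Ii.
by move=> A [B mB <-]; exact: mf.
Qed.

Section consmx.
Context (R : realType) (n : nat).

Definition consmx (z : R * 'rV[R]_n) : 'rV[R]_n.+1 :=
  \row_i (if unlift ord0 i is Some j then z.2 ord0 j else z.1).

Lemma measurable_consmx : measurable_fun [set: R * 'rV[R]_n] consmx.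
Proof.
apply: measurable_fun_rVP => i; rewrite /consmx.
under eq_fun do rewrite mxE.
case: unliftP => [j _|_]; last exact: measurable_fst.
exact: (measurableT_comp (@measurable_coord R n j) measurable_snd).
Qed.

Context (mu : {sigma_finite_measure set 'rV[R]_n -> \bar R}).

Definition cons_measure : set 'rV[R]_n.+1 -> \bar R :=
  pushforward (@lebesgue_measure R \x mu)%E consmx.

Let cons_measure0 : cons_measure set0 = 0%E.
Proof. by rewrite /cons_measure /pushforward preimage_set0 measure0. Qed.

Let cons_measure_ge0 A : (0 <= cons_measure A)%E.
Proof. by have mf := measurable_consmx; exact: measure_ge0. Qed.

Let cons_measure_sigma_additive : semi_sigma_additive cons_measure.
Proof.
by have mf := measurable_consmx; exact: measure_semi_sigma_additive.
Qed.

HB.instance Definition _ := isMeasure.Build _ _ _ cons_measure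
  cons_measure0 cons_measure_ge0 cons_measure_sigma_additive.

Let headmx (x : 'rV[R]_n.+1) : R * 'rV[R]_n :=
  (x ord0 ord0, \row_j x ord0 (lift ord0 j)).

Let consmxK : cancel consmx headmx.
Proof.
move=> [a v]; congr (_, _); rewrite /= /consmx ?mxE ?unlift_none//.
by apply/rowP => j; rewrite !mxE liftK.
Qed.

Let measurable_headmx : measurable_fun setT headmx.
Proof.
apply: measurable_fun_pair; first exact: measurable_coord.
apply: measurable_fun_rVP => i.
under eq_fun do rewrite mxE.
exact: measurable_coord.
Qed.

Let cons_measure_sigma_finite : sigma_finite setT cons_measure.
Proof.
have /sigma_finiteP[F [FT ndF Foo]] := sigma_finiteT (@lebesgue_measure R).
have /sigma_finiteP[G [GT ndG Goo]] := sigma_finiteT mu.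
exists (fun k => headmx @^-1` (F k `*` G k)).
  rewrite -preimage_bigcup (_ : \bigcup_k (F k `*` G k) = setT)//.
  rewrite -setXTT FT GT; apply/seteqP; split => -[a v] /=.
    by move=> [k _ [? ?]]; split; exists k.
  move=> [[k _ Fa] [l _ Gv]]; exists (maxn k l) => //; split => /=.
    by move: a Fa; exact/subsetPset/ndF/leq_maxl.
  by move: v Gv; exact/subsetPset/ndG/leq_maxr.
move=> k; have [mF Fk] := Foo k; have [mG Gk] := Goo k; split.
  rewrite -[X in measurable X]setTI; apply: measurable_headmx => //.
  exact: measurableX.
rewrite /cons_measure /pushforward -comp_preimage.
rewrite (_ : headmx \o consmx = id); last by apply/funext => z /=; rewrite consmxK.
by rewrite preimage_id product_measure1E// lte_mul_pinfty// ge0_fin_numE.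
Qed.

HB.instance Definition _ := Measure_isSigmaFinite.Build _ _ _ cons_measure
  cons_measure_sigma_finite.

End consmx.

Fixpoint lebesgue_rV (R : realType) (n : nat) :
    {sigma_finite_measure set 'rV[R]_n -> \bar R} :=
  match n with
  | 0 => [the {sigma_finite_measure set 'rV[R]_0 -> \bar R} of
           dirac (0 : 'rV[R]_0)]
  | m.+1 => [the {sigma_finite_measure set 'rV[R]_m.+1 -> \bar R} of
              cons_measure (lebesgue_rV R m)]
  end.

Lemma lebesgue_rV_box (R : realType) (n : nat) (A : 'I_n -> set R) :
  (forall i, measurable (A i)) ->
  (lebesgue_rV R n [set x : 'rV[R]_n | forall i, A i (x ord0 i)] =
   \prod_(i < n) lebesgue_measure (A i))%E.
Proof.
elim: n A => [|n IHn] A mA /=.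
  by rewrite big_ord0 diracE mem_set//; case.
rewrite big_ord_recl /cons_measure/= /pushforward -IHn//.
rewrite (_ : _ @^-1` _ =
    A ord0 `*` [set x : 'rV[R]_n | forall i, A (lift ord0 i) (x ord0 i)]).
  rewrite product_measure1E//; first exact: mA.
  have -> : [set x : 'rV[R]_n | forall i, A (lift ord0 i) (x ord0 i)] =
      \bigcap_(i : 'I_n) (fun x : 'rV[R]_n => x ord0 i) @^-1` A (lift ord0 i).
    by apply/seteqP; split => x /= h i; [move=> _|]; exact: h.
  apply: fin_bigcap_measurable => // i _.
  by rewrite -[X in measurable X]setTI; exact: measurable_coord.
apply/seteqP; split => -[a v] /=.
  move=> h; split; first by have := h ord0; rewrite mxE unlift_none.
  by move=> i; have := h (lift ord0 i); rewrite mxE liftK.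
by move=> [Aa Av] i; rewrite mxE; case: unliftP => [j ->|->].
Qed.

Section spaces.
Context (R : realType) (n : nat).
Implicit Types (f u v phi : 'rV[R]_n -> R) (x : 'rV[R]_n) (a : 'I_n -> nat).

Local Notation mu := (lebesgue_rV R n).

(* Measurability for the completed (Lebesgue) sigma-algebra. [integral] takes a
   supremum over Borel simple functions below the positive and negative parts;
   for such functions this is still the Lebesgue integral, as each agrees almost
   everywhere with a Borel function. *)
Definition lebesgue_measurable_fun f :=
  measurable_fun
    [set: g_sigma_algebraType (completed_algebra_gen mu)]
    (f : g_sigma_algebraType (completed_algebra_gen mu) -> R).

(* The norm on 'rV[R]_n provided by the library is the maximum norm. *)
Definition enorm x : R := Num.sqrt (\sum_(i < n) x ord0 i ^+ 2).

Definition partial (i : 'I_n) f : 'rV[R]_n -> R :=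
  fun x => 'D_(delta_mx ord0 i) f x.

Fixpoint Ck (k : nat) f : Prop :=
  continuous f /\
  if k is k'.+1 then
    forall i, (forall x, derivable f x (delta_mx ord0 i)) /\ Ck k' (partial i f)
  else True.

Definition compact_support f := compact (closure [set x | f x != 0]).

Definition Ckc (k : nat) f := Ck k f /\ compact_support f.

Definition test_function phi := (forall k, Ck k phi) /\ compact_support phi.

Definition mi_order a : nat := \sum_(i < n) a i.

Definition multi_partial a phi : 'rV[R]_n -> R :=
  foldr (fun i => iter (a i) (partial i)) phi (enum 'I_n).

Definition loc_integrable f :=
  measurable_fun setT f /\
  forall K : set 'rV[R]_n, compact K -> (\int[mu]_(x in K) `|f x|%:E < +oo)%E.

Definition is_weak_deriv a u v :=
  [/\ loc_integrable u, loc_integrable v &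
    forall phi, test_function phi ->
      \int[mu]_x (u x * multi_partial a phi x) =
      (-1) ^+ mi_order a * \int[mu]_x (v x * phi x)].

(* Weak derivatives are unique up to null sets. *)
Definition weak_deriv a u : 'rV[R]_n -> R := xget (cst 0) (is_weak_deriv a u).

(* The elements of L^p are represented by Borel functions: every class of Lebesgue
   measurable functions contains one. *)
Definition Wkp (k : nat) (p : R) u :=
  u \in Lfun mu p%:E /\
  forall a, (mi_order a <= k)%N ->
    exists2 v, v \in Lfun mu p%:E & is_weak_deriv a u v.

(* The index a runs through the multi-indices of order at most k, whose entries
   are automatically at most k. *)
Definition Wkp_norm (k : nat) (p : R) u : \bar R :=
  ((\sum_(a : {ffun 'I_n -> 'I_k.+1} | (mi_order (fun i => a i) <= k)%N)
      'N[mu]_p%:E[EFin \o weak_deriv (fun i => a i) u] `^ p) `^ p^-1)%E.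

End spaces.

Section operators.
Context (R : realType) (n : nat).
Implicit Types (rho u v : 'rV[R]_n -> R) (eps p : R).

Local Notation mu := (lebesgue_rV R n).

(* Below, 0^-1 = 0 gives the kernels the value 0 at the origin. *)
Definition J_kernel rho (x : 'rV[R]_n) : R := rho x / enorm x ^+ 2.

Definition rho_scaled rho eps (x : 'rV[R]_n) : R :=
  eps ^- n * rho (eps^-1 *: x).

Definition J_scaled rho eps (x : 'rV[R]_n) : R :=
  rho_scaled rho eps x / enorm x ^+ 2.

Definition momentum_matrix rho : 'M[R]_n :=
  \matrix_(i, j) (2^-1 *
    \int[mu]_z (J_kernel rho z * (z ord0 i * z ord0 j))).

Definition local_op rho u : 'rV[R]_n -> R := fun x =>
  - \sum_(i < n) \sum_(j < n) momentum_matrix rho i j *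
      weak_deriv (fun k => ((k == i) + (k == j))%N) u x.

(* The integral over {y : |x - y| >= r}. *)
Definition truncated_op rho eps u (x : 'rV[R]_n) (r : R) : \bar R :=
  (\int[mu]_(y in [set y | (r <= enorm (x - y))%R])
     (J_scaled rho eps (x - y) * (u x - u y))%:E)%E.

(* T is a bounded linear operator from W^{2,p} to L^p that extends the operator
   defined on C_c^2 by the principal value. Elements of these spaces are given
   by representatives, and T is arbitrary outside of W^{2,p}. *)
Definition is_nonlocal_extension rho eps p
    (T : ('rV[R]_n -> R) -> 'rV[R]_n -> R) :=
  [/\ forall u, Wkp 2 p u -> T u \in Lfun mu p%:E,
     forall (c : R) u v, Wkp 2 p u -> Wkp 2 p v ->
       T (c *: u + v) = c *: T u + T v %[ae mu],
     exists C : R, forall u, Wkp 2 p u ->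
       ('N[mu]_p%:E[EFin \o T u] <= C%:E * Wkp_norm 2 p u)%E &
     forall u, Ckc 2 u -> {ae mu, forall x,
       truncated_op rho eps u x r @[r --> 0^'+] --> (T u x)%:E}].

(* Such an extension is unique up to null sets. *)
Definition nonlocal_op rho eps p : ('rV[R]_n -> R) -> 'rV[R]_n -> R :=
  xget (fun _ => cst 0) (is_nonlocal_extension rho eps p).

End operators.

(* Main.v *)
From HB Require Import structures.
From mathcomp Require Import finmap.
Require Import Defs.
From mathcomp Require Import all_boot all_order all_algebra.
From mathcomp Require Import all_classical all_reals all_analysis.
From mathcomp Require Import measurable_realfun ring lra.

Set Implicit Arguments.
Unset Strict Implicit.
Unset Printing Implicit Defensive.

Import Order.TTheory GRing.Theory Num.Theory.
Import numFieldNormedType.Exports.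

Local Open Scope classical_set_scope.
Local Open Scope ring_scope.

(** The proof rests on Taylor's formula with integral remainder. For u in C_c^2,
    the substitution y = x - eps z turns the principal value into an integral of
      rho(z) / (eps^2 |z|^2) * (u(x) - u(x - eps z))
    over the complements of balls. The gradient term of the expansion of
    u(x - eps z) is odd in z and integrates to 0 because rho is even, and the
    remainder is dominated by a multiple of rho, as |z_i z_j| <= |z|^2. In the
    limit ([truncated_op_cvg]),
      L_eps u(x) = - sum_ij int int_0^1 w_ij(t, z) D_ij u(x - eps t z) dt dz
    with w_ij(t, z) = (1 - t) rho(z) z_i z_j / |z|^2.

    The right-hand side is a sum of weighted averages of translates [tavg] of
    the second derivatives. By Minkowski's integral inequality
    ([signed_minkowski], [tavg_norm]) it is bounded from W^{2,p} to L^p when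
    D_ij denotes weak derivatives. Test functions are dense in W^{2,p}
    ([Wkp2_dense], by mollification and cutoff), hence it is the bounded
    extension of the principal value ([taylor_op_extension],
    [nonlocal_extension_unique]).

    The integral of w_ij is the entry M_ij of the momentum matrix
    ([Rintegral_taylor_kernel]). Therefore L_eps u - L u is a sum of terms
      int w_ij(t, z) (D_ij u(x - eps t z) - D_ij u(x)) dt dz.
    For (a), such a term tends to 0 in L^p because translation is continuous
    there; quantitatively, by a rate for test functions and their density in L^p
    ([tavg_approx]). For (b), D_ij u belongs to W^{1,p} and its translation by
    eps t z changes it in L^p by at most a constant times eps |z| times the norm
    of the third derivatives ([Lnorm_translate_weak]); the factor |z| is
    integrable against rho ([tavg_diff]).

    All this supposes rho Borel and even everywhere. A given kernel agrees with
    such a one off a null set ([regular_version]), and a change on a null set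
    affects neither the truncated integrals nor the momentum matrix.

    The tools on Sobolev functions come from two approximations. Smooth functions
    with values in [0, 1] approximate indicators of Borel sets in any finite
    measure ([indic_approximation]), which gives the uniqueness of weak
    derivatives ([loc_integrable_eq0]) and the density of test functions in L^p
    ([test_dense]). Convolution with a test function commutes with weak
    derivatives ([partial_convol_weak]) and approximates the identity
    ([convol_approx]). *)

(** * Lebesgue measure on row vectors *)

Section borel_rV.
Context {R : realType}.
Implicit Types n : nat.

Lemma measurable_rV_ball n (x : 'rV[R]_n) (e : R) : measurable (ball x e).
Proof.
have [e0|e0] := ltP 0 e; last first.
  rewrite (_ : ball x e = set0)//.
  by apply/seteqP; split => // y [+ _]; rewrite ltNge e0.
have -> : ball x e =
    \bigcap_(j : 'I_n) (fun y : 'rV[R]_n => y ord0 j) @^-1` (ball (x ord0 j) e).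
  apply/seteqP; split => [y [_ xy] j _|y xy]; first exact: xy.
  by split => // i j; rewrite (ord1 i); exact: xy.
apply: fin_bigcap_measurable => // j _.
rewrite -[X in measurable X]setTI; apply: measurable_coord => //.
exact: measurable_ball.
Qed.

(** Balls with rational centre and radius form a countable base, so the
    coordinate sigma-algebra contains all the open sets. *)
Lemma open_measurable_rV n (U : set 'rV[R]_n) : open U -> measurable U.
Proof.
move=> oU.
pose B (qk : 'rV[rat]_n * nat) : set 'rV[R]_n :=
  ball (map_mx ratr qk.1 : 'rV[R]_n) qk.2.+1%:R^-1.
have -> : U = \bigcup_(qk in [set qk | B qk `<=` U]) B qk.
  apply/seteqP; split => [x Ux|x [qk /= BU Bx]]; last exact: BU.
  have /nbhs_ballP[e /= e0 xeU] : nbhs x U by apply: open_nbhs_nbhs.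
  pose k := (Num.truncn (2 / e)).
  have ke : 2 * k.+1%:R^-1 < e.
    by rewrite ltr_pdivrMr// mulrC -ltr_pdivrMr// truncnS_gt.
  have dense j : {q : rat | ball (x ord0 j) (k.+1%:R^-1) (ratr q)}.
    apply: cid.
    have : x ord0 j - k.+1%:R^-1 < x ord0 j + k.+1%:R^-1.
      by rewrite ltrD2l gtrN// invr_gt0.
    by move=> /rat_in_itvoo[q qx]; exists q; rewrite ball_itv.
  have Bq : ball x k.+1%:R^-1 (map_mx ratr (\row_j projT1 (dense j)) : 'rV[R]_n).
    by split => // i j; rewrite !mxE (ord1 i); exact: (projT2 (dense j)).
  exists (\row_j projT1 (dense j), k); last exact: ball_sym.
  move=> y By; apply: xeU; apply: (le_ball (ltW ke)).
  by rewrite mulr_natl mulr2n; exact: ball_triangle By.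
rewrite bigcup_mkcond; apply: countable_bigcupT_measurable => //.
by move=> qk; case: ifPn => // _; exact: measurable_rV_ball.
Qed.

Lemma continuous_measurable_rV n (f : 'rV[R]_n -> R) :
  continuous f -> measurable_fun setT f.
Proof.
move=> /continuousP cf; apply: (measurability _ (RGenOpens.measurableE R)).
move=> _ [_ [a [b ->] <-]]; rewrite setTI.
by apply: open_measurable_rV; apply: cf; exact: interval_open.
Qed.

Lemma compact_measurable_rV n (K : set 'rV[R]_n) : compact K -> measurable K.
Proof.
move=> cK; rewrite -[K]setCK; apply: measurableC; apply: open_measurable_rV.
by rewrite openC; exact: compact_closed.
Qed.

End borel_rV.

Section rV_norm.
Context {R : realType} {n : nat}.

Lemma coord_le_norm (x : 'rV[R]_n) i : `|x ord0 i| <= `|x|.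
Proof.
rewrite [leRHS]/Num.norm/= mx_normrE.
exact: (le_bigmax _ (fun k : 'I_1 * 'I_n => `|x k.1 k.2|) (ord0, i)).
Qed.

Lemma norm_le_coord (x : 'rV[R]_n) (M : R) : 0 <= M ->
  (forall i, `|x ord0 i| <= M) -> `|x| <= M.
Proof.
move=> M0 xM; rewrite [leLHS]/Num.norm/= mx_normrE.
by apply/bigmax_leP; split => // -[i j] _ /=; rewrite (ord1 i).
Qed.

End rV_norm.

Section affine_change_of_variables.
Context {R : realType}.
Local Open Scope ereal_scope.

Lemma lebesgue_affine_preimage (c h : R) (A : set R) : c != 0%R ->
  measurable A ->
  lebesgue_measure ((fun a => c * a + h)%R @^-1` A) =
  (`|c|^-1)%:E * lebesgue_measure A.
Proof.
move=> c0 mA.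
pose phi : measurableTypeR R -> measurableTypeR R := fun a => (c * a + h)%R.
have mphi : measurable_fun setT phi.
  by apply: measurable_funD => //; exact: mulrl_measurable.
pose k : {nonneg R} := NngNum (normr_ge0 c).
have -> : lebesgue_measure A = `|c|%:E * lebesgue_measure (phi @^-1` A).
  apply: (@lebesgue_measure_unique R
    (mscale k (pushforward (@lebesgue_measure R) phi))) => // _ [[a b]] _ <- /=.
  rewrite /mscale/= /pushforward lebesgue_measure_itv/=.
  move: c0; rewrite neq_lt => /orP[c0|c0].
  - rewrite (_ : _ @^-1` _ = `[(b - h) / c, (a - h) / c[%classic)%R; last first.
      apply/seteqP; split => x /=; rewrite !in_itv/=.
        rewrite ler_ndivrMr// ltr_ndivlMr// ltrBlDr lerBrDr !(mulrC x).
        by rewrite andbC.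
      rewrite ler_ndivrMr// ltr_ndivlMr// ltrBlDr lerBrDr !(mulrC x).
      by rewrite andbC.
    rewrite lebesgue_measure_itv/= !lte_fin ltr_nM2r ?invr_lt0//.
    rewrite ltrBlDr subrK; case: ifPn => ab; last by rewrite mule0.
    rewrite -!EFinD -EFinM ltr0_norm//; congr (_%:E).
    by field; rewrite lt_eqF.
  - rewrite (_ : _ @^-1` _ = `](a - h) / c, (b - h) / c]%classic)%R; last first.
      apply/seteqP; split => x /=; rewrite !in_itv/=.
        by rewrite ler_pdivlMr// ltr_pdivrMr// ltrBlDr lerBrDr !(mulrC x).
      by rewrite ler_pdivlMr// ltr_pdivrMr// ltrBlDr lerBrDr !(mulrC x).
    rewrite lebesgue_measure_itv/= !lte_fin ltr_pM2r ?invr_gt0//.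
    rewrite ltrBlDr subrK; case: ifPn => ab; last by rewrite mule0.
    rewrite -!EFinD -EFinM gtr0_norm//; congr (_%:E).
    by field; rewrite gt_eqF.
by rewrite muleA -EFinM mulVf ?mul1e// normr_eq0.
Qed.

Lemma ge0_integral_affine (c h : R) (f : R -> \bar R) : c != 0%R ->
  measurable_fun setT f -> (forall x, 0 <= f x) ->
  \int[lebesgue_measure]_a f (c * a + h)%R =
  (`|c|^-1)%:E * \int[lebesgue_measure]_a f a.
Proof.
move=> c0 mf f0.
have mphi : measurable_fun setT
    (fun a : measurableTypeR R => c * a + h : measurableTypeR R)%R.
  by apply: measurable_funD => //; exact: mulrl_measurable.
have := @ge0_integral_pushforward _ _ _ _ _ _ mphi (@lebesgue_measure R) _ f
  measurableT mf (fun y _ => f0 y).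
rewrite preimage_setT => <-.
have c1 : (0 <= `|c|^-1)%R by rewrite invr_ge0.
rewrite -[RHS](@ge0_integral_mscale _ _ _ _ _ _ (NngNum c1))//.
apply: eq_measure_integral => A mA _.
exact: lebesgue_affine_preimage.
Qed.

Lemma ge0_integral_cons n (f : 'rV[R]_n.+1 -> \bar R) :
  measurable_fun setT f -> (forall x, 0 <= f x) ->
  \int[lebesgue_rV R n.+1]_x f x =
  \int[lebesgue_measure]_a \int[lebesgue_rV R n]_v f (consmx (a, v)).
Proof.
move=> mf f0.
have mc : measurable_fun [set: measurableTypeR R * 'rV[R]_n] (@consmx R n).
  exact: measurable_consmx.
rewrite /= /cons_measure.
rewrite (ge0_integral_pushforward mc _ measurableT mf (fun y _ => f0 y)).
rewrite preimage_setT fubini_tonelli1//.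
  exact: measurableT_comp.
by move=> x; exact: f0.
Qed.

Lemma measurable_affine_rV n (c : R) (h : 'rV[R]_n) :
  measurable_fun setT (fun x : 'rV[R]_n => c *: x + h)%R.
Proof.
apply: measurable_fun_rVP => i.
under eq_fun do rewrite !mxE.
apply: measurable_funD => //.
by apply: measurable_funM => //; exact: measurable_coord.
Qed.

(** The coordinates are rescaled and translated one at a time by Tonelli. *)
Lemma ge0_integral_affine_rV n (c : R) (h : 'rV[R]_n) (f : 'rV[R]_n -> \bar R) :
  c != 0%R -> measurable_fun setT f -> (forall x, 0 <= f x) ->
  \int[lebesgue_rV R n]_x f (c *: x + h)%R =
  (`|c| ^- n)%:E * \int[lebesgue_rV R n]_x f x.
Proof.
move=> c0; elim: n h f => [|n IHn] h f mf f0.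
  rewrite expr0 invr1 mul1e /=; apply: eq_integral => x _; congr f.
  by apply/rowP => -[].
have maff := measurable_affine_rV c h.
rewrite !ge0_integral_cons//; last by move=> x; exact: measurableT_comp.
pose h' := (\row_j h ord0 (lift ord0 j))%R : 'rV[R]_n.
transitivity (\int[lebesgue_measure]_a ((`|c| ^- n)%:E *
    \int[lebesgue_rV R n]_v f (consmx (c * a + h ord0 ord0, v)%R))).
  apply: eq_integral => a _.
  rewrite -(IHn h' (fun v => f (consmx (c * a + h ord0 ord0, v)%R)))//; last first.
    apply: measurableT_comp => //.
    by apply: measurableT_comp; [exact: measurable_consmx|exact: measurable_pair1].
  apply: eq_integral => v _; congr f; apply/rowP => j.
  rewrite !mxE; case: unliftP => [k ->|->]; rewrite /= ?mxE//.
have mF : measurable_fun setT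
    (fun a : R => \int[lebesgue_rV R n]_v f (consmx (a, v))).
  apply: (measurable_fun_fubini_tonelli_F (f \o @consmx R n)) => //.
    by apply: measurableT_comp => //; exact: measurable_consmx.
  by move=> x; exact: f0.
have cn0 : (0 <= `|c| ^- n)%R by rewrite invr_ge0 exprn_ge0.
have F0 (a : R) : 0 <= \int[lebesgue_rV R n]_v f (consmx (a, v)).
  by apply: integral_ge0 => v _; exact: f0.
have mFc : measurable_fun setT (fun a : R =>
    \int[lebesgue_rV R n]_v f (consmx (c * a + h ord0 ord0, v)%R)).
  apply: (measurableT_comp mF) => //.
  by apply: measurable_funD => //; exact: mulrl_measurable.
transitivity ((`|c| ^- n)%:E * \int[lebesgue_measure]_a
    \int[lebesgue_rV R n]_v f (consmx (c * a + h ord0 ord0, v)%R)).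
  by apply: ge0_integralZl_EFin => // a _; exact: F0.
rewrite [X in _ * X = _](ge0_integral_affine _ c0 mF F0).
by rewrite muleA -EFinM -invfM -exprSr.
Qed.

Lemma gt0_muleB (r : R) (y z : \bar R) : (0 < r)%R ->
  r%:E * (y - z) = r%:E * y - r%:E * z.
Proof.
move=> r0; have r0' : 0 < r%:E by rewrite lte_fin.
by case: y z => [y| |] [z| |];
  rewrite /= ?(gt0_muley, gt0_muleNy) -?EFinM -?EFinB ?mulrBr.
Qed.

Lemma integral_affine_rV n (c : R) (h : 'rV[R]_n) (f : 'rV[R]_n -> \bar R) :
  c != 0%R -> measurable_fun setT f ->
  \int[lebesgue_rV R n]_x f (c *: x + h)%R =
  (`|c| ^- n)%:E * \int[lebesgue_rV R n]_x f x.
Proof.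
move=> c0 mf; have maff := measurable_affine_rV c h.
rewrite integralE [in RHS]integralE.
rewrite [X in X^\+](_ : _ = f \o (fun x => c *: x + h)%R)//.
rewrite [X in X^\-](_ : _ = f \o (fun x => c *: x + h)%R)//.
have mp := measurable_funepos mf; have mn := measurable_funeneg mf.
rewrite funepos_comp funeneg_comp /= !ge0_integral_affine_rV//.
by rewrite [RHS]gt0_muleB// invr_gt0 exprn_gt0// normr_gt0.
Qed.

Lemma integrable_affine_rV n (c : R) (h : 'rV[R]_n) (f : 'rV[R]_n -> \bar R) :
  c != 0%R -> (lebesgue_rV R n).-integrable setT f ->
  (lebesgue_rV R n).-integrable setT (fun x => f (c *: x + h)%R).
Proof.
move=> c0 /integrableP[mf foo]; apply/integrableP; split.
  by apply: measurableT_comp => //; exact: measurable_affine_rV.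
have mf' : measurable_fun setT (fun x => `|f x|) by exact: measurableT_comp.
rewrite (ge0_integral_affine_rV h c0 mf')//.
by rewrite lte_mul_pinfty// lee_fin invr_ge0 exprn_ge0.
Qed.

Lemma Rintegral_affine_rV n (c : R) (h : 'rV[R]_n) (f : 'rV[R]_n -> R) :
  c != 0%R -> measurable_fun setT f ->
  (\int[lebesgue_rV R n]_x f (c *: x + h) =
  `|c| ^- n * \int[lebesgue_rV R n]_x f x)%R.
Proof.
move=> c0 mf; rewrite /Rintegral.
have mf' : measurable_fun setT (EFin \o f) by exact/measurable_EFinP.
rewrite (integral_affine_rV h c0 mf').
have r0 : (0 < `|c| ^- n)%R by rewrite invr_gt0 exprn_gt0// normr_gt0.
have r0' : 0 < (`|c| ^- n)%:E by rewrite lte_fin.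
by case: (integral _ _ _) => [y| |] /=; rewrite ?(gt0_muley, gt0_muleNy) ?mulr0.
Qed.

Lemma compact_lebesgue_rV_lty n (K : set 'rV[R]_n) :
  compact K -> lebesgue_rV R n K < +oo.
Proof.
move=> cK; have [M0 [_ KM0]] := compact_bounded cK.
pose M := (M0 + 1)%R.
have KM x : K x -> (`|x| <= M)%R by move=> Kx; apply: (KM0 M) => //; rewrite ltrDl.
pose B := [set x : 'rV[R]_n | forall i, `[(- M)%R, M]%classic (x ord0 i)].
have mB : measurable B.
  rewrite (_ : B = \bigcap_(i : 'I_n) (fun x : 'rV[R]_n => x ord0 i) @^-1`
      `[(- M)%R, M]%classic).
    apply: fin_bigcap_measurable => // i _.
    by rewrite -[X in measurable X]setTI; exact: measurable_coord.
  by apply/seteqP; split => [x h i _|x h i]; exact: h.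
have KB : K `<=` B.
  move=> x /KM xM i /=; rewrite in_itv/= -ler_norml.
  exact: le_trans (coord_le_norm x i) xM.
have mK : measurable K by exact: compact_measurable_rV.
apply: (@le_lt_trans _ _ (lebesgue_rV R n B)).
  by apply: le_measure; rewrite ?inE.
rewrite (lebesgue_rV_box (A := fun=> `[(- M)%R, M]%classic))//.
suff : 0 <= \prod_(i < n) lebesgue_measure `[(- M)%R, M]%classic < +oo.
  by case/andP.
elim/big_ind : _ => [|x y /andP[x0 xoo] /andP[y0 yoo]|i _].
- by rewrite lee_fin ler01 ltry.
- by rewrite mule_ge0//= lte_mul_pinfty// ge0_fin_numE.
- by rewrite measure_ge0/= lebesgue_measure_itv/=; case: ifP => // _; rewrite -EFinB ltry.
Qed.

End affine_change_of_variables.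

(** * Calculus of C^k functions *)

Section Ck_calculus.
Context {R : realType} {n : nat}.
Implicit Types (f g : 'rV[R]_n -> R) (x v : 'rV[R]_n) (i j : 'I_n).

Local Notation e_ i := (delta_mx ord0 i : 'rV[R]_n).

Lemma Ck_continuous k f : Ck k f -> continuous f.
Proof. by case: k => [|k] []. Qed.

Lemma CkS k f : Ck k.+1 f -> Ck k f.
Proof.
elim: k f => [|k IHk] f [cf df]; first by [].
by split => // i; have [d dk] := df i; split => //; exact: IHk.
Qed.

Lemma Ck_leq k l f : (k <= l)%N -> Ck l f -> Ck k f.
Proof.
move=> /subnK <-; elim: (l - k)%N => // m IHm /CkS; exact: IHm.
Qed.

Lemma Ck_partial k i f : Ck k.+1 f -> Ck k (partial i f).
Proof. by case=> _ /(_ i)[]. Qed.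

Lemma Ck_derivable k i f x : Ck k.+1 f -> derivable f x (e_ i).
Proof. by case=> _ /(_ i)[]. Qed.

Lemma Ck_cst k (c : R) : Ck k (cst c : 'rV[R]_n -> R).
Proof.
elim: k c => [|k IHk] c; split => //; try exact: cst_continuous.
move=> i; split; first by move=> x; exact: derivable_cst.
rewrite (_ : partial i _ = cst 0); first exact: IHk.
by apply/funext => x; rewrite /partial derive_cst.
Qed.

Lemma CkD k f g : Ck k f -> Ck k g -> Ck k (f \+ g).
Proof.
elim: k f g => [|k IHk] f g [cf df] [cg dg]; split => //.
- by move=> x; apply: continuousD; [exact: cf|exact: cg].
- by move=> x; apply: continuousD; [exact: cf|exact: cg].
- move=> i; have [df1 df2] := df i; have [dg1 dg2] := dg i; split.
    by move=> x; exact: derivableD.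
  rewrite (_ : partial i _ = partial i f \+ partial i g); first exact: IHk.
  by apply/funext => x; rewrite /partial deriveD.
Qed.

Lemma partialM i f g x : derivable f x (e_ i) -> derivable g x (e_ i) ->
  partial i (f \* g) x = f x * partial i g x + g x * partial i f x.
Proof. exact: (@deriveM R _ f g x (e_ i)). Qed.

Lemma CkM k f g : Ck k f -> Ck k g -> Ck k (f \* g).
Proof.
elim: k f g => [|k IHk] f g [cf df] [cg dg]; split => //.
- by move=> x; apply: continuousM; [exact: cf|exact: cg].
- by move=> x; apply: continuousM; [exact: cf|exact: cg].
- move=> i; have [df1 df2] := df i; have [dg1 dg2] := dg i; split.
    by move=> x; exact: derivableM.
  rewrite (_ : partial i _ = (f \* partial i g) \+ (g \* partial i f)).
    by apply: CkD; apply: IHk => //; apply: CkS; split.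
  by apply/funext => x; rewrite partialM.
Qed.

Lemma Ck_sum k (I : Type) (r : seq I) (F : I -> 'rV[R]_n -> R) :
  (forall l, Ck k (F l)) -> Ck k (fun x => \sum_(l <- r) F l x).
Proof.
move=> CF; elim: r => [|l r IHr].
  by under eq_fun do rewrite big_nil; exact: Ck_cst.
by under eq_fun do rewrite big_cons; exact: CkD.
Qed.

(** Directional derivatives are derivatives of one-variable functions; this
    lets the one-variable theory do the work below. *)
Lemma line_quotient f x v :
  (fun h : R => h^-1 *: (f (h *: v + x) - f x)) =
  (fun h : R => h^-1 *: (f (x + (h *: 1 + 0 : R^o) *: v) - f (x + (0 : R) *: v))).
Proof.
apply/funext => h; rewrite addr0 scale0r addr0; congr (_ *: (f _ - _)).
by rewrite addrC; congr (_ + _ *: _); rewrite /GRing.scale/= mulr1.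
Qed.

Lemma is_derive_line f x v (t : R) : derivable f (x + t *: v) v ->
  is_derive t (1 : R) (fun s : R => f (x + s *: v)) ('D_v f (x + t *: v)).
Proof.
move=> df.
have E : (fun h : R => h^-1 *: (f (h *: v + (x + t *: v)) - f (x + t *: v))) =
    (fun h : R => h^-1 *: (f (x + (h *: 1 + t : R^o) *: v) - f (x + t *: v))).
  apply/funext => h; congr (_ *: (f _ - _)).
  rewrite addrCA; congr (_ + _); rewrite scalerDl; congr (_ *: _ + _).
  by rewrite /GRing.scale/= mulr1.
by split; [rewrite /derivable -E|rewrite /derive -E].
Qed.

Lemma is_derive_scale_arg (G : R -> R) (c t a : R) :
  is_derive (c * t) 1 G a -> is_derive t 1 (fun s => G (c * s)) (c * a).
Proof.
move=> dG.
have dc : is_derive t (1 : R) (c \*: (@id R)) (c *: (1 : R)).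
  exact: is_deriveZ.
have := @is_derive1_comp _ G (c \*: (@id R)) t _ _ dG dc.
by rewrite /GRing.scale/= mulr1 mulrC.
Qed.

Lemma derive_affine f (c : R) (b x v : 'rV[R]_n) :
  derivable f (c *: x + b) v ->
  derivable (fun y => f (c *: y + b)) x v /\
  'D_v (fun y => f (c *: y + b)) x = c * 'D_v f (c *: x + b).
Proof.
move=> df.
pose G (s : R) := f (c *: x + b + s *: v).
have dG : is_derive (0 : R) (1 : R) (fun s => G (c * s))
    (c * 'D_v f (c *: x + b)).
  apply: is_derive_scale_arg.
  have E0 : c *: x + b + (c * 0) *: v = c *: x + b.
    by rewrite mulr0 scale0r addr0.
  by rewrite -[X in 'D_v f X]E0; apply: is_derive_line; rewrite E0.
have E : (fun h : R => h^-1 *: (f (c *: (h *: v + x) + b) - f (c *: x + b))) =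
    (fun h : R => h^-1 *: ((fun s => G (c * s)) (h *: 1 + 0 : R^o) -
                           (fun s => G (c * s)) 0)).
  apply/funext => h; rewrite /G/= mulr0 scale0r addr0 addr0.
  congr (_ *: (f _ - _)); rewrite scalerDr scalerA -addrA addrC.
  by congr (_ + (_ * _) *: _); rewrite /GRing.scale/= mulr1.
by move: dG => [d1 d2]; split; [rewrite /derivable E|rewrite /derive E].
Qed.

Lemma Ck_affine k f (c : R) (b : 'rV[R]_n) :
  Ck k f -> Ck k (fun y => f (c *: y + b)).
Proof.
have caff : continuous (fun y : 'rV[R]_n => c *: y + b).
  move=> y; apply: continuousD; last exact: cst_continuous.
  exact: (@scaler_continuous _ _ c y).
elim: k f => [|k IHk] f [cf df]; split => //.
- by move=> x; apply: continuous_comp; [exact: caff|exact: cf].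
- by move=> x; apply: continuous_comp; [exact: caff|exact: cf].
- move=> i; have [df1 df2] := df i; split.
    by move=> x; have [] := derive_affine (df1 (c *: x + b)).
  rewrite (_ : partial i _ = cst c \* (fun y => partial i f (c *: y + b))).
    by apply: CkM; [exact: Ck_cst|exact: IHk].
  by apply/funext => x; have [_ ?] := derive_affine (df1 (c *: x + b)).
Qed.

Lemma partial_affine i f (c : R) (b : 'rV[R]_n) :
  (forall x, derivable f x (e_ i)) ->
  partial i (fun y => f (c *: y + b)) = fun y => c * partial i f (c *: y + b).
Proof.
by move=> df; apply/funext => x; have [_] := derive_affine (df (c *: x + b)).
Qed.

Lemma mvt_line f i x (s : R) : (forall y, derivable f y (e_ i)) ->
  exists2 t : R, `|t| <= `|s| &
    f (x + s *: e_ i) - f x = s * partial i f (x + t *: e_ i).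
Proof.
move=> df.
pose G (t : R) := f (x + (s * t) *: e_ i).
have dG t : is_derive (t : R) (1 : R) G (s * partial i f (x + (s * t) *: e_ i)).
  by apply: (is_derive_scale_arg (G := fun r => f (x + r *: e_ i)));
    exact: is_derive_line.
have cG : {within `[0, 1], continuous G}.
  apply: continuous_subspaceT => t.
  by apply: differentiable_continuous; apply/derivable1_diffP; exact: ex_derive.
have [t + Gt] := MVT ltr01 (fun t _ => dG t) cG.
rewrite in_itv/= => /andP[t0 t1]; exists (s * t).
  by rewrite normrM ler_piMr// ger0_norm// ltW.
by move: Gt; rewrite /G mulr0 scale0r addr0 subr0 !mulr1.
Qed.

(** Changing the coordinates one after the other and using the mean value
    theorem each time expresses an increment by the partial derivatives; the
    derivative in any direction and Lipschitz bounds come from here. *)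
Lemma mean_value f x v : (forall i y, derivable f y (e_ i)) ->
  exists2 w : 'I_n -> 'rV[R]_n, (forall k, `|w k| <= `|v|) &
    f (x + v) - f x = \sum_(k < n) v ord0 k * partial k f (x + w k).
Proof.
move=> df.
pose pre k : 'rV[R]_n := \row_j (if (j < k)%N then v ord0 j else 0).
have preS (k : 'I_n) : pre k.+1 = pre k + v ord0 k *: e_ k.
  apply/rowP => j; rewrite !mxE eqxx/= ltnS leq_eqVlt.
  have [->|jk] := eqVneq j k; first by rewrite eqxx ltnn mulr1 add0r.
  by rewrite mulr0 addr0 (_ : (j == k :> nat) = false)//; apply/negbTE.
have H (k : 'I_n) : exists w : 'rV[R]_n, `|w| <= `|v| /\
    f (x + pre k.+1) - f (x + pre k) = v ord0 k * partial k f (x + w).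
  have [t tv E] := mvt_line (x + pre k) (v ord0 k) (df k).
  exists (pre k + t *: e_ k); split; last by rewrite preS !addrA.
  apply: norm_le_coord => // j; rewrite !mxE eqxx/=.
  have [->|jk] := eqVneq j k.
    by rewrite ltnn add0r mulr1 (le_trans tv)// coord_le_norm.
  rewrite mulr0 addr0; case: ifP => _; first exact: coord_le_norm.
  by rewrite normr0.
have [w wP] := choice H.
exists w; first by move=> k; have [] := wP k.
rewrite -(eq_bigr _ (fun k _ => (wP k).2)).
rewrite -(big_mkord xpredT (fun k => f (x + pre k.+1) - f (x + pre k))).
rewrite telescope_sumr//; congr (f (_ + _) - f _).
  by apply/rowP => j; rewrite !mxE ltn_ord.
by rewrite (_ : pre 0%N = 0) ?addr0//; apply/rowP => j; rewrite !mxE.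
Qed.

Lemma cvg_partial_near k f x (w : R -> 'rV[R]_n) (M : R) :
  continuous (partial k f) -> (forall h, `|w h| <= `|h| * M) ->
  partial k f (x + w h) @[h --> 0^'] --> partial k f x.
Proof.
move=> cf wM; apply: continuous_cvg; first exact: cf.
rewrite -[X in _ --> X]addr0; apply: cvgD; first exact: cvg_cst.
apply/cvgr0Pnorm_le => e e0.
have M0 : 0 < `|M| + 1 by rewrite ltr_wpDl.
near=> h.
apply: (le_trans (wM h)).
apply: (@le_trans _ _ (`|h| * (`|M| + 1))).
  by rewrite ler_wpM2l// (le_trans (ler_norm _))// lerDl.
rewrite -ler_pdivlMr// ltW//.
near: h; apply: dnbhs0_lt; by rewrite divr_gt0.
Unshelve. all: by end_near. Qed.

(** [mean_value] together with the continuity of the partial derivatives. *)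
Lemma C1_derive f x v : Ck 1 f ->
  derivable f x v /\ 'D_v f x = \sum_(k < n) v ord0 k * partial k f x.
Proof.
move=> C1f.
have df i y : derivable f y (e_ i) by exact: Ck_derivable C1f.
have H (h : R) : exists w : 'I_n -> 'rV[R]_n, (forall k, `|w k| <= `|h| * `|v|) /\
    f (h *: v + x) - f x = h * \sum_(k < n) v ord0 k * partial k f (x + w k).
  have [w w1 w2] := mean_value x (h *: v) df.
  exists w; split; first by move=> k; rewrite -normrZ.
  rewrite (addrC (h *: v)) w2 mulr_sumr; apply: eq_bigr => k _.
  by rewrite !mxE mulrA.
have [w wP] := choice H.
suff : h^-1 *: (f (h *: v + x) - f x) @[h --> 0^'] -->
    \sum_(k < n) v ord0 k * partial k f x.
  by move=> cv; split; [apply/cvg_ex; eexists; exact: cv|exact/cvg_lim].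
have : \sum_(k < n) v ord0 k * partial k f (x + w h k) @[h --> 0^'] -->
    \sum_(k < n) v ord0 k * partial k f x.
  apply: cvg_big => [|k _]; first exact: add_continuous.
  apply: cvgM; first exact: cvg_cst.
  apply: (@cvg_partial_near _ _ _ (fun h => w h k) `|v|).
    by apply: Ck_continuous; exact: Ck_partial C1f.
  by move=> h; have [] := wP h.
apply: cvg_trans; apply: near_eq_cvg; near=> h.
have h0 : h != 0 by near: h; exact: nbhs_dnbhs_neq.
by rewrite (wP h).2 /GRing.scale/= mulKf.
Unshelve. all: by end_near. Qed.

(** The second difference of f in directions i and j is a mixed second
    derivative at a nearby point, in either order. *)
Lemma partialC i j f : Ck 2 f -> partial i (partial j f) = partial j (partial i f).
Proof.
move=> C2f; apply/funext => x.
have df k y : derivable f y (e_ k) by exact: Ck_derivable C2f.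
have ddf k l y : derivable (partial k f) y (e_ l).
  by apply: Ck_derivable; exact: Ck_partial C2f.
have diff k l (h : R) : exists w : 'rV[R]_n, `|w| <= `|h| * 2 /\
   f (x + h *: e_ k + h *: e_ l) - f (x + h *: e_ k) -
     (f (x + h *: e_ l) - f x) = h * (h * partial l (partial k f) (x + w)).
  pose G y := f (y + h *: e_ l) - f y.
  have dG y : is_derive y (e_ k) G (partial k f (y + h *: e_ l) - partial k f y).
    have [d1 d2] := @derive_affine f 1 (h *: e_ l) y (e_ k)
      (df _ (1 *: y + h *: e_ l)).
    move: d1 d2; under eq_fun do rewrite scale1r.
    rewrite scale1r mul1r => d1 d2.
    have : is_derive y (e_ k) (fun z => f (z + h *: e_ l))
      (partial k f (y + h *: e_ l)) by split.
    by move=> ?; apply: is_deriveB; split.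
  have [s sh Gs] := mvt_line x h (fun y => @ex_derive _ _ _ _ _ _ _ (dG y)).
  have [t th Ft] := mvt_line (x + s *: e_ k) h (ddf k l).
  exists (s *: e_ k + t *: e_ l); split.
    have n1 m : `|e_ m| <= 1 :> R.
      apply: norm_le_coord => // q; rewrite !mxE eqxx/=.
      by case: (_ == _); rewrite ?normr1 ?normr0.
    rewrite (le_trans (ler_normD _ _))// mulr_natr mulr2n.
    rewrite lerD// normrZ.
      by apply: le_trans sh; rewrite ler_piMr.
    by apply: le_trans th; rewrite ler_piMr.
  rewrite -/(G (x + h *: e_ k)) -/(G x) Gs; congr (_ * _).
  by rewrite /partial derive_val Ft addrA.
have cij k l : continuous (partial l (partial k f)).
  by apply: Ck_continuous; do 2 apply: Ck_partial; exact: C2f.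
have [a aP] := choice (diff j i); have [b bP] := choice (diff i j).
have ca := @cvg_partial_near i (partial j f) x a 2 (cij _ _) (fun h => (aP h).1).
have cb := @cvg_partial_near j (partial i f) x b 2 (cij _ _) (fun h => (bP h).1).
apply: (cvg_unique _ ca); first exact: Rhausdorff.
apply: cvg_trans cb; apply: near_eq_cvg; near=> h.
have h0 : h != 0 by near: h; exact: nbhs_dnbhs_neq.
apply: (mulfI h0); apply: (mulfI h0).
apply: (eq_trans (esym (bP h).2)); apply: (eq_trans _ (aP h).2).
rewrite [X in _ = f X - _ - _]addrAC.
by move: (f _) (f _) (f _) (f _) => p q r s; ring.
Unshelve. all: by end_near. Qed.

(** Away from the support of f the function vanishes in a neighbourhood. *)
Lemma support_partial i f : closure [set x | partial i f x != 0] `<=`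
  closure [set x | f x != 0].
Proof.
have <- : closure (closure [set x | f x != 0]) = closure [set x | f x != 0].
  by apply/esym/closure_id; exact: closed_closure.
apply: closureS => x /= Dx; apply: contrapT => xf; move/eqP: Dx; apply.
have /nbhs_ballP[e /= e0 xe] : nbhs x (~` closure [set x | f x != 0]).
  apply: open_nbhs_nbhs; split => //; apply: closed_openC; exact: closed_closure.
have fe y : ball x e y -> f y = 0.
  by move=> /xe /= yf; apply: contrapT => /eqP fy; apply: yf; exact: subset_closure.
transitivity ('D_(e_ i) (cst 0 : 'rV[R]_n -> R) x); last exact: derive_cst.
apply: near_eq_derive; apply/nbhs_ballP; exists e => //.
Qed.

Lemma compact_support_sub f g : closure [set x | f x != 0] `<=`
  closure [set x | g x != 0] -> compact_support g -> compact_support f.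
Proof.
by move=> fg cg; apply: subclosed_compact fg => //; exact: closed_closure.
Qed.

Lemma Ckc_partial k i f : Ckc k.+1 f -> Ckc k (partial i f).
Proof.
move=> [Cf cf]; split; first exact: Ck_partial.
exact: compact_support_sub (@support_partial i f) cf.
Qed.

Lemma compact_supportM f g : compact_support f -> compact_support (f \* g).
Proof.
apply: compact_support_sub; apply: closureS => x /=.
by apply: contra => /eqP ->; rewrite mul0r.
Qed.

Lemma Ckc_bounded k f : Ckc k f -> exists M, forall x, `|f x| <= M.
Proof.
move=> [Cf cf].
have [M0 [_ KM0]] : bounded_set (f @` closure [set x | f x != 0]).
  apply: compact_bounded; apply: continuous_compact => //.
  by apply: continuous_subspaceT; exact: Ck_continuous Cf.
exists (`|M0| + 1) => x.
have [->|fx] := eqVneq (f x) 0; first by rewrite normr0 addr_ge0.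
apply: (KM0 (`|M0| + 1)).
  by rewrite (le_lt_trans (ler_norm _))// ltrDl.
by exists x => //; exact: subset_closure.
Qed.

End Ck_calculus.

(** * Smooth cutoff functions *)

Section smooth_functions.
Context {R : realType}.

(** The functions t^-m exp(-1/t), extended by 0. The derivative of one of them is
    a combination of two others, which makes smoothness an induction on the
    order of differentiation. *)
Definition flat_exp (m : nat) (t : R) : R :=
  if 0 < t then t ^- m * expR (- t^-1) else 0.

Lemma flat_exp_ge0 m t : 0 <= flat_exp m t.
Proof.
rewrite /flat_exp; case: ifPn => // t0.
by rewrite mulr_ge0 ?expR_ge0// invr_ge0 exprn_ge0// ltW.
Qed.

Lemma flat_exp_gt0 m t : 0 < t -> 0 < flat_exp m t.
Proof.
by move=> t0; rewrite /flat_exp t0 mulr_gt0 ?expR_gt0// invr_gt0 exprn_gt0.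
Qed.

Lemma flat_exp_le0 m t : t <= 0 -> flat_exp m t = 0.
Proof. by rewrite /flat_exp ltNge => ->. Qed.

(** From the series of exp(1/t). Applied to m + 1, it shows that the difference
    quotients of [flat_exp m] at 0 tend to 0. *)
Lemma flat_exp_le m t : flat_exp m t <= (m.+1)`!%:R * `|t|.
Proof.
have [t0|t0] := leP t 0; first by rewrite flat_exp_le0// mulr_ge0.
rewrite /flat_exp t0 gtr0_norm// expRN ler_pdivrMr ?expR_gt0//.
have ti0 : 0 <= t^-1 by rewrite invr_ge0 ltW.
have := expR_ge1Dxn m ti0.
have F0 : 0 < (m.+1)`!%:R :> R by rewrite ltr0n fact_gt0.
move=> /(le_trans _) -/(_ (t^-1 ^+ m.+1 / m.+1`!%:R)) /(_ _)/=.
rewrite lerDr ler01 => /(_ isT) h.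
rewrite -ler_pdivrMl ?mulr_gt0//; apply: le_trans h.
rewrite invfM exprVn exprS invfM [leRHS]mulrC -!mulrA.
by [].
Qed.

Lemma is_derive_flat_exp m (t : R) : is_derive t (1 : R) (flat_exp m)
  (- m%:R * flat_exp m.+1 t + flat_exp m.+2 t).
Proof.
have [t0|t0|->] := ltgtP t 0.
- rewrite !flat_exp_le0 ?ltW// mulr0 addr0.
  apply: (@near_eq_is_derive _ _ _ (cst 0)).
  near=> s; rewrite flat_exp_le0// ltW//.
  by near: s; exact: lt_nbhsl.
- have tn0 : t != 0 by rewrite gt_eqF.
  have d1 : is_derive t (1 : R) (fun s : R => s^-1) (- t ^- 2).
    have := @is_deriveV R id t 1 1 tn0 (is_derive_id _ _).
    by rewrite /GRing.scale/= mulr1.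
  have d2 : is_derive t (1 : R) (fun s : R => expR (- s^-1))
      (expR (- t^-1) * t ^- 2).
    have := @is_derive1_comp R expR (fun s => - s^-1) t _ _ _ (is_deriveN d1).
    rewrite opprK; apply; exact: is_derive_expR.
  have d3 : is_derive t (1 : R) (fun s : R => s ^- m) (- m%:R * t ^- m.+1).
    have dX : is_derive t (1 : R) (fun s : R => s ^+ m) (m%:R * t ^+ m.-1).
      have := @is_deriveX R _ id m t 1 1 (is_derive_id _ _).
      have -> : id ^+ m = (fun s : R => s ^+ m).
        by apply/funext => s; rewrite exprfctE.
      by rewrite /GRing.scale/= mulr1 -mulr_natl.
    have := @is_deriveV R (fun s => s ^+ m) t _ 1 _ dX.
    rewrite expf_neq0// => /(_ isT).
    rewrite /GRing.scale/= (_ : - _ * _ = - m%:R * t ^- m.+1)//.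
    case: m {dX} => [|m]; first by rewrite !(mul0r, mulr0, oppr0).
    by rewrite [m.+1.-1]/= !exprS; field; rewrite tn0 expf_neq0.
  have dF := @is_deriveM R _ _ _ _ _ _ _ d3 d2.
  rewrite (_ : - m%:R * flat_exp m.+1 t + flat_exp m.+2 t =
      t ^- m *: (expR (- t^-1) * t ^- 2) + expR (- t^-1) *: (- m%:R * t ^- m.+1)).
    refine (near_eq_is_derive _ dF); near=> s; rewrite /flat_exp ifT//.
    by near: s; exact: lt_nbhsr.
  rewrite /flat_exp t0 /GRing.scale/= !exprS.
  by move: (expR _) (m%:R) => E M; field; rewrite tn0 expf_neq0.
- rewrite !flat_exp_le0// mulr0 addr0.
  have cv : h^-1 *: (flat_exp m (h *: 1 + 0) - flat_exp m 0) @[h --> 0^'] --> 0.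
    apply/cvgr0Pnorm_le => e e0; near=> h.
    have h0 : h != 0 by near: h; exact: nbhs_dnbhs_neq.
    rewrite (_ : h *: 1 + 0 = h); last by rewrite addr0 /GRing.scale/= mulr1.
    rewrite [X in _ - X]flat_exp_le0// subr0 /GRing.scale/=.
    rewrite (_ : h^-1 * flat_exp m h = flat_exp m.+1 h); last first.
      rewrite /flat_exp; case: ifP => _; last by rewrite mulr0.
      by rewrite exprS invfM mulrA.
    rewrite ger0_norm ?flat_exp_ge0// (le_trans (flat_exp_le _ _))//.
    rewrite mulrC -ler_pdivlMr ?ltr0n ?fact_gt0// ltW//.
    by near: h; apply: dnbhs0_lt; rewrite divr_gt0// ltr0n fact_gt0.
  by split; [apply/cvg_ex; exists 0; exact: cv|exact/cvg_lim].
Unshelve. all: by end_near. Qed.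

Lemma continuous_flat_exp m : continuous (flat_exp m).
Proof.
move=> t; apply: differentiable_continuous; apply/derivable1_diffP.
by have [] := is_derive_flat_exp m t.
Qed.

Context {n : nat}.
Implicit Types (f u : 'rV[R]_n -> R) (x : 'rV[R]_n).

Lemma is_derive_comp1 (g : R -> R) u x (v : 'rV[R]_n) (a : R) :
  derivable u x v -> is_derive (u x) (1 : R) g a ->
  is_derive x v (g \o u) (a * 'D_v u x).
Proof.
move=> du dg.
have du' : derivable u (x + (0 : R) *: v) v by rewrite scale0r addr0.
have := is_derive_line du'; rewrite scale0r addr0 => dl.
have dg' : is_derive (u (x + (0 : R) *: v)) (1 : R) g a by rewrite scale0r addr0.
have := @is_derive1_comp R g (fun s => u (x + s *: v)) 0 _ _ dg' dl.
have E := line_quotient (g \o u) x v.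
by move=> [d1 d2]; split; [rewrite /derivable E|rewrite /derive E].
Qed.

Lemma Ck_flat_exp k m u : Ck k u -> Ck k (flat_exp m \o u).
Proof.
elim: k m => [|k IHk] m Cu.
  split => // x; apply: continuous_comp; first exact: (Ck_continuous Cu).
  exact: continuous_flat_exp.
split.
  move=> x; apply: continuous_comp; first exact: (Ck_continuous Cu).
  exact: continuous_flat_exp.
move=> i.
have D x := @is_derive_comp1 _ u x (delta_mx ord0 i) _ (@Ck_derivable _ _ _ i _ x Cu)
  (is_derive_flat_exp m (u x)).
split; first by move=> x; have [] := D x.
rewrite (_ : partial i _ =
  ((cst (- m%:R) \* (flat_exp m.+1 \o u)) \+ (flat_exp m.+2 \o u)) \*
  partial i u).
  have Cu' := CkS Cu.
  apply: CkM; last exact: Ck_partial.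
  by apply: CkD; [apply: CkM; [exact: Ck_cst|exact: IHk]|exact: IHk].
by apply/funext => x; rewrite /partial; have [_ ->] := D x.
Qed.

Lemma Ck_inv k u : (forall x, u x != 0) -> Ck k u -> Ck k (fun x => (u x)^-1).
Proof.
move=> u0; elim: k => [|k IHk] Cu.
  by split => // x; apply: continuousV => //; exact: (Ck_continuous Cu).
have cu := Ck_continuous Cu.
split; first by move=> x; apply: continuousV => //; exact: cu.
move=> i.
have D x : is_derive x (delta_mx ord0 i) (fun y => (u y)^-1)
    (- ((u x)^-1 * (u x)^-1) * partial i u x).
  have dV : is_derive (u x) (1 : R) (fun s : R => s^-1) (- ((u x)^-1 * (u x)^-1)).
    have := @is_deriveV R id (u x) 1 1 (u0 x) (is_derive_id _ _).
    by rewrite /GRing.scale/= mulr1 expr2 invfM.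
  exact: (is_derive_comp1 (@Ck_derivable _ _ _ i _ x Cu) dV).
split; first by move=> x; have [] := D x.
rewrite (_ : partial i _ =
  (cst (-1) \* ((fun x => (u x)^-1) \* (fun x => (u x)^-1))) \* partial i u).
  have Cu' := CkS Cu.
  apply: CkM; last exact: Ck_partial.
  by apply: CkM; [exact: Ck_cst|apply: CkM; exact: IHk].
by apply/funext => x; rewrite /partial; have [_ ->] := D x; rewrite /= mulN1r.
Qed.

Lemma Ck_coord k i : Ck k (fun x : 'rV[R]_n => x ord0 i).
Proof.
have ccoord : continuous (fun x : 'rV[R]_n => x ord0 i) by exact: coord_continuous.
case: k => [|k]; split => // j.
have D (x : 'rV[R]_n) : is_derive x (delta_mx ord0 j)
    (fun x : 'rV[R]_n => x ord0 i) ((i == j)%:R : R).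
  have cv : h^-1 *: ((h *: (delta_mx ord0 j : 'rV[R]_n) + x) ord0 i - x ord0 i)
      @[h --> (0 : R)^'] --> ((i == j)%:R : R).
    apply: cvg_near_cst; near=> h.
    have h0 : h != 0 by near: h; exact: nbhs_dnbhs_neq.
    by rewrite !mxE eqxx addrK /GRing.scale/= mulKf.
  by split; [apply/cvg_ex; eexists; exact: cv|exact/cvg_lim].
split; first by move=> x; have [] := D x.
rewrite (_ : partial j _ = cst (i == j)%:R); first exact: Ck_cst.
by apply/funext => x; rewrite /partial; have [_ ->] := D x.
Unshelve. all: by end_near. Qed.

Definition smooth_step (t : R) : R :=
  flat_exp 0 t / (flat_exp 0 t + flat_exp 0 (1 - t)).

Lemma smooth_step_den t : 0 < flat_exp 0 t + flat_exp 0 (1 - t).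
Proof.
have [t0|t0] := ltP 0 t.
  by rewrite ltr_pwDl ?flat_exp_ge0// flat_exp_gt0.
by rewrite ltr_wpDl ?flat_exp_ge0// flat_exp_gt0// subr_gt0 (le_lt_trans t0).
Qed.

Lemma smooth_step_ge0 t : 0 <= smooth_step t.
Proof. by rewrite divr_ge0 ?flat_exp_ge0// ltW// smooth_step_den. Qed.

Lemma smooth_step_le1 t : smooth_step t <= 1.
Proof.
by rewrite ler_pdivrMr ?smooth_step_den// mul1r lerDl flat_exp_ge0.
Qed.

Lemma smooth_step_le0 t : t <= 0 -> smooth_step t = 0.
Proof. by move=> t0; rewrite /smooth_step flat_exp_le0// mul0r. Qed.

Lemma smooth_step_ge1 t : 1 <= t -> smooth_step t = 1.
Proof.
move=> t1; rewrite /smooth_step [X in _ + X]flat_exp_le0 ?subr_le0// addr0.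
by rewrite divff// gt_eqF// flat_exp_gt0// (lt_le_trans ltr01).
Qed.

Lemma Ck_smooth_step k u : Ck k u -> Ck k (smooth_step \o u).
Proof.
move=> Cu; apply: CkM; first exact: Ck_flat_exp.
apply: Ck_inv; first by move=> x; rewrite gt_eqF// smooth_step_den.
apply: CkD; first exact: Ck_flat_exp.
apply: (Ck_flat_exp 0 (u := fun x => 1 - u x)).
rewrite (_ : (fun _ => _) = cst 1 \+ (cst (-1) \* u)).
  by apply: CkD; [exact: Ck_cst|apply: CkM => //; exact: Ck_cst].
by apply/funext => x /=; rewrite mulN1r.
Qed.

Definition sqnorm x : R := \sum_(i < n) x ord0 i ^+ 2.

Lemma Ck_sqnorm k : Ck k sqnorm.
Proof.
by apply: Ck_sum => i; under eq_fun do rewrite expr2; apply: CkM; exact: Ck_coord.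
Qed.

Lemma sqnorm_ge0 x : 0 <= sqnorm x.
Proof. by apply: sumr_ge0 => i _; exact: sqr_ge0. Qed.

Lemma norm_le_sqnorm x : `|x| ^+ 2 <= sqnorm x.
Proof.
rewrite -[leRHS]sqr_sqrtr ?sqnorm_ge0// ler_pXn2r ?nnegrE ?sqrtr_ge0//.
apply: norm_le_coord => [|i]; first exact: sqrtr_ge0.
rewrite -sqrtr_sqr ler_sqrt ?sqnorm_ge0// /sqnorm (bigD1 i)//= lerDl.
by apply: sumr_ge0 => j _; exact: sqr_ge0.
Qed.

Lemma sqnorm_le_norm x : sqnorm x <= n%:R * `|x| ^+ 2.
Proof.
have -> : n%:R * `|x| ^+ 2 = \sum_(i < n) `|x| ^+ 2.
  by rewrite sumr_const card_ord mulr_natl.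
apply: ler_sum => i _.
by rewrite -real_normK ?num_real// ler_pXn2r ?nnegrE// coord_le_norm.
Qed.

Lemma sqnormZ (c : R) x : sqnorm (c *: x) = c ^+ 2 * sqnorm x.
Proof.
by rewrite /sqnorm mulr_sumr; apply: eq_bigr => i _; rewrite mxE exprMn.
Qed.

(** A smooth function that is 1 where [sqnorm x <= r^2] and vanishes where
    [sqnorm x >= 2 r^2]. *)
Definition cutoff (r : R) x : R := smooth_step (2 - sqnorm (r^-1 *: x)).

Lemma cutoff_itv r x : 0 <= cutoff r x <= 1.
Proof. by rewrite smooth_step_ge0 smooth_step_le1. Qed.

Lemma Ck_cutoff k r : Ck k (cutoff r).
Proof.
rewrite (_ : cutoff r = smooth_step \o (fun x => 2 - sqnorm (r^-1 *: x + 0))).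
  apply: Ck_smooth_step.
  apply: (@Ck_affine _ _ k (fun x => 2 - sqnorm x)).
  rewrite (_ : (fun _ => _) = cst 2 \+ (cst (-1) \* sqnorm)).
    by apply: CkD; [exact: Ck_cst|apply: CkM => //; [exact: Ck_cst|exact: Ck_sqnorm]].
  by apply/funext => x /=; rewrite mulN1r.
by apply/funext => x /=; rewrite addr0.
Qed.

Lemma compact_norm_le (r : R) : compact [set x : 'rV[R]_n | `|x| <= r].
Proof.
apply: bounded_closed_compact.
  exists r; split; first exact: num_real.
  by move=> M rM x /= xr; rewrite (le_trans xr)// ltW.
rewrite (_ : [set x | _] = (@Num.norm R 'rV[R]_n) @^-1` [set y | y <= r])//.
by apply: closed_comp; [move=> x _; exact: norm_continuous|exact: closed_le].
Qed.

Lemma compact_support_norm f (r : R) :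
  (forall x, r < `|x| -> f x = 0) -> compact_support f.
Proof.
move=> fr; apply: (@subclosed_compact _ _ [set x | `|x| <= r]).
- exact: closed_closure.
- exact: compact_norm_le.
have cl : closed [set x : 'rV[R]_n | `|x| <= r].
  by apply: compact_closed; [exact: norm_hausdorff|exact: compact_norm_le].
rewrite [X in _ `<=` X](closure_id _).1//; apply: closureS => x /=.
by apply: contraPT; rewrite -ltNge => /fr ->; rewrite eqxx.
Qed.

Lemma compact_support_bound f : compact_support f ->
  exists2 r : R, 0 < r & forall x, r < `|x| -> f x = 0.
Proof.
move=> cf; have [M0 [_ KM0]] := compact_bounded cf.
exists (`|M0| + 1) => [|x]; first by rewrite ltr_wpDl.
apply: contraTeq => fx; rewrite -leNgt.
apply: (KM0 (`|M0| + 1)); first by rewrite (le_lt_trans (ler_norm _))// ltrDl.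
exact: subset_closure.
Qed.

Lemma cutoff_eq1 r x : 0 < r -> n%:R * `|x| ^+ 2 <= r ^+ 2 -> cutoff r x = 1.
Proof.
move=> r0 xr; apply: smooth_step_ge1; rewrite sqnormZ exprVn lerBrDr.
rewrite -lerBrDl (_ : 2 - 1 = 1); last by ring.
rewrite mulrC ler_pdivrMr ?exprn_gt0// mul1r.
exact: le_trans (sqnorm_le_norm _) xr.
Qed.

Lemma cutoff_eq0 r x : 0 < r -> 2 * r < `|x| -> cutoff r x = 0.
Proof.
move=> r0 xr; apply: smooth_step_le0; rewrite sqnormZ exprVn subr_le0.
rewrite mulrC ler_pdivlMr ?exprn_gt0//.
apply: le_trans (norm_le_sqnorm x).
have : (2 * r) ^+ 2 <= `|x| ^+ 2.
  by rewrite ler_pXn2r ?nnegrE ?normr_ge0 ?mulr_ge0//; exact: ltW.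
by apply: le_trans; rewrite exprMn ler_pM2r ?exprn_gt0//; lra.
Qed.

Lemma test_cutoff r : 0 < r -> test_function (cutoff r).
Proof.
move=> r0; split => [k|]; first exact: Ck_cutoff.
by apply: (@compact_support_norm _ (2 * r)) => x; exact: cutoff_eq0.
Qed.

End smooth_functions.

(** * Real-valued integrals and smooth approximation of indicators *)

Section real_integrals.
Context d (T : measurableType d) {R : realType} (mu : {measure set T -> \bar R}).
Implicit Types (f g h : T -> R).

Local Notation intble f := (mu.-integrable setT (EFin \o f)).

Lemma intble_measurable f : intble f -> measurable_fun setT f.
Proof. by move=> /integrableP[/measurable_EFinP]. Qed.

Lemma le_intble f g : measurable_fun setT f -> (forall x, `|f x| <= g x) ->
  intble g -> intble f.
Proof.
move=> mf fg; apply: le_integrable => //; first exact/measurable_EFinP.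
by move=> x _; rewrite lee_fin (le_trans (fg x))// ler_norm.
Qed.

Lemma intbleD f g : intble f -> intble g -> intble (fun x => f x + g x).
Proof. by move=> hf hg; exact: (integrableD measurableT hf hg). Qed.

Lemma intbleZ (c : R) f : intble f -> intble (fun x => c * f x).
Proof. by move=> hf; exact: (integrableZl measurableT c hf). Qed.

Lemma intbleN f : intble f -> intble (fun x => - f x).
Proof. by move=> hf; exact: (integrableN hf). Qed.

Lemma intbleB f g : intble f -> intble g -> intble (fun x => f x - g x).
Proof. by move=> hf hg; apply: intbleD => //; exact: intbleN. Qed.

Lemma intble_norm f : intble f -> intble (fun x => `|f x|).
Proof. exact: integrable_norm. Qed.

Lemma intble_sum (I : Type) (r : seq I) (F : I -> T -> R) :
  (forall i, intble (F i)) -> intble (fun x => \sum_(i <- r) F i x).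
Proof.
move=> iF; elim: r => [|i r IHr].
  by under eq_fun do rewrite big_nil; exact: integrable0.
by under eq_fun do rewrite big_cons; exact: intbleD.
Qed.

Lemma Rintegral_sum (I : Type) (r : seq I) (F : I -> T -> R) :
  (forall i, intble (F i)) ->
  \int[mu]_x (\sum_(i <- r) F i x) = \sum_(i <- r) \int[mu]_x F i x.
Proof.
move=> iF; elim: r => [|i r IHr].
  rewrite big_nil; under eq_Rintegral do rewrite big_nil.
  by rewrite /Rintegral integral0.
rewrite big_cons -IHr; under eq_Rintegral do rewrite big_cons.
by rewrite RintegralD//; exact: intble_sum.
Qed.

Lemma intbleM_bounded f g (M : R) : measurable_fun setT f ->
  (forall x, `|f x| <= M) -> intble g -> intble (fun x => f x * g x).
Proof.
move=> mf fM ig; apply: (@le_intble _ (fun x => M * `|g x|)).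
- by apply: measurable_funM => //; exact: intble_measurable.
- by move=> x; rewrite normrM ler_wpM2r.
- by apply: intbleZ; exact: intble_norm.
Qed.

Lemma ge0_intbleP f : measurable_fun setT f -> (forall x, 0 <= f x) ->
  (\int[mu]_x (f x)%:E < +oo)%E -> intble f.
Proof.
move=> mf f0 foo; apply/integrableP; split; first exact/measurable_EFinP.
by under eq_integral do rewrite /= ger0_norm//.
Qed.

Lemma intble_lty f : (forall x, 0 <= f x) -> intble f ->
  (\int[mu]_x (f x)%:E < +oo)%E.
Proof.
move=> f0 /integrableP[_].
by under eq_integral do rewrite /= ger0_norm//.
Qed.

Lemma EFin_Rintegral f : intble f ->
  (\int[mu]_x f x)%:E = (\int[mu]_x (f x)%:E)%E.
Proof. by move=> hf; rewrite /Rintegral fineK//; exact: integrable_fin_num. Qed.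

Lemma dominated_cvg_R (F : nat -> T -> R) f g :
  (forall m, measurable_fun setT (F m)) ->
  (forall x, F m x @[m --> \oo] --> f x) ->
  intble g -> (forall m x, `|F m x| <= g x) ->
  \int[mu]_x F m x @[m --> \oo] --> \int[mu]_x f x.
Proof.
move=> mF Ff ig Fg.
have mf : measurable_fun setT f.
  by apply: (measurable_fun_cvg mF) => x _; exact: Ff.
have fg x : `|f x| <= g x.
  have : `|F m x| @[m --> \oo] --> `|f x| by apply: cvg_norm; exact: Ff.
  by move/cvgr_to_le; apply; apply: nearW => m; exact: Fg.
have if_ : intble f by exact: le_intble fg ig.
apply: fine_cvg; rewrite [in X in _ --> X]fineK; last exact: integrable_fin_num.
apply: (@dominated_cvg _ _ _ mu setT measurableT
  (fun m => EFin \o F m) (EFin \o f) (EFin \o g)) => //.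
- by move=> m; exact/measurable_EFinP.
- by move=> x _; apply: cvg_EFin; [exact: nearW|exact: Ff].
- by move=> m x _; rewrite lee_fin.
Qed.

Lemma Rintegral_norm_eq0 f : intble f -> \int[mu]_x `|f x| = 0 ->
  f = cst 0 %[ae mu].
Proof.
move=> hf f0.
have : (\int[mu]_x `|(EFin \o f) x| = 0)%E.
  by rewrite -[RHS]/(0%R%:E) -f0 EFin_Rintegral//; exact: intble_norm.
move/(ae_eq_integral_abs mu measurableT _).
move=> /(_ (measurable_int _ hf)); apply: filterS => x /= /(_ I).
by move=> [].
Qed.

End real_integrals.

(** Smooth functions with values in [0, 1] approximate indicators with respect
    to any finite measure [h dx]: the sets with this property form a
    sigma-algebra, as the class of functions is closed under complement to 1
    and products, and it contains the half-spaces. *)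
Section indicator_approximation.
Context {R : realType} {n : nat} (h : 'rV[R]_n -> R).

Local Notation mu := (lebesgue_rV R n).

Hypothesis h_ge0 : forall x, 0 <= h x.
Hypothesis h_int : mu.-integrable setT (EFin \o h).

Definition smooth_01 (f : 'rV[R]_n -> R) :=
  (forall k, Ck k f) /\ forall x, 0 <= f x <= 1.

Let dist01 (A : set 'rV[R]_n) (f : 'rV[R]_n -> R) :=
  \int[mu]_x (`|\1_A x - f x| * h x).

Let approximable (A : set 'rV[R]_n) := measurable A /\
  forall e : R, 0 < e -> exists2 f, smooth_01 f & dist01 A f < e.

Let mh : measurable_fun setT h := intble_measurable h_int.

Let smooth_meas f : smooth_01 f -> measurable_fun setT f.
Proof. by move=> [Cf _]; apply: continuous_measurable_rV; exact: (Ck_continuous (Cf 0%N)). Qed.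

Let indic_01 (A : set 'rV[R]_n) x : 0 <= (\1_A x : R) <= 1.
Proof. by rewrite indicE; case: (_ \in _); rewrite ?ler01 ?lexx. Qed.

Let diff_le1 (a b : R) : 0 <= a <= 1 -> 0 <= b <= 1 -> `|a - b| <= 1.
Proof. by move=> /andP[? ?] /andP[? ?]; rewrite ler_norml; lra. Qed.

Let intble_diff (a b : 'rV[R]_n -> R) : measurable_fun setT a ->
  measurable_fun setT b -> (forall x, 0 <= a x <= 1) ->
  (forall x, 0 <= b x <= 1) ->
  mu.-integrable setT (EFin \o (fun x => `|a x - b x| * h x)).
Proof.
move=> ma mb a01 b01; apply: (@intbleM_bounded _ _ _ _ (fun x => `|a x - b x|) _ 1) => //.
  by apply: measurableT_comp => //; exact: measurable_funB.
by move=> x; rewrite normr_id diff_le1.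
Qed.

Let dist_triangle (a b c : 'rV[R]_n -> R) : measurable_fun setT a ->
  measurable_fun setT b -> measurable_fun setT c -> (forall x, 0 <= a x <= 1) ->
  (forall x, 0 <= b x <= 1) -> (forall x, 0 <= c x <= 1) ->
  \int[mu]_x (`|a x - c x| * h x) <=
  \int[mu]_x (`|a x - b x| * h x) + \int[mu]_x (`|b x - c x| * h x).
Proof.
move=> ma mb mc a01 b01 c01.
rewrite -RintegralD//; [|exact: intble_diff|exact: intble_diff].
apply: le_Rintegral => //.
- exact: intble_diff.
- by apply: intbleD; exact: intble_diff.
- by move=> x _; rewrite -mulrDl ler_wpM2r// ler_distD.
Qed.

Let approximableC A : approximable A -> approximable (~` A).
Proof.
move=> [mA aA]; split; first exact: measurableC.
move=> e e0; have [f [Cf f01] fe] := aA e e0.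
exists (fun x => 1 - f x).
  split => [k|x].
    rewrite (_ : (fun _ => _) = cst 1 \+ (cst (-1) \* f)).
      by apply: CkD; [exact: Ck_cst|apply: CkM => //; exact: Ck_cst].
    by apply/funext => x /=; rewrite mulN1r.
  by have := f01 x; lra.
rewrite /dist01; under eq_Rintegral => x _.
  rewrite indicC/= (_ : `|_| = `|\1_A x - f x|); first over.
  by rewrite indicE -normrN; case: (x \in A) => /=; congr `|_|; ring.
exact: fe.
Qed.

Let approximableI A B : approximable A -> approximable B -> approximable (A `&` B).
Proof.
move=> [mA aA] [mB aB]; split; first exact: measurableI.
move=> e e0; have e20 : 0 < e / 2 by rewrite divr_gt0.
have [f [Cf f01] fe] := aA _ e20; have [g [Cg g01] ge] := aB _ e20.
have mf : measurable_fun setT f by apply: smooth_meas.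
have mg : measurable_fun setT g by apply: smooth_meas.
have mfg : measurable_fun setT (f \* g) by exact: measurable_funM.
exists (f \* g).
  split => [k|x]; first exact: CkM.
  have := f01 x; have := g01 x; move=> /andP[? ?] /andP[? ?] /=.
  by rewrite mulr_ge0//= mulr_ile1.
rewrite (splitr e); apply: le_lt_trans (ltrD fe ge).
rewrite -RintegralD//; [|exact: intble_diff|exact: intble_diff].
apply: le_Rintegral => //.
- have mAB : measurable_fun setT (\1_(A `&` B) : 'rV[R]_n -> R).
    by apply: measurable_indic; exact: measurableI.
  apply: intble_diff => //.
  move=> x /=; have := f01 x; have := g01 x; move=> /andP[? ?] /andP[? ?] /=.
  by rewrite mulr_ge0//= mulr_ile1.
- by apply: intbleD; exact: intble_diff.
- move=> x _; rewrite -mulrDl ler_wpM2r// indicI/=.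
  rewrite (_ : _ - _ = (\1_A x - f x) * \1_B x + f x * (\1_B x - g x)); last by ring.
  rewrite (le_trans (ler_normD _ _))// !normrM lerD//.
    by rewrite ler_piMr// ger0_norm; have /andP[] := indic_01 B x.
  by rewrite ler_piMl// ger0_norm; have /andP[] := f01 x.
Qed.

Let approximable0 : approximable set0.
Proof.
split => // e e0; exists (cst 0); first by split => [k|x]; [exact: Ck_cst|rewrite lexx ler01].
rewrite /dist01; under eq_Rintegral do rewrite indic0/= subrr normr0 mul0r.
by rewrite /Rintegral integral0.
Qed.

Let approximable_lim A (B : nat -> set 'rV[R]_n) : measurable A ->
  (forall m, approximable (B m)) ->
  (forall x, \1_(B m) x @[m --> \oo] --> (\1_A x : R)) -> approximable A.
Proof.
move=> mA aB BA; split => // e e0; have e20 : 0 < e / 2 by rewrite divr_gt0.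
have : \int[mu]_x (`|\1_A x - \1_(B m) x| * h x) @[m --> \oo] --> \int[mu]_x (0 : R).
  apply: (@dominated_cvg_R _ _ _ _ _ (cst 0) h) => //.
  - move=> m; apply: measurable_funM => //; apply: measurableT_comp => //.
    by apply: measurable_funB; apply: measurable_indic => //; exact: (aB m).1.
  - move=> x; rewrite -[X in _ --> X](mul0r (h x)); apply: cvgMr_tmp.
    rewrite -[X in _ --> X](@normr0 _ R); apply: cvg_norm.
    rewrite -[X in _ --> X](subrr (\1_A x : R)); apply: cvgB; first exact: cvg_cst.
    exact: BA.
  - by move=> m x; rewrite normrM normr_id ger0_norm// ler_piMl// diff_le1.
rewrite {2}/Rintegral integral0 => /cvgr0_norm_lt /(_ _ e20)[N _ /(_ N (leqnn N))].
move=> ABN; have [f f01 fe] := (aB N).2 _ e20; exists f => //.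
rewrite (splitr e); apply: le_lt_trans (ltrD ABN fe).
rewrite ger0_norm; last by apply: Rintegral_ge0 => x _; rewrite mulr_ge0.
apply: dist_triangle => //.
- by apply: measurable_indic => //; exact: (aB N).1.
- exact: smooth_meas.
- by case: f01.
Qed.

Let approximable_sigma_algebra : sigma_algebra setT approximable.
Proof.
split => //; first by move=> A aA; rewrite setTD; exact: approximableC.
move=> F aF; pose B m := \big[setU/set0]_(i < m) F i.
have aU A1 A2 : approximable A1 -> approximable A2 -> approximable (A1 `|` A2).
  move=> a1 a2; rewrite -[_ `|` _]setCK setCU.
  by apply: approximableC; apply: approximableI; exact: approximableC.
apply: (@approximable_lim _ B).
- by apply: bigcupT_measurable => i; exact: (aF i).1.
- by move=> m; rewrite /B; elim/big_ind : _ => // i _.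
- move=> x; have [Fx|Fx] := pselect ((\bigcup_k F k) x).
    have [N _ FNx] := Fx.
    apply: cvg_near_cst; exists N.+1 => // m /= Nm.
    rewrite !indicE mem_set//; last first.
      by rewrite /B -bigcup_mkord; exists N.
    by rewrite mem_set.
  apply: cvg_near_cst; apply: nearW => m.
  rewrite !indicE memNset//; last by rewrite /B -bigcup_mkord => -[i /= im Fi]; apply: Fx; exists i.
  by rewrite memNset.
Qed.

Let approximable_ray i a : approximable ((fun x : 'rV[R]_n => x ord0 i) @^-1` `]a, +oo[).
Proof.
have mA : measurable ((fun x : 'rV[R]_n => x ord0 i) @^-1` `]a, +oo[).
  by rewrite -[X in measurable X]setTI; exact: measurable_coord.
split => // e e0.
pose f (m : nat) (x : 'rV[R]_n) := smooth_step (m%:R * (x ord0 i - a)).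
have f01 m : smooth_01 (f m).
  split => [k|x]; last by rewrite smooth_step_ge0 smooth_step_le1.
  apply: (@Ck_smooth_step _ _ k (fun x => m%:R * (x ord0 i - a))).
  have -> : (fun x : 'rV[R]_n => m%:R * (x ord0 i - a)) =
    cst m%:R \* ((fun x => x ord0 i) \+ cst (- a)) by [].
  by apply: CkM; [exact: Ck_cst|apply: CkD; [exact: Ck_coord|exact: Ck_cst]].
set A := _ @^-1` _ in mA *.
have : \int[mu]_x (`|\1_A x - f m x| * h x) @[m --> \oo] --> \int[mu]_x (0 : R).
  apply: (@dominated_cvg_R _ _ _ _ _ (cst 0) h) => //.
  - move=> m; apply: measurable_funM => //; apply: measurableT_comp => //.
    by apply: measurable_funB; [exact: measurable_indic|exact: smooth_meas].
  - move=> x; apply: cvg_near_cst.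
    have [xa|xa] := leP (x ord0 i) a.
      apply: nearW => m; rewrite indicE memNset; last first.
        by rewrite /A/= in_itv/= andbT; apply/negP; rewrite -leNgt.
      rewrite /f smooth_step_le0 ?subrr ?normr0 ?mul0r//.
      by rewrite mulr_ge0_le0// subr_le0.
    have xa0 : 0 < x ord0 i - a by rewrite subr_gt0.
    near=> m; rewrite indicE mem_set; last by rewrite /A/= in_itv/= xa.
    rewrite /f smooth_step_ge1 ?subrr ?normr0 ?mul0r//.
    rewrite -ler_pdivrMr// mul1r.
    by near: m; exact: nbhs_infty_ger.
  - move=> m x; rewrite normrM normr_id ger0_norm// ler_piMl// diff_le1//.
    exact: (f01 m).2.
rewrite {2}/Rintegral integral0 => /cvgr0_norm_lt /(_ _ e0)[N _ /(_ N (leqnn N))].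
rewrite ger0_norm; last by apply: Rintegral_ge0 => x _; rewrite mulr_ge0.
by exists (f N).
Unshelve. all: by end_near. Qed.

Lemma indic_approximation (A : set 'rV[R]_n) (e : R) : measurable A -> 0 < e ->
  exists2 f, smooth_01 f & \int[mu]_x (`|\1_A x - f x| * h x) < e.
Proof.
move=> mA e0.
suff : approximable A by case=> _; exact.
suff sub : @measurable _ 'rV[R]_n `<=` approximable by exact: sub.
apply: smallest_sub; first exact: approximable_sigma_algebra.
elim/big_ind : _ => [//|X Y XA YA|i _]; first by rewrite subUset.
move=> _ [B mB <-]; rewrite setTI.
suff : @measurable _ R `<=` [set B | approximable
  ((fun x : 'rV[R]_n => x ord0 i) @^-1` B)] by exact.
move=> C mC; have : (@RGenOInfty.G R).-sigma.-measurable C.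
  by rewrite -RGenOInfty.measurableE; exact: mC.
move: C {mC}; apply: smallest_sub.
  have [s0 sC sU] := approximable_sigma_algebra.
  split => /=; first by rewrite preimage_set0.
    by move=> C aC; rewrite setTD preimage_setC -setTD; exact: sC.
  by move=> F aF; rewrite preimage_bigcup; exact: sU.
by move=> _ [a ->]; exact: approximable_ray.
Qed.

End indicator_approximation.

(** * Minkowski's integral inequality in L^p *)

Section Lp_norm.
Context d (T : measurableType d) {R : realType} (mu : {measure set T -> \bar R}).
Context (p : R) (p1 : 1 <= p).
Implicit Types (f g h : T -> R).
Local Open Scope ereal_scope.

Local Notation N f := ('N[mu]_p%:E[EFin \o f]).

Let p_gt0 : (0 < p)%R. Proof. exact: lt_le_trans p1. Qed.
Let p_neq0 : p != 0%R. Proof. by rewrite gt_eqF. Qed.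

Lemma le_poweR (x y : \bar R) (r : R) : (0 <= r)%R -> 0 <= x -> x <= y ->
  x `^ r <= y `^ r.
Proof.
by move=> r0 x0 xy; apply: gt0_ler_poweR => //; rewrite in_itv/= ?leey ?andbT//;
  exact: le_trans xy.
Qed.

Lemma LnormE f : N f = (\int[mu]_x (`|f x| `^ p)%:E) `^ p^-1.
Proof.
by rewrite unlock; congr (_ `^ _); apply: eq_integral => x _; rewrite /= ?poweR_EFin.
Qed.

Lemma Lnorm_powE f : N f `^ p = \int[mu]_x (`|f x| `^ p)%:E.
Proof.
by rewrite poweR_Lnorm//; apply: eq_integral => x _; rewrite /= poweR_EFin.
Qed.

Lemma measurable_abs_powR f : measurable_fun setT f ->
  measurable_fun setT (fun x => (`|f x| `^ p)%:E).
Proof.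
move=> mf; apply/measurable_EFinP.
apply: (measurableT_comp (measurable_powR p)).
exact: measurableT_comp.
Qed.

Lemma Lnorm_leP f (B : R) : (0 <= B)%R ->
  \int[mu]_x (`|f x| `^ p)%:E <= (B `^ p)%:E -> N f <= B%:E.
Proof.
move=> B0 H; rewrite LnormE.
have -> : B%:E = (B `^ p)%:E `^ p^-1.
  by rewrite poweR_EFin -powRrM mulfV// powRr1.
apply: le_poweR => //; first by rewrite invr_ge0 ltW.
by apply: integral_ge0 => x _; rewrite lee_fin powR_ge0.
Qed.

Lemma Lnorm_lepow f (B : R) : (0 <= B)%R -> N f <= B%:E ->
  \int[mu]_x (`|f x| `^ p)%:E <= (B `^ p)%:E.
Proof.
move=> B0 H; rewrite -Lnorm_powE -poweR_EFin; apply: le_poweR => //.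
  exact: ltW.
exact: Lnorm_ge0.
Qed.

Lemma le_Lnorm f g : measurable_fun setT f -> measurable_fun setT g ->
  (forall x, `|f x| <= `|g x|)%R -> N f <= N g.
Proof.
move=> mf mg fg; rewrite !LnormE; apply: le_poweR.
- by rewrite invr_ge0 ltW.
- by apply: integral_ge0 => x _; rewrite lee_fin powR_ge0.
- apply: ge0_le_integral => //; try exact: measurable_abs_powR.
  move=> x _; rewrite lee_fin ge0_ler_powR ?nnegrE//; exact: ltW.
Qed.

Lemma eq_Lnorm_ae f g : measurable_fun setT f -> measurable_fun setT g ->
  f = g %[ae mu] -> N f = N g.
Proof.
move=> mf mg fg; rewrite !LnormE; apply: (congr1 (fun y => y `^ p^-1)).
apply: ge0_ae_eq_integral => //; try exact: measurable_abs_powR.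
by move: fg; apply: filterS => x /= /(_ I) ->.
Qed.

Lemma LnormN f : N (fun x => - f x)%R = N f.
Proof.
by rewrite !LnormE; under eq_integral do rewrite normrN.
Qed.

Lemma Lnorm_distC f g : N (f \- g)%R = N (g \- f)%R.
Proof. by rewrite !LnormE; under eq_integral do rewrite distrC. Qed.

Lemma LnormZ_fun (c : R) f : measurable_fun setT f ->
  N (fun x => c * f x)%R = `|c|%:E * N f.
Proof.
move=> mf; rewrite !LnormE.
under eq_integral do rewrite normrM powRM// EFinM.
rewrite ge0_integralZl_EFin//; [|exact: measurable_abs_powR].
rewrite poweRM//; first by rewrite poweR_EFin -powRrM mulfV// powRr1.
by apply: integral_ge0 => x _; rewrite lee_fin powR_ge0.
Qed.

Lemma LnormD f g : measurable_fun setT f -> measurable_fun setT g ->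
  N (fun x => f x + g x)%R <= N f + N g.
Proof. by move=> mf mg; exact: minkowski_EFin. Qed.

Lemma LnormB f g : measurable_fun setT f -> measurable_fun setT g ->
  N (fun x => f x - g x)%R <= N f + N g.
Proof.
move=> mf mg; rewrite -(LnormN g).
by apply: (@LnormD f (fun x => - g x)%R) => //; exact: measurableT_comp.
Qed.

Lemma Lnorm_triangle g f h : measurable_fun setT f -> measurable_fun setT g ->
  measurable_fun setT h -> N (f \- h)%R <= N (f \- g)%R + N (g \- h)%R.
Proof.
move=> mf mg mh.
rewrite (_ : (f \- h)%R = (fun x => (f \- g) x + (g \- h) x)%R).
  by apply: LnormD; exact: measurable_funB.
by apply/funext => x /=; rewrite subrKA.
Qed.

Lemma Lnorm_fun0 : N (fun=> 0)%R = 0.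
Proof. by apply: Lnorm0; rewrite eqe. Qed.

Lemma Lnorm_sum (I : Type) (r : seq I) (F : I -> T -> R) :
  (forall i, measurable_fun setT (F i)) ->
  N (fun x => \sum_(i <- r) F i x)%R <= \sum_(i <- r) N (F i).
Proof.
move=> mF; elim: r => [|i r IHr].
  rewrite big_nil (_ : (fun _ => _) = fun=> 0%R) ?Lnorm_fun0//.
  by apply/funext => x; rewrite big_nil.
rewrite big_cons (_ : (fun _ => _) = (fun x => F i x + \sum_(j <- r) F j x)%R);
  last by apply/funext => x; rewrite big_cons.
apply: (le_trans (LnormD _ _)) => //.
  exact: measurable_sum.
by rewrite leeD2l.
Qed.

Lemma Lnorm0_ae f : measurable_fun setT f -> N f = 0 -> f = cst 0%R %[ae mu].
Proof.
move=> mf Nf.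
have mf' : measurable_fun setT (EFin \o f) by exact/measurable_EFinP.
have := Lnorm_eq0_eq0 mf' _ Nf.
rewrite lte_fin => /(_ p_gt0); apply: filterS => x /= /(_ I) H _.
by case: H.
Qed.

Lemma Lfun_normP f : (f \in Lfun mu p%:E) <-> measurable_fun setT f /\ N f < +oo.
Proof.
by rewrite inE/=; split => [/andP[/[!inE]]|[? ?]]//; apply/andP; rewrite !inE.
Qed.

Lemma LfunD f g : f \in Lfun mu p%:E -> g \in Lfun mu p%:E ->
  (fun x => f x + g x)%R \in Lfun mu p%:E.
Proof.
move=> /Lfun_normP[mf Nf] /Lfun_normP[mg Ng]; apply/Lfun_normP; split.
  exact: measurable_funD.
by rewrite (le_lt_trans (LnormD _ _))// lte_add_pinfty.
Qed.

Lemma LfunZ (c : R) f : f \in Lfun mu p%:E -> (fun x => c * f x)%R \in Lfun mu p%:E.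
Proof.
move=> /Lfun_normP[mf Nf]; apply/Lfun_normP; split; first exact: measurable_funM.
by rewrite LnormZ_fun// lte_mul_pinfty.
Qed.

Lemma LfunB f g : f \in Lfun mu p%:E -> g \in Lfun mu p%:E ->
  (fun x => f x - g x)%R \in Lfun mu p%:E.
Proof.
move=> Lf Lg; rewrite (_ : (fun _ => _) = (fun x => f x + (-1) * g x)%R).
  by apply: LfunD => //; exact: LfunZ.
by apply/funext => x; rewrite mulN1r.
Qed.

Lemma Lfun_le f g : measurable_fun setT f -> (forall x, `|f x| <= `|g x|)%R ->
  g \in Lfun mu p%:E -> f \in Lfun mu p%:E.
Proof.
move=> mf fg /Lfun_normP[mg Ng]; apply/Lfun_normP; split => //.
exact: le_lt_trans (le_Lnorm mf mg fg) Ng.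
Qed.

Lemma Lfun_ae f g : measurable_fun setT f -> f = g %[ae mu] ->
  g \in Lfun mu p%:E -> f \in Lfun mu p%:E.
Proof.
move=> mf fg /Lfun_normP[mg Ng]; apply/Lfun_normP; split => //.
by rewrite (eq_Lnorm_ae mf mg fg).
Qed.

Lemma Lfun_measurable f : f \in Lfun mu p%:E -> measurable_fun setT f.
Proof. by move=> /Lfun_normP[]. Qed.

Lemma Lfun_fin f : f \in Lfun mu p%:E -> N f \is a fin_num.
Proof. by move=> /Lfun_normP[_ ?]; rewrite ge0_fin_numE ?Lnorm_ge0. Qed.

Lemma Lfun_fineK f : f \in Lfun mu p%:E -> (fine (N f))%:E = N f.
Proof. by move=> /Lfun_fin /fineK. Qed.

Lemma Lfun_intble f : f \in Lfun mu p%:E ->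
  mu.-integrable setT (EFin \o (fun x => `|f x| `^ p))%R.
Proof. by move=> fL; apply: (Lfun_integrable p1 fL). Qed.

(** The p-th powers of the differences are dominated by the integrable |g|^p. *)
Lemma Lnorm_dominated (F : nat -> T -> R) f g :
  (forall m, measurable_fun setT (F m)) -> measurable_fun setT f ->
  (forall x, F m x @[m --> \oo] --> f x)%classic ->
  g \in Lfun mu p%:E -> (forall m x, `|F m x - f x| <= `|g x|)%R ->
  (N (F m \- f)%R @[m --> \oo] --> 0)%classic.
Proof.
move=> mF mf Ff gL Fg.
have mD m : measurable_fun setT (F m \- f)%R by exact: measurable_funB.
have mDp m : measurable_fun setT (fun x => `|F m x - f x| `^ p)%R.
  by apply/measurable_EFinP; exact: (measurable_abs_powR (mD m)).
have le_p m x : (`|F m x - f x| `^ p <= `|g x| `^ p)%R.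
  by rewrite ge0_ler_powR ?nnegrE//; exact: ltW.
have cvI : (\int[mu]_x (`|F m x - f x| `^ p) @[m --> \oo] --> \int[mu]_x (0 : R))%R.
  apply: (@dominated_cvg_R _ _ _ _ _ (cst 0%R) (fun x => `|g x| `^ p)%R) => //.
  - move=> x; have : (`|F m x - f x| @[m --> \oo] --> (0 : R))%R.
      rewrite -[X in _ --> X](@normr0 _ R); apply: cvg_norm.
      rewrite -[X in _ --> X](subrr (f x)); apply: cvgB; last exact: cvg_cst.
      exact: Ff.
    move=> H; apply/cvgr0Pnorm_le => e e0.
    have e'0 : (0 < e `^ p^-1)%R by rewrite powR_gt0.
    move/cvgr0Pnorm_le : H => /(_ _ e'0); apply: filterS => m; rewrite normr_id => h.
    rewrite ger0_norm ?powR_ge0//.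
    have -> : e = ((e `^ p^-1) `^ p)%R by rewrite -powRrM mulVf// powRr1// ltW.
    by apply: ge0_ler_powR; rewrite ?nnegrE ?powR_ge0//; exact: ltW.
  - exact: Lfun_intble.
  - by move=> m x; rewrite ger0_norm ?powR_ge0.
have intD m : mu.-integrable setT (EFin \o (fun x => `|F m x - f x| `^ p))%R.
  apply: le_intble (Lfun_intble gL) => // x.
  by rewrite ger0_norm ?powR_ge0.
rewrite {2}/Rintegral integral0 in cvI.
apply/fine_cvgP; split.
  apply: nearW => m; rewrite LnormE fin_num_poweR//.
  exact: integrable_fin_num (intD m).
apply/cvgr0Pnorm_le => e e0.
have e'0 : (0 < e `^ p)%R by rewrite powR_gt0.
move/cvgr0Pnorm_le : cvI => /(_ _ e'0); apply: filterS => m /= h.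
rewrite ger0_norm ?fine_ge0 ?Lnorm_ge0//.
have : N (F m \- f)%R <= e%:E.
  apply: Lnorm_leP; first exact: ltW.
  rewrite -EFin_Rintegral//= lee_fin (le_trans (ler_norm _))//.
by move/(fine_le _ _) => /=; apply => //; rewrite LnormE fin_num_poweR//
  (integrable_fin_num _ (intD m)).
Qed.

End Lp_norm.

Section minkowski_integral.
Context d1 d2 (X : measurableType d1) (S : measurableType d2) {R : realType}.
Context (mu : {sigma_finite_measure set X -> \bar R}).
Context (nu : {sigma_finite_measure set S -> \bar R}).
Context (p : R) (p1 : 1 <= p).
Local Open Scope ereal_scope.

Let p_gt0 : (0 < p)%R. Proof. exact: lt_le_trans p1. Qed.
Let p_neq0 : p != 0%R. Proof. by rewrite gt_eqF. Qed.

(** Hoelder's inequality for the splitting of w in powers 1/p and 1-1/p. *)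
Lemma jensen_powR (w f : S -> R) : measurable_fun setT w ->
  measurable_fun setT f -> (forall s, 0 <= w s)%R -> (forall s, 0 <= f s)%R ->
  nu.-integrable setT (EFin \o w) ->
  (\int[nu]_s (w s * f s)%:E) `^ p <=
  ((\int[nu]_s w s)%R `^ (p - 1))%:E * \int[nu]_s (w s * f s `^ p)%:E.
Proof.
move=> mw mf w0 f0 iw.
have W0 : (0 <= (\int[nu]_s w s)%R)%R by exact: Rintegral_ge0.
move: (p1); rewrite le_eqVlt => /predU1P[p1'|p1'].
  rewrite -p1' subrr powRr0 mul1e poweRe1; last first.
    by apply: integral_ge0 => s _; rewrite lee_fin mulr_ge0.
  by under [leRHS]eq_integral do rewrite powRr1//.
pose q := (p / (p - 1))%R.
have pm0 : (0 < p - 1)%R by rewrite subr_gt0.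
have q0 : (0 < q)%R by rewrite divr_gt0.
have pq : (p^-1 + q^-1 = 1)%R by rewrite /q; field; rewrite !gt_eqF.
pose a s := (w s `^ p^-1 * f s)%R; pose b s := (w s `^ q^-1)%R.
have ma : measurable_fun setT a.
  by apply: measurable_funM => //; exact: (measurableT_comp (measurable_powR _)).
have mb : measurable_fun setT b by exact: (measurableT_comp (measurable_powR _)).
have := hoelder nu ma mb p_gt0 q0 pq.
rewrite Lnorm1 => H.
have {}H : \int[nu]_s (w s * f s)%:E <= 'N[nu]_p%:E[EFin \o a] * 'N[nu]_q%:E[EFin \o b].
  apply: le_trans H; rewrite le_eqVlt; apply/orP; left; apply/eqP.
  apply: eq_integral => s _; rewrite /= ger0_norm; last first.
    by rewrite /a/b !mulr_ge0// powR_ge0.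
  rewrite /a /b mulrAC -powRD ?pq ?powRr1//.
  by rewrite oner_eq0.
have I0 : 0 <= \int[nu]_s (w s * f s)%:E.
  by apply: integral_ge0 => s _; rewrite lee_fin mulr_ge0.
apply: (le_trans (le_poweR (ltW p_gt0) I0 H)).
rewrite poweRM ?Lnorm_ge0// muleC Lnorm_powE//.
rewrite (_ : \int[nu]_s (`|a s| `^ p)%:E = \int[nu]_s (w s * f s `^ p)%:E); last first.
  apply: eq_integral => s _; congr (_%:E); rewrite /a ger0_norm; last first.
    by rewrite mulr_ge0// powR_ge0.
  by rewrite powRM ?powR_ge0// -powRrM mulVf// powRr1.
rewrite lee_wpmul2r//.
  by apply: integral_ge0 => s _; rewrite lee_fin mulr_ge0// powR_ge0.
rewrite LnormE -poweRrM.
rewrite (_ : \int[nu]_s (`|b s| `^ q)%:E = \int[nu]_s (w s)%:E); last first.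
  apply: eq_integral => s _; congr (_%:E); rewrite /b ger0_norm ?powR_ge0//.
  by rewrite -powRrM mulVf ?powRr1// gt_eqF.
rewrite -EFin_Rintegral// poweR_EFin (_ : q^-1 * p = p - 1)%R//.
by rewrite /q; field; rewrite !gt_eqF.
Qed.

Context (w : S -> R) (F : X * S -> R).
Hypothesis w_int : nu.-integrable setT (EFin \o w).
Hypothesis w_ge0 : forall s, (0 <= w s)%R.
Hypothesis mF : measurable_fun setT F.

Let mw : measurable_fun setT w := intble_measurable w_int.

Let mwF : measurable_fun setT (fun xs : X * S => w xs.2 * F xs)%R.
Proof.
by apply: measurable_funM => //; exact: measurableT_comp.
Qed.

Lemma measurable_Rintegral_param :
  measurable_fun setT (fun x => \int[nu]_s (w s * F (x, s)))%R.
Proof.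
rewrite /Rintegral; apply: (measurableT_comp (fine_measurable measurableT)) => //.
pose G := EFin \o (fun xs : X * S => w xs.2 * F xs)%R.
have mG : measurable_fun setT G by exact/measurable_EFinP.
rewrite (_ : (fun x => _) = (fun x => fubini_F nu G^\+ x - fubini_F nu G^\- x)).
  apply: emeasurable_funB; apply: measurable_fun_fubini_tonelli_F => //.
  - exact: measurable_funepos.
  - exact: measurable_funeneg.
by apply/funext => x; rewrite integralE; congr (_ - _);
  apply: eq_integral => s _; rewrite ?funeposE ?funenegE.
Qed.

Context (B : R) (B0 : (0 <= B)%R).
Hypothesis F_le : forall s, 'N[mu]_p%:E[EFin \o (fun x => F (x, s))] <= B%:E.

(** [jensen_powR] in the parameter, then Tonelli. *)
Lemma minkowski_integral_abs :
  \int[mu]_x ((\int[nu]_s (w s * `|F (x, s)|)%:E) `^ p) <=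
  (((\int[nu]_s w s)%R * B) `^ p)%:E.
Proof.
have W0 : (0 <= (\int[nu]_s w s)%R)%R by exact: Rintegral_ge0.
set W := (\int[nu]_s w s)%R in W0 *.
have mF1 x : measurable_fun setT (fun s => F (x, s)).
  by apply: measurableT_comp => //; exact: measurable_pair1.
have mFp : measurable_fun setT (fun xs : X * S => (w xs.2 * `|F xs| `^ p)%:E).
  apply/measurable_EFinP; apply: measurable_funM; first exact: measurableT_comp.
  apply: (measurableT_comp (measurable_powR p)); exact: measurableT_comp.
have mFa : measurable_fun setT (fun xs : X * S => (w xs.2 * `|F xs|)%:E).
  apply/measurable_EFinP; apply: measurable_funM; first exact: measurableT_comp.
  exact: measurableT_comp.
have Fp0 xs : 0 <= (w xs.2 * `|F xs| `^ p)%:E by rewrite lee_fin mulr_ge0// powR_ge0.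
have Fa0 xs : 0 <= (w xs.2 * `|F xs|)%:E by rewrite lee_fin mulr_ge0.
have mH := measurable_fun_fubini_tonelli_F (m2 := nu) _ mFp Fp0.
have mG := measurable_fun_fubini_tonelli_F (m2 := nu) _ mFa Fa0.
apply: (@le_trans _ _ (\int[mu]_x ((W `^ (p - 1))%:E *
    \int[nu]_s (w s * `|F (x, s)| `^ p)%:E))).
  apply: ge0_le_integral => //.
  - by move=> x _; exact: poweR_ge0.
  - exact: (measurableT_comp (measurable_poweR p) mG).
  - by apply: measurable_funeM; exact: mH.
  - move=> x _; apply: (@jensen_powR w (fun s => `|F (x, s)|)%R) => //.
    exact: measurableT_comp.
rewrite ge0_integralZl_EFin//; last first.
- exact: powR_ge0.
- by move=> x _; apply: integral_ge0 => s _; exact: (Fp0 (x, s)).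
rewrite (fubini_tonelli (fun xs : X * S => (w xs.2 * `|F xs| `^ p)%:E))//=.
apply: (@le_trans _ _ ((W `^ (p - 1))%:E * (W * B `^ p)%:E)); last first.
  rewrite -EFinM lee_fin mulrA [in leRHS]powRM//.
  rewrite -[X in (_ * X * _ <= _)%R]powRr1// -powRD ?subrK//.
  by rewrite (negbTE p_neq0).
rewrite lee_wpmul2l//; first by rewrite lee_fin powR_ge0.
apply: (@le_trans _ _ (\int[nu]_s (w s * B `^ p)%:E)); last first.
  under eq_integral do rewrite mulrC EFinM.
  rewrite ge0_integralZl_EFin ?powR_ge0//; last 2 first.
    by move=> s _; rewrite lee_fin.
    exact/measurable_EFinP.
  by rewrite -EFin_Rintegral// -EFinM mulrC.
apply: ge0_le_integral => //.
- by move=> s _; apply: integral_ge0 => x _; exact: (Fp0 (x, s)).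
- exact: (measurable_fun_fubini_tonelli_G (m1 := mu) _ mFp Fp0).
- by apply/measurable_EFinP; exact: measurable_funM.
- move=> s _; under eq_integral do rewrite EFinM.
  rewrite ge0_integralZl_EFin//; last first.
    by apply: measurable_abs_powR; apply: measurableT_comp.
  by rewrite EFinM lee_wpmul2l ?lee_fin//; exact: Lnorm_lepow.
Qed.

End minkowski_integral.

Section signed_minkowski_integral.
Context d1 d2 (X : measurableType d1) (S : measurableType d2) {R : realType}.
Context (mu : {sigma_finite_measure set X -> \bar R}).
Context (nu : {sigma_finite_measure set S -> \bar R}).
Context (p : R) (p1 : 1 <= p).
Local Open Scope ereal_scope.

Let p_gt0 : (0 < p)%R. Proof. exact: lt_le_trans p1. Qed.
Let p_neq0 : p != 0%R. Proof. by rewrite gt_eqF. Qed.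

Context (w : S -> R) (F : X * S -> R).
Hypothesis w_int : nu.-integrable setT (EFin \o w).
Hypothesis mF : measurable_fun setT F.

Let mw : measurable_fun setT w := intble_measurable w_int.

Let abs_w_int : nu.-integrable setT (EFin \o (fun s => `|w s|)%R).
Proof. exact: intble_norm. Qed.

Context (B : R) (B0 : (0 <= B)%R).
Hypothesis F_le : forall s, 'N[mu]_p%:E[EFin \o (fun x => F (x, s))] <= B%:E.

(** Minkowski's integral inequality, in the form where the norms of the slices
    have a common bound. *)
Lemma signed_minkowski :
  'N[mu]_p%:E[EFin \o (fun x => \int[nu]_s (w s * F (x, s)))%R] <=
  ((\int[nu]_s `|w s|)%R * B)%:E.
Proof.
have W0 : (0 <= (\int[nu]_s `|w s|)%R)%R by exact: Rintegral_ge0.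
have mF1 x : measurable_fun setT (fun s => w s * F (x, s))%R.
  by apply: measurable_funM => //; apply: measurableT_comp => //;
    exact: measurable_pair1.
apply: Lnorm_leP => //; first exact: mulr_ge0.
apply: le_trans (minkowski_integral_abs p1 abs_w_int (fun s => normr_ge0 (w s)) mF B0 F_le).
have mFa : measurable_fun setT (fun xs : X * S => (`|w xs.2| * `|F xs|)%:E).
  apply/measurable_EFinP; apply: measurable_funM; last exact: measurableT_comp.
  by do 2 apply: measurableT_comp => //.
have Fa0 xs : 0 <= (`|w xs.2| * `|F xs|)%:E by rewrite lee_fin mulr_ge0.
have mG := measurable_fun_fubini_tonelli_F (m2 := nu) _ mFa Fa0.
apply: ge0_le_integral => //.
- exact: measurable_abs_powR (measurable_Rintegral_param w_int mF).
- exact: (measurableT_comp (measurable_poweR p) mG).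
move=> x _; rewrite -poweR_EFin; apply: le_poweR => //; first exact: ltW.
apply: (@le_trans _ _ `|\int[nu]_s (w s * F (x, s))%:E|).
  by rewrite /Rintegral; case: (integral _ _ _) => [r| |] /=; rewrite ?normr0 ?leey.
apply: (le_trans (le_abse_integral _ _ _)) => //; first exact/measurable_EFinP.
rewrite le_eqVlt; apply/orP; left; apply/eqP; apply: eq_integral => s _.
by rewrite abse_EFin normrM.
Qed.

Lemma signed_minkowski_ae : {ae mu, forall x,
  nu.-integrable setT (EFin \o (fun s => w s * F (x, s))%R)}.
Proof.
have mF1 x : measurable_fun setT (fun s => w s * F (x, s))%R.
  by apply: measurable_funM => //; apply: measurableT_comp => //;
    exact: measurable_pair1.
have mFa : measurable_fun setT (fun xs : X * S => (`|w xs.2| * `|F xs|)%:E).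
  apply/measurable_EFinP; apply: measurable_funM; last exact: measurableT_comp.
  by do 2 apply: measurableT_comp => //.
have Fa0 xs : 0 <= (`|w xs.2| * `|F xs|)%:E by rewrite lee_fin mulr_ge0.
have mG := measurable_fun_fubini_tonelli_F (m2 := nu) _ mFa Fa0.
have : mu.-integrable setT (fun x => (\int[nu]_s (`|w s| * `|F (x, s)|)%:E) `^ p).
  apply/integrableP; split; first exact: (measurableT_comp (measurable_poweR p) mG).
  apply: le_lt_trans (ltry (((\int[nu]_s `|w s|)%R * B) `^ p)%R).
  apply: le_trans (minkowski_integral_abs p1 abs_w_int (fun s => normr_ge0 (w s)) mF B0 F_le).
  rewrite le_eqVlt; apply/orP; left; apply/eqP; apply: eq_integral => x _.
  by rewrite gee0_abs// poweR_ge0.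
move=> /(integrable_ae measurableT); apply: filterS => x /(_ I) fx.
apply/integrableP; split; first exact/measurable_EFinP.
have : \int[nu]_s (`|w s| * `|F (x, s)|)%:E < +oo.
  by apply: (lty_poweRy p_neq0); rewrite ltey_eq fx.
apply: le_lt_trans; rewrite le_eqVlt; apply/orP; left; apply/eqP.
by apply: eq_integral => s _; rewrite /= normrM.
Qed.

End signed_minkowski_integral.

(** * The fundamental lemma and the density of test functions in L^p *)

Section local_integrability.
Context {R : realType} {n : nat}.
Implicit Types (f g w phi : 'rV[R]_n -> R) (K : set 'rV[R]_n).

Local Notation mu := (lebesgue_rV R n).
Local Notation intble f := (mu.-integrable setT (EFin \o f)).

Definition normball (r : R) : set 'rV[R]_n := [set x | `|x| <= r].

Lemma measurable_normball r : measurable (normball r).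
Proof. by apply: compact_measurable_rV; exact: compact_norm_le. Qed.

Lemma normball_lty r : (mu (normball r) < +oo)%E.
Proof. by apply: compact_lebesgue_rV_lty; exact: compact_norm_le. Qed.

Lemma intble_indic (K : set 'rV[R]_n) : measurable K -> (mu K < +oo)%E ->
  intble (fun x => \1_K x).
Proof.
move=> mK Koo.
have mI : measurable_fun setT (\1_K : 'rV[R]_n -> R) by exact: measurable_indic.
by apply: (@ge0_intbleP _ _ _ _ (\1_K)) => //; rewrite integral_indic// setIT.
Qed.

Lemma loc_intble_indic w K : loc_integrable w -> compact K ->
  intble (fun x => `|w x| * \1_K x).
Proof.
move=> [mw lw] cK; have mK := compact_measurable_rV cK.
apply: ge0_intbleP => //.
- by apply: measurable_funM; [exact: measurableT_comp|exact: measurable_indic].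
- apply: le_lt_trans (lw K cK); rewrite [leRHS]integral_mkcond.
  rewrite le_eqVlt; apply/orP; left; apply/eqP; apply: eq_integral => x _.
  by rewrite patchE indicE; case: ifP => _; rewrite ?mulr1 ?mulr0.
Qed.

Lemma loc_intbleM w phi (M r : R) : loc_integrable w -> measurable_fun setT phi ->
  (forall x, `|phi x| <= M) -> (forall x, r < `|x| -> phi x = 0) ->
  intble (fun x => w x * phi x).
Proof.
move=> lw mphi phiM phir.
apply: (@le_intble _ _ _ _ _ (fun x => M * (`|w x| * \1_(normball r) x))).
- by apply: measurable_funM => //; case: lw.
- move=> x; rewrite normrM mulrCA.
  have [xr|xr] := leP `|x| r; last first.
    rewrite phir// normr0 mulr0 !mulr_ge0//.
    by rewrite (le_trans _ (phiM 0)).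
  by rewrite indicE mem_set//= mulr1 ler_wpM2l.
- by apply: intbleZ; apply: loc_intble_indic => //; exact: compact_norm_le.
Qed.

Lemma loc_intbleM_Ckc w phi k : loc_integrable w -> Ckc k phi ->
  intble (fun x => w x * phi x).
Proof.
move=> lw Cphi; have [M phiM] := Ckc_bounded Cphi.
case: (Cphi) => [C cphi]; have [r r0 phir] := compact_support_bound cphi.
apply: (loc_intbleM lw _ phiM phir).
by apply: continuous_measurable_rV; exact: Ck_continuous C.
Qed.

Lemma test_Ckc k phi : test_function phi -> Ckc k phi.
Proof. by move=> [C c]; split. Qed.

Lemma loc_intbleM_test w phi : loc_integrable w -> test_function phi ->
  intble (fun x => w x * phi x).
Proof. by move=> lw tphi; apply: (loc_intbleM_Ckc lw (test_Ckc 0 tphi)). Qed.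

Lemma compact_supportD f g : compact_support f -> compact_support g ->
  compact_support (fun x => f x + g x).
Proof.
move=> /compact_support_bound[r _ fr] /compact_support_bound[s _ gs].
apply: (@compact_support_norm _ _ _ (Num.max r s)) => x.
by rewrite gt_max => /andP[xr xs]; rewrite fr// gs// addr0.
Qed.

Lemma test_functionD f g : test_function f -> test_function g ->
  test_function (fun x => f x + g x).
Proof.
move=> [Cf cf] [Cg cg]; split => [k|]; first exact: CkD.
exact: compact_supportD.
Qed.

Lemma test_functionM (f g : 'rV[R]_n -> R) : (forall k, Ck k f) -> test_function g ->
  test_function (fun x => f x * g x).
Proof.
move=> Cf [Cg cg]; split => [k|]; first exact: CkM.
rewrite (_ : (fun _ => _) = g \* f); first exact: compact_supportM.
by apply/funext => x /=; rewrite mulrC.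
Qed.

Lemma test_functionZ (c : R) f : test_function f -> test_function (fun x => c * f x).
Proof. by apply: test_functionM => k; exact: Ck_cst. Qed.

Lemma test_function0 : test_function ((fun=> 0) : 'rV[R]_n -> R).
Proof.
split => [k|]; first exact: Ck_cst.
by apply: (@compact_support_norm _ _ _ 0).
Qed.

Lemma test_function_affine (f : 'rV[R]_n -> R) (c : R) (b : 'rV[R]_n) : c != 0 ->
  test_function f -> test_function (fun y => f (c *: y + b)).
Proof.
move=> c0 [Cf cf]; split => [k|]; first exact: Ck_affine.
have [r r0 fr] := compact_support_bound cf.
apply: (@compact_support_norm _ _ _ ((r + `|b|) / `|c|)) => x.
rewrite ltr_pdivrMr ?normr_gt0// => xr; apply: fr.
have := ler_normB (c *: x + b) b; rewrite addrK normrZ mulrC => h.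
by move: xr h; lra.
Qed.

(** A smooth approximation to an indicator of a bounded set may be cut off
    without loss. *)
Lemma indic_test_approximation (h : 'rV[R]_n -> R) (A : set 'rV[R]_n) (r e : R) :
  (forall x, 0 <= h x) ->
  (forall s, intble (fun x => h x * \1_(normball s) x)) ->
  measurable A -> A `<=` normball r -> 0 < e ->
  exists phi, [/\ test_function phi, forall x, `|\1_A x - phi x| <= 1,
    mu.-integrable setT (EFin \o (fun x => `|\1_A x - phi x| * h x)) &
    \int[mu]_x (`|\1_A x - phi x| * h x) < e].
Proof.
move=> h0 lh mA Ar e0.
pose s := (n%:R + 1) * (`|r| + 1).
have s0 : 0 < s by rewrite mulr_gt0// ltr_wpDl.
have chi1 x : A x -> cutoff s x = 1.
  move=> /Ar xr; apply: cutoff_eq1 => //.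
  apply: (@le_trans _ _ (n%:R * (`|r| + 1) ^+ 2)).
    rewrite ler_wpM2l// ler_pXn2r ?nnegrE ?addr_ge0//.
    by rewrite (le_trans xr)// (le_trans (ler_norm _))// lerDl.
  rewrite exprMn ler_wpM2r ?exprn_ge0 ?addr_ge0//.
  have n0 : 0 <= n%:R :> R by [].
  by rewrite expr2; nra.
have ih := lh (2 * s).
have mh : measurable_fun setT (fun x => h x * \1_(normball (2 * s)) x).
  exact: intble_measurable ih.
have h0' x : 0 <= h x * \1_(normball (2 * s)) x by rewrite mulr_ge0.
have [f [Cf f01] fe] := indic_approximation h0' ih mA e0.
pose phi x := f x * cutoff s x.
have le_phi x : `|\1_A x - phi x| <= `|\1_A x - f x| * \1_(normball (2 * s)) x.
  have [xs|xs] := leP `|x| (2 * s); last first.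
    rewrite /phi cutoff_eq0// mulr0 subr0 indicE memNset ?normr0 ?mulr_ge0//.
    by move=> /chi1; rewrite cutoff_eq0// => /eqP; rewrite eq_sym oner_eq0.
  rewrite [X in _ <= _ * X]indicE mem_set// mulr1.
  have -> : \1_A x - phi x = cutoff s x * (\1_A x - f x).
    rewrite /phi mulrBr (mulrC (f x)); congr (_ - _).
    rewrite indicE; case: (boolP (x \in A)) => [/set_mem/chi1 ->|_]; first by rewrite mulr1.
    by rewrite mulr0.
  have /andP[c0 c1] := cutoff_itv s x.
  by rewrite normrM ger0_norm// ler_piMl.
have ind1 x : 0 <= (\1_A x : R) <= 1 by rewrite indicE; case: (_ \in _); rewrite ?ler01 ?lexx.
have f1 x : `|\1_A x - f x| <= 1.
  by have := ind1 x; have := f01 x; rewrite ler_norml; lra.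
have mf : measurable_fun setT f.
  by apply: continuous_measurable_rV; exact: Ck_continuous (Cf 0%N).
have mphi : measurable_fun setT phi.
  apply: measurable_funM => //; apply: continuous_measurable_rV.
  exact: Ck_continuous (Ck_cutoff 0 s).
have i1 : intble (fun x => `|\1_A x - f x| * (h x * \1_(normball (2 * s)) x)).
  apply: (@intbleM_bounded _ _ _ _ (fun x => `|\1_A x - f x|) _ 1) => //.
    by apply: measurableT_comp => //; apply: measurable_funB => //; exact: measurable_indic.
  by move=> x; rewrite normr_id.
have le2 x : `|\1_A x - phi x| * h x <=
    `|\1_A x - f x| * (h x * \1_(normball (2 * s)) x).
  by rewrite mulrA mulrAC ler_wpM2r.
have mdiff : measurable_fun setT (fun x => `|\1_A x - phi x|).
  by apply: measurableT_comp => //; apply: measurable_funB => //; exact: measurable_indic.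
have i2 : intble (fun x => `|\1_A x - phi x| * h x).
  have E : (fun x => `|\1_A x - phi x| * h x) =
           (fun x => `|\1_A x - phi x| * (h x * \1_(normball (2 * s)) x)).
    apply/funext => x; have [xs|xs] := leP `|x| (2 * s).
      by rewrite [\1_(normball _) _]indicE mem_set// mulr1.
    have := le_phi x; rewrite [\1_(normball _) _]indicE memNset; last first.
      by rewrite /normball/= leNgt xs.
    by rewrite mulr0 normr_le0 => /eqP ->; rewrite normr0 !mul0r.
  apply: le_intble i1; first by rewrite E; exact: measurable_funM.
  by move=> x; rewrite ger0_norm// mulr_ge0.
exists phi; split => //.
- by apply: test_functionM => //; exact: test_cutoff.
- move=> x; apply: (le_trans (le_phi x)).
  rewrite [X in _ * X]indicE; case: (_ \in _); rewrite ?mulr1 ?mulr0//.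
- by apply: le_lt_trans fe; exact: le_Rintegral.
Qed.

(** The fundamental lemma of the calculus of variations. For the measure |w| dx,
    the indicator of the part of [w > 0] in a ball is approximated by test
    functions, hence w has integral 0 over it. *)
Let fundamental_half w : loc_integrable w ->
  (forall phi, test_function phi -> \int[mu]_x (w x * phi x) = 0) ->
  {ae mu, forall x, w x <= 0}.
Proof.
move=> lw w0; have mw : measurable_fun setT w by case: lw.
suff H (r : nat) : {ae mu, forall x, `|x| <= r%:R -> w x <= 0}.
  have : {ae mu, forall x (r : nat), `|x| <= r%:R -> w x <= 0} by exact: ae_foralln.
  apply: filterS => x /(_ (Num.truncn `|x|).+1); apply.
  by rewrite ltW// truncnS_gt.
pose A := normball r%:R `&` [set x | 0 < w x].
have mA : measurable A.
  apply: measurableI; first exact: measurable_normball.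
  rewrite (_ : [set x | _] = w @^-1` `]0, +oo[); last first.
    by apply/seteqP; split => x /=; rewrite in_itv/= andbT.
  by rewrite -[X in measurable X]setTI; exact: mw.
have Ar : A `<=` normball r%:R by move=> x [].
have iw s : intble (fun x => `|w x| * \1_(normball s) x).
  by apply: loc_intble_indic => //; exact: compact_norm_le.
have iA : intble (fun x => w x * \1_A x).
  apply: (@loc_intbleM _ _ 1 r%:R) => //.
  - by move=> x; rewrite indicE; case: (_ \in _); rewrite ?normr1 ?normr0.
  - move=> x xr; rewrite indicE memNset// => -[]; by rewrite /normball/= leNgt xr.
have wA0 x : 0 <= w x * \1_A x.
  rewrite indicE; case: (boolP (x \in A)) => [/set_mem[_ /= w0x]|_].
    by rewrite mulr1 ltW.
  by rewrite mulr0.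
have IA : \int[mu]_x (w x * \1_A x) = 0.
  apply/eqP; rewrite eq_le Rintegral_ge0// andbT.
  apply/ler_addgt0Pr => e e0; rewrite add0r.
  have [phi [tphi phi1 iphi phie]] :=
    indic_test_approximation (fun x => normr_ge0 (w x)) iw mA Ar e0.
  apply: le_trans (ltW phie).
  rewrite -[leLHS]subr0 -(w0 _ tphi) -RintegralB//; last exact: loc_intbleM_test.
  apply: le_Rintegral => //.
    by apply: intbleB => //; exact: loc_intbleM_test.
  by move=> x _; rewrite -mulrBr mulrC (le_trans (ler_norm _))// normrM.
have : (fun x => w x * \1_A x) = cst 0 %[ae mu].
  apply: Rintegral_norm_eq0 => //; rewrite -IA; apply: eq_Rintegral => x _.
  by rewrite ger0_norm.
apply: filterS => x /= /(_ I) + xr; rewrite leNgt => wx; apply/negP => w0x.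
have : w x = 0.
  by rewrite -wx indicE mem_set ?mulr1//; split.
by move=> E; move: w0x; rewrite E ltxx.
Qed.

Lemma loc_integrable_eq0 w : loc_integrable w ->
  (forall phi, test_function phi -> \int[mu]_x (w x * phi x) = 0) ->
  w = cst 0 %[ae mu].
Proof.
move=> lw w0.
have lNw : loc_integrable (fun x => - w x).
  case: lw => mw lw; split; first exact: measurableT_comp.
  by move=> K cK; under eq_integral do rewrite normrN; exact: lw.
have Nw0 phi : test_function phi -> \int[mu]_x (- w x * phi x) = 0.
  move=> tphi; under eq_Rintegral do rewrite mulNr -mulN1r.
  by rewrite RintegralZl ?w0 ?mulr0//; exact: loc_intbleM_test.
have := fundamental_half lw w0; have := fundamental_half lNw Nw0.
apply: filterS2 => x wN w_ _ /=; apply/eqP; rewrite eq_le w_/=.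
by rewrite -oppr_le0.
Qed.

End local_integrability.

Section Lp_density.
Import HBNNSimple.
Context {R : realType} {n : nat} (p : R) (p1 : 1 <= p).
Implicit Types (f g phi : 'rV[R]_n -> R).

Local Notation mu := (lebesgue_rV R n).
Local Notation N f := ('N[mu]_p%:E[EFin \o f%R])%E.

Let p_gt0 : 0 < p. Proof. exact: lt_le_trans p1. Qed.
Let p_neq0 : p != 0. Proof. by rewrite gt_eqF. Qed.

Lemma Lfun_bounded_support f (M r : R) : measurable_fun setT f ->
  (forall x, `|f x| <= M) -> (forall x, r < `|x| -> f x = 0) ->
  f \in Lfun mu p%:E.
Proof.
move=> mf fM fr; apply/Lfun_normP; split => //.
have M0 : 0 <= M by apply: le_trans (fM 0).
rewrite LnormE// poweR_lty//.
apply: (@le_lt_trans _ _ (\int[mu]_x (M `^ p * \1_(normball r) x)%:E)%E).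
  apply: ge0_le_integral => //.
  - exact: measurable_abs_powR.
  - apply/measurable_EFinP; apply: measurable_funM => //.
    by apply: measurable_indic; exact: measurable_normball.
  - move=> x _; rewrite lee_fin; have [xr|xr] := leP `|x| r.
      by rewrite indicE mem_set// mulr1 ge0_ler_powR ?nnegrE// ltW.
    by rewrite fr// normr0 powR0// mulr_ge0// powR_ge0.
apply: intble_lty; first by move=> x; rewrite mulr_ge0// powR_ge0.
apply: intbleZ; apply: intble_indic; first exact: measurable_normball.
exact: normball_lty.
Qed.

Lemma Ckc_Lfun k f : Ckc k f -> f \in Lfun mu p%:E.
Proof.
move=> Cf; have [M fM] := Ckc_bounded Cf; case: (Cf) => C cf.
have [r _ fr] := compact_support_bound cf.
apply: (Lfun_bounded_support _ fM fr).
by apply: continuous_measurable_rV; exact: Ck_continuous C.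
Qed.

(** Because |f| <= 1 + |f|^p. *)
Lemma Lfun_loc_integrable f : f \in Lfun mu p%:E -> loc_integrable f.
Proof.
move=> fL; have mf := Lfun_measurable fL; split => // K cK.
have mK := compact_measurable_rV cK.
have i1 : mu.-integrable setT (EFin \o (fun x => \1_K x + `|f x| `^ p)).
  apply: intbleD; last exact: Lfun_intble.
  by apply: intble_indic => //; exact: compact_lebesgue_rV_lty.
have i10 x : 0 <= \1_K x + `|f x| `^ p by rewrite addr_ge0// powR_ge0.
apply: le_lt_trans (intble_lty i10 i1).
rewrite [leLHS]integral_mkcond; apply: ge0_le_integral => //.
- by move=> x _; apply: erestrict_ge0 => y _; rewrite lee_fin.
- apply/(measurable_restrictT _ mK); apply: measurable_funTS.
  by apply/measurable_EFinP; exact: measurableT_comp.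
- by apply/measurable_EFinP; exact: intble_measurable i1.
- move=> x _; rewrite patchE indicE; case: ifP => _; last first.
    by rewrite lee_fin add0r powR_ge0.
  rewrite lee_fin; have [f1|f1] := leP `|f x| 1.
    by rewrite (le_trans f1)// lerDl powR_ge0.
  rewrite -[leLHS]add0r lerD// -[leLHS]powRr1//.
  by apply: ler_powR => //; exact: ltW.
Qed.

Let approximable f := measurable_fun setT f /\
  forall e : R, 0 < e -> exists2 phi, test_function phi & (N (f \- phi) <= e%:E)%E.

Let test_measurable phi : test_function phi -> measurable_fun setT phi.
Proof. by move=> [C _]; apply: continuous_measurable_rV; exact: Ck_continuous (C 0%N). Qed.

Let approximableD f g : approximable f -> approximable g ->
  approximable (fun x => f x + g x).
Proof.
move=> [mf af] [mg ag]; split; first exact: measurable_funD.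
move=> e e0; have e20 : 0 < e / 2 by rewrite divr_gt0.
have [phi tphi fe] := af _ e20; have [psi tpsi ge] := ag _ e20.
exists (fun x => phi x + psi x); first exact: test_functionD.
rewrite [in leRHS](splitr e) EFinD; apply: le_trans (leeD fe ge).
rewrite (_ : _ \- _ = (fun x => (f \- phi) x + (g \- psi) x)).
  by apply: LnormD => //; apply: measurable_funB => //; exact: test_measurable.
by apply/funext => x /=; ring.
Qed.

Let approximableZ (c : R) f : approximable f -> approximable (fun x => c * f x).
Proof.
move=> [mf af]; split; first exact: measurable_funM.
move=> e e0; have c0 : 0 < `|c| + 1 by rewrite ltr_wpDl.
have e'0 : 0 < e / (`|c| + 1) by rewrite divr_gt0.
have [phi tphi fe] := af _ e'0.
exists (fun x => c * phi x); first exact: test_functionZ.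
rewrite (_ : _ \- _ = (fun x => c * (f \- phi) x)); last first.
  by apply/funext => x /=; ring.
rewrite LnormZ_fun//; last by apply: measurable_funB => //; exact: test_measurable.
apply: (le_trans (lee_wpmul2l _ fe)); first by rewrite lee_fin.
rewrite -EFinM lee_fin mulrCA ger_pMr// ler_pdivrMr// mul1r lerDl.
by [].
Qed.

Let approximable_sum (I : Type) (r : seq I) (F : I -> 'rV[R]_n -> R) :
  (forall i, approximable (F i)) -> approximable (fun x => \sum_(i <- r) F i x).
Proof.
move=> aF; elim: r => [|i r IHr].
  under eq_fun do rewrite big_nil; split => // e e0.
  exists (fun=> 0); first exact: test_function0.
  rewrite (_ : _ \- _ = fun=> 0); first by rewrite Lnorm_fun0// lee_fin ltW.
  by apply/funext => x /=; rewrite subrr.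
by under eq_fun do rewrite big_cons; exact: approximableD.
Qed.

Let approximable_indic A (r : R) : measurable A -> A `<=` normball r ->
  approximable (\1_A).
Proof.
move=> mA Ar; split; first exact: measurable_indic.
move=> e e0; have e'0 : 0 < e `^ p by rewrite powR_gt0.
have ih s : mu.-integrable setT (EFin \o (fun x => (cst 1 x : R) * \1_(normball s) x)).
  under [X in _ \o X]eq_fun do rewrite /= mul1r.
  by apply: intble_indic; [exact: measurable_normball|exact: normball_lty].
have [phi [tphi phi1 iphi phie]] := indic_test_approximation
  (fun=> ler01) ih mA Ar e'0.
exists phi => //; apply: Lnorm_leP => //; first exact: ltW.
apply: (@le_trans _ _ (\int[mu]_x (`|\1_A x - phi x| * 1))%:E); last first.
  by rewrite lee_fin ltW.
rewrite EFin_Rintegral//; apply: ge0_le_integral => //.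
- apply: measurable_abs_powR; apply: measurable_funB; first exact: measurable_indic.
  exact: test_measurable.
- by apply/measurable_EFinP; exact: intble_measurable iphi.
- move=> x _; rewrite lee_fin mulr1.
  rewrite -[(\1_A \- phi) x]/(\1_A x - phi x).
  have [->|d0] := eqVneq (\1_A x - phi x) 0; first by rewrite normr0 powR0.
  rewrite -[leRHS]powRr1//; apply: ger_powR => //.
  by rewrite normr_gt0 d0 phi1.
Qed.

Let approximable_cvg f (F : nat -> 'rV[R]_n -> R) : measurable_fun setT f ->
  (forall m, approximable (F m)) -> (N (F m \- f) @[m --> \oo] --> 0)%E ->
  approximable f.
Proof.
move=> mf aF Ff; split => // e e0; have e20 : 0 < e / 2 by rewrite divr_gt0.
have /fine_cvgP[Ffin /cvgr0Pnorm_lt /(_ _ e20) Fe] := Ff.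
near \oo => m.
have [mFm aFm] := aF m; have [phi tphi phie] := aFm _ e20.
exists phi => //.
have mphi : measurable_fun setT phi by exact: test_measurable.
apply: (le_trans (Lnorm_triangle mu p1 mf mFm mphi)).
rewrite [in leRHS](splitr e) EFinD leeD// Lnorm_distC.
have Nf : N (F m \- f) \is a fin_num by near: m.
rewrite -(fineK Nf) lee_fin ltW// (le_lt_trans (ler_norm _))//.
by near: m.
Unshelve. all: by end_near. Qed.

Let approximable_ge0 f : f \in Lfun mu p%:E -> (forall x, 0 <= f x) ->
  approximable f.
Proof.
move=> fL f0; have mf := Lfun_measurable fL.
have mf' : measurable_fun setT (EFin \o f) by exact/measurable_EFinP.
pose s := nnsfun_approx measurableT mf'.
have cs x : s m x @[m --> \oo] --> f x.
  exact: (fine_cvg (@cvg_nnsfun_approx _ _ _ _ measurableT _ mf' (fun x _ => f0 x) x I)).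
have sf m x : s m x <= f x.
  have nds : nondecreasing_seq (fun m => s m x : R).
    by move=> i j ij; have /lefP := nd_nnsfun_approx measurableT mf' ij; exact.
  rewrite -(cvg_lim _ (cs x))//; apply: nondecreasing_cvgn_le => //.
  by apply/cvg_ex; exists (f x); exact: cs.
pose F (m : nat) x := s m x * \1_(normball m%:R) x.
have Fcv x : F m x @[m --> \oo] --> f x.
  apply: cvg_trans (cs x); apply: near_eq_cvg; near=> m.
  rewrite /F indicE mem_set ?mulr1//; rewrite /normball/=.
  by near: m; exact: nbhs_infty_ger.
have mF m : measurable_fun setT (F m).
  apply: measurable_funM => //.
  by apply: measurable_indic; exact: measurable_normball.
apply: (@approximable_cvg _ F) => //.
- move=> m; rewrite /F.
  rewrite (_ : (fun x => _) = (fun x => \sum_(y <- fset_set (range (s m)))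
    y * \1_(s m @^-1` [set y] `&` normball m%:R) x)); last first.
    apply/funext => x; rewrite [in LHS](fimfunE (s m)) fsbig_finite//= mulr_suml.
    by apply: eq_bigr => y _; rewrite indicI/= mulrA.
  apply: approximable_sum => y; apply: approximableZ.
  apply: (@approximable_indic _ m%:R); last by move=> x [].
  by apply: measurableI => //; exact: measurable_normball.
- apply: (@Lnorm_dominated _ _ _ _ _ p1 _ _ f) => // m x.
  have F0 : 0 <= F m x <= f x.
    have /andP[i0 i1] : 0 <= (\1_(normball m%:R) x : R) <= 1.
      by rewrite indicE; case: (x \in _); rewrite ?ler01 ?lexx.
    by rewrite mulr_ge0//= (le_trans _ (sf m x))// ler_piMr.
  by rewrite distrC !ger0_norm// ?subr_ge0//; case/andP: F0 => // F0 _; lra.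
Unshelve. all: by end_near. Qed.

(** Simple functions reduce density to indicators of bounded sets. These have
    approximations at distance at most 1, for which smallness in L^1 implies
    smallness in L^p. *)
Lemma test_dense f (e : R) : f \in Lfun mu p%:E -> 0 < e ->
  exists2 phi, test_function phi & (N (f \- phi) <= e%:E)%E.
Proof.
move=> fL e0; have mf := Lfun_measurable fL.
have [] : approximable f; last by move=> _; exact.
rewrite (_ : f = (fun x => Num.max (f x) 0 + (-1) * Num.max (- f x) 0)).
  have mN : measurable_fun setT (fun x => - f x) by exact: measurableT_comp.
  apply: approximableD; last apply: approximableZ.
  - apply: approximable_ge0; last by move=> x; rewrite le_max lexx orbT.
    apply: (@Lfun_le _ _ _ _ _ p1 _ f) => //; first exact: measurable_maxr.
    by move=> x; rewrite ger0_norm ?le_max ?lexx ?orbT// ge_max ler_norm/=.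
  - apply: approximable_ge0; last by move=> x; rewrite le_max lexx orbT.
    apply: (@Lfun_le _ _ _ _ _ p1 _ f) => //; first exact: measurable_maxr.
    move=> x; rewrite ger0_norm ?le_max ?lexx ?orbT// ge_max normr_ge0 andbT.
    by rewrite -normrN ler_norm.
apply/funext => x; rewrite mulN1r.
by case: (leP (f x) 0) => ?; case: (leP (- f x) 0) => ?; lra.
Qed.

End Lp_density.

(** * Integration by parts and weak derivatives *)

Section multi_index_lists.
Context {n : nat}.
Implicit Types (a : 'I_n -> nat) (s : seq 'I_n).

(** The directions of a multi-index, repeated according to multiplicity, so that
    inductions on the order become inductions on a list. *)
Definition mi_list (a : 'I_n -> nat) : seq 'I_n :=
  flatten [seq nseq (a i) i | i <- enum 'I_n].

Lemma count_mi_list a i : count_mem i (mi_list a) = a i.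
Proof.
rewrite /mi_list count_flatten sumnE !big_map -enumT big_enum/=.
rewrite (bigD1 i)//= count_nseq/= eqxx mul1n big1 ?addn0// => j ji.
by rewrite count_nseq/= (negbTE ji).
Qed.

Lemma size_mi_list a : size (mi_list a) = mi_order a.
Proof.
rewrite /mi_list size_flatten /shape sumnE !big_map -enumT big_enum/=.
by apply: eq_bigr => i _; rewrite size_nseq.
Qed.

Lemma mi_order_count a s : (forall i, count_mem i s = a i) -> mi_order a = size s.
Proof.
move=> sa; rewrite -size_mi_list; apply: perm_size.
by apply/allP => i _ /=; rewrite sa count_mi_list.
Qed.

End multi_index_lists.

Section integration_by_parts.
Context {R : realType} {n : nat}.
Implicit Types (f g u v phi : 'rV[R]_n -> R) (x h : 'rV[R]_n) (i j : 'I_n).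

Local Notation mu := (lebesgue_rV R n).
Local Notation intble f := (mu.-integrable setT (EFin \o f)).
Local Notation e_ i := (delta_mx ord0 i : 'rV[R]_n).

Lemma Rintegral_shift f h : measurable_fun setT f ->
  \int[mu]_x f (x + h) = \int[mu]_x f x.
Proof.
move=> mf; have := @Rintegral_affine_rV _ _ 1 h f (oner_neq0 _) mf.
rewrite normr1 expr1n invr1 mul1r => <-.
by apply: eq_Rintegral => x _; rewrite scale1r.
Qed.

Lemma intble_shift f h : intble f -> intble (fun x => f (x + h)).
Proof.
move=> /(integrable_affine_rV h (oner_neq0 R)).
by under eq_fun do rewrite scale1r.
Qed.

Lemma measurable_shift f h : measurable_fun setT f ->
  measurable_fun setT (fun x => f (x + h)).
Proof.
move=> mf; apply: measurableT_comp => //.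
have := @measurable_affine_rV R n 1 h.
by under eq_fun do rewrite scale1r.
Qed.

Lemma Ck_measurable k f : Ck k f -> measurable_fun setT f.
Proof. by move=> /Ck_continuous; exact: continuous_measurable_rV. Qed.

Lemma Ckc_intble k f : Ckc k f -> intble f.
Proof.
by move=> /(@Ckc_Lfun _ _ 1 (lexx _)) /Lfun1_integrable.
Qed.

Lemma norm_delta_le1 i : `|e_ i| <= 1.
Proof.
apply: norm_le_coord => // j; rewrite !mxE eqxx/=.
by case: (_ == _); rewrite ?normr1 ?normr0.
Qed.

(** The integral of a partial derivative is the limit of integrals of
    difference quotients, which vanish by translation invariance. *)
Lemma Rintegral_partial i f : Ckc 1 f -> \int[mu]_x partial i f x = 0.
Proof.
move=> Cf; have [C cf] := Cf.
have df y : derivable f y (e_ i) by exact: Ck_derivable C.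
have Cdf := Ckc_partial i Cf.
have [M dfM] := Ckc_bounded Cdf.
have [r r0 dfr] := compact_support_bound Cdf.2.
have mf := Ck_measurable C.
pose F (m : nat) x := m.+1%:R * (f (x + m.+1%:R^-1 *: e_ i) - f x).
have F0 m : \int[mu]_x F m x = 0.
  have if_ := Ckc_intble Cf; have ifs := intble_shift (m.+1%:R^-1 *: e_ i) if_.
  rewrite RintegralZl//; last exact: intbleB.
  by rewrite RintegralB// Rintegral_shift// subrr mulr0.
have Fw m x : exists2 t : R, `|t| <= m.+1%:R^-1 & F m x = partial i f (x + t *: e_ i).
  have [t ts E] := mvt_line x (m.+1%:R^-1) df.
  exists t; first by rewrite (le_trans ts)// ger0_norm.
  by rewrite /F E mulrA mulfV ?mul1r.
suff : \int[mu]_x F m x @[m --> \oo] --> \int[mu]_x partial i f x.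
  under eq_fun do rewrite F0.
  by move=> H; rewrite -(cvg_lim (@Rhausdorff R) H) lim_cst.
apply: (@dominated_cvg_R _ _ _ _ _ _ (fun x => M * \1_(normball (r + 1)) x)).
- move=> m; apply: measurable_funM => //; apply: measurable_funB => //.
  exact: measurable_shift.
- move=> x; apply/cvgrPdist_le => e e0.
  have cdf : continuous (partial i f) := Ck_continuous Cdf.1.
  have /cvgrPdist_le /(_ _ e0) /nbhs_ballP[d /= d0 xd] := cdf x.
  near=> m; have [t tm ->] := Fw m x; apply: xd.
  rewrite -ball_normE/= opprD addNKr normrN normrZ.
  apply: (@le_lt_trans _ _ `|t|); first by rewrite ler_piMr// norm_delta_le1.
  apply: (le_lt_trans tm); near: m; exact: near_infty_natSinv_lt (PosNum d0).
- apply: intbleZ; apply: intble_indic; first exact: measurable_normball.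
  exact: normball_lty.
- move=> m x; have [t tm ->] := Fw m x.
  have [xr|xr] := leP `|x| (r + 1); first by rewrite indicE mem_set// mulr1.
  rewrite dfr ?normr0 ?mulr_ge0//; first by rewrite (le_trans _ (dfM 0)).
  have t1 : `|t *: e_ i| <= 1.
    rewrite normrZ mulr_ile1// ?norm_delta_le1// (le_trans tm)//.
    by rewrite invf_le1// ler1n.
  have := ler_normB (x + t *: e_ i) (t *: e_ i); rewrite addrK.
  by move: xr t1; lra.
Unshelve. all: by end_near. Qed.

Lemma integration_by_parts_partial i u phi : Ck 1 u -> Ckc 1 phi ->
  \int[mu]_x (u x * partial i phi x) = - \int[mu]_x (partial i u x * phi x).
Proof.
move=> Cu [Cphi cphi].
have Cup : Ckc 1 (u \* phi).
  split; first exact: CkM.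
  rewrite (_ : u \* phi = phi \* u); first exact: compact_supportM.
  by apply/funext => x /=; rewrite mulrC.
have i1 : intble (fun x => u x * partial i phi x).
  apply: (@Ckc_intble 0); split; first exact: CkM (CkS Cu) (Ck_partial i Cphi).
  rewrite (_ : (fun _ => _) = partial i phi \* u).
    apply: compact_supportM; exact: compact_support_sub (@support_partial _ _ i phi) cphi.
  by apply/funext => x /=; rewrite mulrC.
have i2 : intble (fun x => partial i u x * phi x).
  apply: (@Ckc_intble 0); split; first exact: CkM (Ck_partial i Cu) (CkS Cphi).
  rewrite (_ : (fun _ => _) = phi \* partial i u); first exact: compact_supportM.
  by apply/funext => x /=; rewrite mulrC.
apply/eqP; rewrite -addr_eq0 -RintegralD//; apply/eqP.
rewrite -[RHS](Rintegral_partial i Cup); apply: eq_Rintegral => x _.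
rewrite partialM; [|exact: Ck_derivable Cu|exact: Ck_derivable Cphi].
by rewrite (mulrC (phi x)).
Qed.

Lemma continuous_loc_integrable f : continuous f -> loc_integrable f.
Proof.
move=> cf; split; first exact: continuous_measurable_rV.
move=> K cK; have mK := compact_measurable_rV cK.
have [M0 [_ KM0]] : bounded_set (f @` K).
  by apply: compact_bounded; apply: continuous_compact => //; exact: continuous_subspaceT.
have KM x : K x -> `|f x| <= `|M0| + 1.
  move=> Kx; apply: (KM0 (`|M0| + 1)); last by exists x.
  by rewrite (le_lt_trans (ler_norm _))// ltrDl.
apply: (@le_lt_trans _ _ (\int[mu]_(x in K) (`|M0| + 1)%:E)%E).
  apply: ge0_le_integral => //.
  apply: measurable_funTS; apply/measurable_EFinP; apply: measurableT_comp => //.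
  exact: continuous_measurable_rV.
by rewrite integral_cst// lte_mul_pinfty// compact_lebesgue_rV_lty.
Qed.

(** Mixed derivatives along a list of directions; by symmetry of second
    derivatives only the multiplicities matter. *)
Definition iter_partial (s : seq 'I_n) f : 'rV[R]_n -> R := foldr (@partial R n) f s.

Lemma Ck_iter_partial k s f : Ck (size s + k) f -> Ck k (iter_partial s f).
Proof.
elim: s k => [//|i s IHs] k Cf /=; apply: Ck_partial; apply: IHs.
by rewrite addnS.
Qed.

Lemma Ckc_iter_partial k s f : Ckc (size s + k) f -> Ckc k (iter_partial s f).
Proof.
elim: s k => [//|i s IHs] k Cf /=; apply: Ckc_partial; apply: IHs.
by rewrite addnS.
Qed.

Lemma test_partial i phi : test_function phi -> test_function (partial i phi).
Proof.
move=> [C c]; split => [k|]; first by apply: Ck_partial; exact: C.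
exact: compact_support_sub (@support_partial _ _ i phi) c.
Qed.

Lemma test_iter_partial s phi : test_function phi -> test_function (iter_partial s phi).
Proof. by move=> tphi; elim: s => //= i s; exact: test_partial. Qed.

Lemma iter_partial_rem i s f : i \in s -> Ck (size s) f ->
  iter_partial s f = partial i (iter_partial (rem i s) f).
Proof.
elim: s => [//|j s IHs] /=; have [->//|ji] := eqVneq j i.
rewrite inE eq_sym (negbTE ji)/= => is_ Cf.
have -> := IHs is_ (CkS (Cf : Ck (size s).+1 f)).
apply: partialC; apply: Ck_iter_partial.
rewrite size_rem//; case: s is_ {IHs} Cf => // l s _ Cf.
by rewrite /= addn2; exact: Cf.
Qed.

Lemma perm_iter_partial s t f : perm_eq s t -> Ck (size s) f ->
  iter_partial s f = iter_partial t f.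
Proof.
elim: s t f => [|i s IHs] t f st Cf.
  by move: st; rewrite perm_sym => /perm_nilP ->.
have it : i \in t by rewrite -(perm_mem st) inE eqxx.
rewrite (iter_partial_rem it); last by rewrite -(perm_size st).
congr partial; apply: IHs; last exact: CkS.
by rewrite -(perm_cons i) (perm_trans st)// perm_to_rem.
Qed.

Lemma multi_partialE a f : multi_partial a f = iter_partial (mi_list a) f.
Proof.
rewrite /multi_partial /mi_list /iter_partial.
elim: (enum 'I_n) => //= i s ->; rewrite foldr_cat.
by elim: (a i) => //= k ->.
Qed.

Lemma multi_partial_perm a s f : (forall i, count_mem i s = a i) ->
  Ck (size s) f -> multi_partial a f = iter_partial s f.
Proof.
move=> sa Cf; rewrite multi_partialE; apply/esym; apply: perm_iter_partial => //.
by apply/allP => i _ /=; rewrite sa count_mi_list.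
Qed.

Lemma integration_by_parts_iter s u phi : Ck (size s) u -> test_function phi ->
  \int[mu]_x (u x * iter_partial s phi x) =
  (-1) ^+ size s * \int[mu]_x (iter_partial s u x * phi x).
Proof.
elim: s u => [|i s IHs] u Cu tphi; first by rewrite expr0 mul1r.
rewrite /= integration_by_parts_partial; last 2 first.
- exact: Ck_leq Cu.
- by apply: test_Ckc; exact: test_iter_partial.
rewrite IHs//; last exact: Ck_partial.
rewrite exprS mulN1r -mulNr; congr (_ * _); apply: eq_Rintegral => x _.
congr (_ * _); rewrite -[LHS]/(iter_partial s (iter_partial [:: i] u) x).
rewrite /iter_partial -foldr_cat -/(iter_partial (s ++ [:: i]) u).
rewrite (@perm_iter_partial _ (i :: s))//; first by rewrite perm_catC.
by rewrite size_cat addn1.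
Qed.

End integration_by_parts.

Section weak_derivatives.
Context {R : realType} {n : nat}.
Implicit Types (f g u v w phi : 'rV[R]_n -> R) (a : 'I_n -> nat).

Local Notation mu := (lebesgue_rV R n).

Lemma weak_deriv_unique a u v w : is_weak_deriv a u v -> is_weak_deriv a u w ->
  v = w %[ae mu].
Proof.
move=> [lu lv uv] [_ lw uw].
have lvw : loc_integrable (fun x => v x - w x).
  case: lv => mv lv; case: lw => mw lw.
  split; first exact: measurable_funB.
  move=> K cK; have mK := compact_measurable_rV cK.
  apply: (@le_lt_trans _ _ (\int[mu]_(x in K) (`|v x|%:E + `|w x|%:E))%E).
    apply: ge0_le_integral => //.
    - apply: measurable_funTS; apply/measurable_EFinP; apply: measurableT_comp => //.
      exact: measurable_funB.
    - apply: measurable_funTS; apply/measurable_EFinP.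
      by apply: measurable_funD => //; exact: measurableT_comp.
    - by move=> x _; rewrite lee_fin ler_normB.
  rewrite ge0_integralD//; first by rewrite lte_add_pinfty// ?lv// ?lw.
  - by apply: measurable_funTS; apply/measurable_EFinP; exact: measurableT_comp.
  - by apply: measurable_funTS; apply/measurable_EFinP; exact: measurableT_comp.
have := loc_integrable_eq0 lvw _; move=> /(_ _)/filterS; apply.
  by move=> x /= /(_ I) /eqP + _; rewrite subr_eq0 => /eqP.
move=> phi tphi; under eq_Rintegral do rewrite mulrBl.
rewrite RintegralB//; [|exact: loc_intbleM_test|exact: loc_intbleM_test].
apply/eqP; rewrite subr_eq0; apply/eqP.
have s0 : (-1) ^+ mi_order a != 0 :> R by rewrite expf_neq0// oppr_eq0 oner_neq0.
by apply: (mulfI s0); rewrite -uv// -uw.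
Qed.

Lemma weak_derivP a u v : is_weak_deriv a u v -> is_weak_deriv a u (weak_deriv a u).
Proof. by move=> H; apply: xgetPex; exists v. Qed.

Lemma weak_deriv_ae a u v : is_weak_deriv a u v -> weak_deriv a u = v %[ae mu].
Proof. by move=> H; exact: (weak_deriv_unique (weak_derivP H) H). Qed.

Lemma is_weak_deriv_lin a (c : R) u v u' v' : is_weak_deriv a u v ->
  is_weak_deriv a u' v' ->
  is_weak_deriv a (fun x => c * u x + u' x) (fun x => c * v x + v' x).
Proof.
have lin f g : loc_integrable f -> loc_integrable g ->
    loc_integrable (fun x : 'rV[R]_n => c * f x + g x).
  move=> [mf lf] [mg lg]; split.
    by apply: measurable_funD => //; exact: measurable_funM.
  move=> K cK; have mK := compact_measurable_rV cK.
  apply: (@le_lt_trans _ _ (\int[mu]_(x in K) (`|c|%:E * `|f x|%:E + `|g x|%:E))%E).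
    apply: ge0_le_integral => //.
    - apply: measurable_funTS; apply/measurable_EFinP; apply: measurableT_comp => //.
      by apply: measurable_funD => //; exact: measurable_funM.
    - apply: measurable_funTS; apply/measurable_EFinP.
      by apply: measurable_funD; [apply: measurable_funM => //|]; exact: measurableT_comp.
    - by move=> x _; rewrite lee_fin -normrM ler_normD.
  have mf' : measurable_fun K (fun x => `|f x|%:E).
    by apply: measurable_funTS; apply/measurable_EFinP; exact: measurableT_comp.
  rewrite ge0_integralD//; last 2 first.
  - exact: measurable_funeM.
  - by apply: measurable_funTS; apply/measurable_EFinP; exact: measurableT_comp.
  by rewrite lte_add_pinfty ?lg// ge0_integralZl_EFin// lte_mul_pinfty// lf.
move=> [lu lv uv] [lu' lv' uv']; split; [exact: lin|exact: lin|].
move=> phi tphi.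
have tD : test_function (multi_partial a phi).
  by rewrite multi_partialE; exact: test_iter_partial.
under eq_Rintegral do rewrite mulrDl -mulrA.
under [in RHS]eq_Rintegral do rewrite mulrDl -mulrA.
rewrite RintegralD//; [|by apply: intbleZ; exact: loc_intbleM_test|exact: loc_intbleM_test].
rewrite RintegralD//; [|by apply: intbleZ; exact: loc_intbleM_test|exact: loc_intbleM_test].
rewrite RintegralZl//; last exact: loc_intbleM_test.
rewrite RintegralZl//; last exact: loc_intbleM_test.
by rewrite uv// uv'//; ring.
Qed.

Lemma Ck_weak_deriv a u : Ck (mi_order a) u -> is_weak_deriv a u (multi_partial a u).
Proof.
move=> Cu; rewrite -(size_mi_list a) in Cu.
split.
- by apply: continuous_loc_integrable; exact: Ck_continuous Cu.
- apply: continuous_loc_integrable; rewrite multi_partialE.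
  by apply: (Ck_continuous (k := 0)); apply: Ck_iter_partial; rewrite addn0.
- move=> phi tphi; rewrite !multi_partialE integration_by_parts_iter//.
  by rewrite size_mi_list.
Qed.

(** Test with the partial derivatives of test functions. *)
Lemma is_weak_deriv_partial a (k : 'I_n) u v w :
  is_weak_deriv a u v -> is_weak_deriv (fun i => (a i + (i == k))%N) u w ->
  is_weak_deriv (fun i => (i == k) : nat) v w.
Proof.
move=> [lu lv uv] [_ lw uw]; split => // phi tphi.
have E1 : multi_partial (fun i => (i == k) : nat) phi = partial k phi.
  apply: (@multi_partial_perm _ _ _ [:: k]); last by case: tphi.
  by move=> i /=; rewrite addn0 eq_sym.
have E2 : multi_partial (fun i => (a i + (i == k))%N) phi =
    multi_partial a (partial k phi).
  rewrite (@multi_partial_perm _ _ _ (rcons (mi_list a) k)).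
  - by rewrite multi_partialE /iter_partial foldr_rcons.
  - move=> i; rewrite -cats1 count_cat count_mi_list/=.
    by rewrite addn0 eq_sym.
  - by case: tphi.
have S1 : mi_order (fun i => (i == k) : nat) = 1%N.
  by rewrite (@mi_order_count _ _ [:: k])// => i /=; rewrite addn0 eq_sym.
have S2 : mi_order (fun i => (a i + (i == k))%N) = (mi_order a).+1.
  rewrite (@mi_order_count _ _ (rcons (mi_list a) k)) ?size_rcons ?size_mi_list//.
  by move=> i; rewrite -cats1 count_cat count_mi_list/= addn0 eq_sym.
rewrite E1 S1 expr1.
have := uw phi tphi; rewrite E2 uv; last exact: test_partial.
rewrite S2 exprS -mulrA => H.
have s0 : (-1) ^+ mi_order a != 0 :> R by rewrite expf_neq0// oppr_eq0 oner_neq0.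
by apply: (mulfI s0); rewrite H; ring.
Qed.

End weak_derivatives.

(** * Averages of translates *)

Section unit_interval.
Context {R : realType}.

Local Notation lam := (@lebesgue_measure R).
Local Notation unit_indic := (\1_(`[0%R, 1%R]%classic) : measurableTypeR R -> R).

Let unit_measure : lam `[0%R, 1%R]%classic = 1%E.
Proof. by rewrite lebesgue_measure_itv/= lte_fin ltr01 sube0. Qed.

Lemma Rintegral_unit_indic : \int[lam]_t unit_indic t = 1.
Proof.
rewrite /Rintegral integral_indic//= setIT.
by rewrite (_ : lebesgue_measure _ = 1%E)//; exact: unit_measure.
Qed.

Lemma intble_unit_indic : lam.-integrable setT (EFin \o unit_indic).
Proof.
apply: ge0_intbleP => //.
rewrite integral_indic//= setIT.
by rewrite (_ : lebesgue_measure _ = 1%E) ?ltry//; exact: unit_measure.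
Qed.

Lemma continuous_measurable_unit (f : R -> R) : continuous f ->
  measurable_fun setT (f : measurableTypeR R -> R).
Proof. exact: continuous_measurable_fun. Qed.

Lemma intble_unit (f : R -> R) : continuous f ->
  lam.-integrable setT (EFin \o (fun t : measurableTypeR R => unit_indic t * f t)).
Proof.
move=> cf.
have [M0 [_ KM0]] : bounded_set (f @` `[0, 1]).
  apply: compact_bounded; apply: continuous_compact; last exact: segment_compact.
  exact: continuous_subspaceT.
have KM x : x \in `[0, 1] -> `|f x| <= `|M0| + 1.
  move=> Kx; apply: (KM0 (`|M0| + 1)); last by exists x.
  by rewrite (le_lt_trans (ler_norm _))// ltrDl.
apply: (@le_intble _ _ _ _ _ (fun t => (`|M0| + 1) * unit_indic t)).
- by apply: measurable_funM => //; exact: continuous_measurable_unit.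
- move=> t; rewrite normrM indicE; case: (boolP (t \in _)) => [/set_mem tI|_].
    by rewrite normr1 mul1r mulr1; exact: KM.
  by rewrite normr0 mul0r mulr0.
- by apply: intbleZ; exact: intble_unit_indic.
Qed.

(** The interval enters as a weight, so that the integral can be read as an
    average over the parameter of a segment. *)
Lemma FTC_unit (G G' : R -> R) : (forall t, is_derive t (1 : R) G (G' t)) ->
  continuous G' ->
  G 1 - G 0 = \int[lam]_t (unit_indic t * G' t).
Proof.
move=> dG cG'.
have cG : continuous G.
  move=> t; apply: differentiable_continuous; apply/derivable1_diffP.
  by have [] := dG t.
have := @continuous_FTC2 R G' G 0 1 ltr01 _ _ _.
move=> /(_ (continuous_subspaceT cG')) H.
have {}H : (\int[lam]_(x in `[0%R, 1%R]) (G' x)%:E = (G 1)%:E - (G 0)%:E)%E.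
  apply: H.
  - split; first by move=> t _; have [] := dG t.
      by apply: cvg_at_right_filter; exact: cG.
    by apply: cvg_at_left_filter; exact: cG.
  - by move=> t _; rewrite derive1E; have [_ ->] := dG t.
rewrite /Rintegral (_ : (\int[lam]_t _ = (G 1)%:E - (G 0)%:E)%E)// -H.
rewrite [RHS]integral_mkcond; apply: eq_integral => t _.
by rewrite patchE indicE; case: ifP; rewrite ?mul1r ?mul0r.
Qed.

End unit_interval.

Lemma measurable_funV_ge0 (R : realType) d (T : measurableType d) (f : T -> R) :
  (forall x, 0 <= f x) -> measurable_fun setT f ->
  measurable_fun setT (fun x => (f x)^-1).
Proof.
move=> f0 mf.
under eq_fun do rewrite -powR_inv1//.
exact: (measurableT_comp (measurable_powR (-1))).
Qed.

Section translation_average.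
Context d (S : measurableType d) {R : realType} {n : nat}.
Context (nu : {sigma_finite_measure set S -> \bar R}).
Context (p : R) (p1 : 1 <= p).
Implicit Types (g f : 'rV[R]_n -> R).

Local Notation mu := (lebesgue_rV R n).
Local Notation N f := ('N[mu]_p%:E[EFin \o f%R])%E.
Local Notation intble f := (nu.-integrable setT (EFin \o f)).

(** A weighted average of translates. Mollification and the nonlocal operator
    are both of this form. *)
Definition tavg (w : S -> R) (a : S -> 'rV[R]_n) g (x : 'rV[R]_n) : R :=
  \int[nu]_s (w s * g (x - a s)).

Lemma Lnorm_shift g h : measurable_fun setT g -> N (fun x => g (x + h)) = N g.
Proof.
move=> mg; rewrite !LnormE; apply: (congr1 (fun y => y `^ p^-1)%E).
have := @ge0_integral_affine_rV _ _ 1 h (fun x => (`|g x| `^ p)%:E) (oner_neq0 _).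
rewrite normr1 expr1n invr1 mul1e => <-.
- by apply: eq_integral => x _; rewrite scale1r.
- exact: measurable_abs_powR.
- by move=> x; rewrite lee_fin powR_ge0.
Qed.

Context (w : S -> R) (a : S -> 'rV[R]_n).
Hypothesis w_int : intble w.
Hypothesis ma : measurable_fun setT a.

Let W := \int[nu]_s `|w s|.

Let W_ge0 : 0 <= W. Proof. by apply: Rintegral_ge0. Qed.

Let msub g : measurable_fun setT g ->
  measurable_fun setT (fun xs : 'rV[R]_n * S => g (xs.1 - a xs.2)).
Proof.
move=> mg; apply: (measurableT_comp mg); apply: measurable_fun_rVP => i.
under eq_fun do rewrite !mxE.
apply: measurable_funB.
  exact: (measurableT_comp (measurable_coord i) measurable_fst).
apply: (measurableT_comp (measurable_coord i)).
exact: (measurableT_comp ma measurable_snd).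
Qed.

Let N_le g : g \in Lfun mu p%:E ->
  forall s, (N (fun x => g (x - a s)) <= (fine (N g))%:E)%E.
Proof.
by move=> gL s; rewrite Lnorm_shift ?Lfun_fineK//; exact: Lfun_measurable gL.
Qed.

Let fineN_ge0 g : 0 <= fine (N g).
Proof. by rewrite fine_ge0// Lnorm_ge0. Qed.

Lemma measurable_tavg g : measurable_fun setT g -> measurable_fun setT (tavg w a g).
Proof. by move=> mg; exact: (measurable_Rintegral_param w_int (msub mg)). Qed.

(** Translations are isometries of L^p, so this is Minkowski's inequality. *)
Lemma tavg_norm g : g \in Lfun mu p%:E -> (N (tavg w a g) <= W%:E * N g)%E.
Proof.
move=> gL; rewrite -(Lfun_fineK gL) -EFinM.
exact: (signed_minkowski p1 w_int (msub (Lfun_measurable gL)) (fineN_ge0 g) (N_le gL)).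
Qed.

Lemma tavg_Lfun g : g \in Lfun mu p%:E -> tavg w a g \in Lfun mu p%:E.
Proof.
move=> gL; apply/Lfun_normP; split; first exact: measurable_tavg (Lfun_measurable gL).
apply: (le_lt_trans (tavg_norm gL)); rewrite -(Lfun_fineK gL) -EFinM.
exact: ltry.
Qed.

Lemma tavg_intble_ae g : g \in Lfun mu p%:E ->
  {ae mu, forall x, intble (fun s => w s * g (x - a s))}.
Proof.
move=> gL.
exact: (signed_minkowski_ae p1 w_int (msub (Lfun_measurable gL)) (fineN_ge0 g) (N_le gL)).
Qed.

Lemma tavg_lin (c : R) f g : f \in Lfun mu p%:E -> g \in Lfun mu p%:E ->
  tavg w a (fun x => c * f x + g x) = (fun x => c * tavg w a f x + tavg w a g x) %[ae mu].
Proof.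
move=> /tavg_intble_ae fi /tavg_intble_ae gi.
apply: filterS2 fi gi => x fx gx _; rewrite /tavg.
under eq_Rintegral do rewrite mulrDr mulrCA.
by rewrite RintegralD//; [rewrite RintegralZl|exact: intbleZ].
Qed.

Lemma tavgB f g : f \in Lfun mu p%:E -> g \in Lfun mu p%:E ->
  tavg w a (f \- g) = (tavg w a f \- tavg w a g) %[ae mu].
Proof.
move=> /tavg_intble_ae fi /tavg_intble_ae gi.
apply: filterS2 fi gi => x fx gx _; rewrite /tavg/=.
by under eq_Rintegral do rewrite mulrBr; rewrite RintegralB.
Qed.

Lemma tavg_ae f g : f \in Lfun mu p%:E -> g \in Lfun mu p%:E ->
  f = g %[ae mu] -> tavg w a f = tavg w a g %[ae mu].
Proof.
move=> fL gL fg.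
have mf := Lfun_measurable fL; have mg := Lfun_measurable gL.
have fgL : (f \- g) \in Lfun mu p%:E by exact: LfunB.
have N0 : (N (f \- g) = 0)%E.
  rewrite -[RHS](Lnorm_fun0 mu p1); apply: eq_Lnorm_ae => //.
    exact: measurable_funB.
  by move: fg; apply: filterS => x /= /(_ I) -> _; rewrite subrr.
have : (N (tavg w a (f \- g)) <= 0)%E by rewrite (le_trans (tavg_norm fgL))// N0 mule0.
move=> h; have {}h : (N (tavg w a (f \- g)) = 0)%E.
  by apply/eqP; rewrite eq_le h Lnorm_ge0.
have := Lnorm0_ae p1 (measurable_tavg (Lfun_measurable fgL)) h.
apply: filterS2 (tavgB fL gL) => x /(_ I) /= + /(_ I) E _.
by rewrite E => /esym/eqP; rewrite subr_eq0 => /eqP.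
Qed.

(** The bound on the displacement of g may grow with s: the difference is divided
    by b before Minkowski's inequality is applied, and the weight multiplied. *)
Lemma tavg_diff g (b : S -> R) (c : R) : g \in Lfun mu p%:E ->
  measurable_fun setT b -> (forall s, 0 < b s) ->
  intble (fun s => w s * b s) -> 0 <= c ->
  (forall s, (N (fun x => (g (x - a s) - g x)%R) <= (c * b s)%:E)%E) ->
  (N (tavg w a g \- (fun x => (\int[nu]_s w s) * g x))
    <= ((\int[nu]_s `|w s * b s|) * c)%:E)%E.
Proof.
move=> gL mb b0 wb_int c0 Ng.
have mg := Lfun_measurable gL.
pose F (xs : 'rV[R]_n * S) := (b xs.2)^-1 * (g (xs.1 - a xs.2) - g xs.1).
have mF : measurable_fun setT F.
  apply: measurable_funM.
    apply: measurable_funV_ge0; first by move=> xs; rewrite ltW.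
    exact: (measurableT_comp mb measurable_snd).
  apply: measurable_funB; first exact: msub.
  exact: (measurableT_comp mg measurable_fst).
have NF s : (N (fun x => F (x, s)) <= c%:E)%E.
  have mgs : measurable_fun setT (fun x : 'rV[R]_n => g (x - a s) - g x).
    by apply: measurable_funB => //; exact: measurable_shift.
  rewrite (LnormZ_fun mu p1 (b s)^-1 mgs).
  apply: (le_trans (lee_wpmul2l _ (Ng s))); first by rewrite lee_fin.
  rewrite -EFinM lee_fin gtr0_norm ?invr_gt0// mulrCA mulVf ?mulr1//.
  by rewrite gt_eqF.
have E : (tavg w a g \- (fun x => (\int[nu]_s w s) * g x)) =
    (fun x => \int[nu]_s ((w s * b s) * F (x, s))) %[ae mu].
  have := tavg_intble_ae gL; apply: filterS => x gx _ /=.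
  rewrite /tavg mulrC -RintegralZl// -RintegralB//; last exact: intbleZ.
  apply: eq_Rintegral => s _; rewrite /F/= -mulrA (mulrA (b s)) mulfV ?gt_eqF//.
  by rewrite mul1r mulrBr (mulrC (g x)).
rewrite (eq_Lnorm_ae _ _ _ E).
- exact: (signed_minkowski p1 wb_int mF c0 NF).
- apply: measurable_funB; first exact: measurable_tavg.
  exact: measurable_funM.
- exact: (measurable_Rintegral_param wb_int mF).
Qed.

End translation_average.

Section translation_estimates.
Context {R : realType} {n : nat} (p : R) (p1 : 1 <= p).
Implicit Types (g f : 'rV[R]_n -> R).

Local Notation mu := (lebesgue_rV R n).
Local Notation N f := ('N[mu]_p%:E[EFin \o f%R])%E.
Local Notation lam := (@lebesgue_measure R).
Local Notation unit_indic := (\1_(`[0%R, 1%R]%classic) : measurableTypeR R -> R).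

Lemma C1_increment g (x h : 'rV[R]_n) : Ck 1 g ->
  g (x - h) - g x = \sum_(k < n)
    \int[lam]_t ((- h ord0 k * unit_indic t) * partial k g (x - t *: h)).
Proof.
move=> Cg.
pose G' (t : R) := \sum_(k < n) - h ord0 k * partial k g (x + t *: (- h)).
have dG (t : R) : is_derive t (1 : R) (fun s => g (x + s *: (- h))) (G' t).
  have [d1 d2] := C1_derive (x + t *: (- h)) (- h) Cg.
  have := is_derive_line d1; rewrite d2 (_ : \sum_(k < n) _ = G' t)//.
  by apply: eq_bigr => k _; rewrite mxE.
have cline : continuous (fun t : R => x + t *: (- h)).
  move=> t; apply: (@continuousD _ _ _ (cst x) (fun t : R => t *: (- h))).
    exact: cst_continuous.
  by apply: (@continuousZl _ _ _ (fun t : R => t)); exact: cvg_id.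
have cpart k : continuous (fun t : R => partial k g (x + t *: (- h))).
  move=> t; apply: (@continuous_comp _ _ _ (fun t : R => x + t *: (- h)) (partial k g)).
    exact: cline.
  exact: (Ck_continuous (Ck_partial k Cg)).
have cG' : continuous G'.
  move=> t; apply: cvg_big => [|k _]; first exact: add_continuous.
  by apply: cvgM; [exact: cvg_cst|exact: (cpart k t)].
have := FTC_unit dG cG'; rewrite scale1r scale0r addr0 => ->.
under eq_Rintegral do rewrite mulr_sumr.
rewrite Rintegral_sum; last first.
  move=> k.
  under [X in _ \o X]eq_fun do rewrite mulrCA.
  by apply: intbleZ; apply: intble_unit; exact: cpart.
apply: eq_bigr => k _; apply: eq_Rintegral => t _.
by rewrite scalerN mulrCA mulrA.
Qed.

Lemma Lnorm_translate_C1 g h (C : R) : Ck 1 g -> 0 <= C ->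
  (forall k, partial k g \in Lfun mu p%:E) ->
  (forall k, (N (partial k g) <= C%:E)%E) ->
  (N (fun x => (g (x - h) - g x)%R) <= ((\sum_(k < n) `|h ord0 k|) * C)%:E)%E.
Proof.
move=> Cg C0 gL gC.
pose w k (t : measurableTypeR R) : R := - h ord0 k * unit_indic t.
pose a (t : measurableTypeR R) : 'rV[R]_n := t *: h.
have w_int k : lam.-integrable setT (EFin \o w k).
  by apply: intbleZ; exact: intble_unit_indic.
have ma : measurable_fun setT a.
  apply: measurable_fun_rVP => i; rewrite /a.
  under eq_fun do rewrite mxE.
  exact: measurable_funM.
have -> : (fun x => g (x - h) - g x) = (fun x => \sum_(k < n) tavg lam (w k) a (partial k g) x).
  by apply/funext => x; rewrite C1_increment.
apply: (le_trans (Lnorm_sum mu p1 _ _)).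
  move=> k; apply: measurable_tavg => //; exact: Lfun_measurable (gL k).
rewrite mulr_suml -sumEFin; apply: lee_sum => k _.
apply: (le_trans (tavg_norm p1 (w_int k) ma (gL k))).
have -> : \int[lam]_s `|w k s| = `|h ord0 k|.
  rewrite /w; under eq_Rintegral do rewrite normrM normrN [X in _ * X]ger0_norm//.
  by rewrite RintegralZl ?Rintegral_unit_indic ?mulr1//; exact: intble_unit_indic.
by rewrite EFinM lee_wpmul2l// lee_fin.
Qed.

Lemma sum_coord_le_norm (h : 'rV[R]_n) : \sum_(k < n) `|h ord0 k| <= n%:R * `|h|.
Proof.
apply: (@le_trans _ _ (\sum_(k < n) `|h|)).
  by apply: ler_sum => k _; exact: coord_le_norm.
by rewrite sumr_const card_ord mulr_natl.
Qed.

Context d (S : measurableType d) (nu : {sigma_finite_measure set S -> \bar R}).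
Context (w : S -> R) (a : S -> 'rV[R]_n).
Hypothesis w_int : nu.-integrable setT (EFin \o w).
Hypothesis ma : measurable_fun setT a.
Hypothesis wa_int : nu.-integrable setT (EFin \o (fun s => w s * (1 + `|a s|))).

Lemma measurable_norm_rV (b : S -> 'rV[R]_n) : measurable_fun setT b ->
  measurable_fun setT (fun s => `|b s|).
Proof.
move=> mb; apply: (@measurableT_comp _ _ _ _ _ _ (@Num.norm R 'rV[R]_n)) => //.
by apply: continuous_measurable_rV; exact: norm_continuous.
Qed.

(** Contracting the translations makes the average converge to a multiple of
    the identity in L^p: a rate holds for test functions, which are dense. *)
Lemma tavg_approx g (e : R) : g \in Lfun mu p%:E -> 0 < e ->
  exists2 r : R, 0 < r & forall t : R, 0 < t -> t < r ->
    (N (tavg nu w (fun s => t *: a s) g \- (fun x => (\int[nu]_s w s) * g x))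
      <= e%:E)%E.
Proof.
move=> gL e0; have mg := Lfun_measurable gL.
pose W := \int[nu]_s `|w s|.
have W0 : 0 <= W by exact: Rintegral_ge0.
pose e' := e / (3 * (W + 1)).
have e'0 : 0 < e' by rewrite divr_gt0// mulr_gt0// ltr_wpDl.
have [phi tphi gphi] := test_dense p1 gL e'0.
have phiL : phi \in Lfun mu p%:E by exact: Ckc_Lfun (test_Ckc 0 tphi).
have mphi := Lfun_measurable phiL.
have dL k : partial k phi \in Lfun mu p%:E.
  exact: Ckc_Lfun (test_Ckc 0 (test_partial k tphi)).
pose C := \sum_(k < n) fine (N (partial k phi)).
have C0 : 0 <= C by apply: sumr_ge0 => k _; rewrite fine_ge0// Lnorm_ge0.
have dC k : (N (partial k phi) <= C%:E)%E.
  rewrite -(Lfun_fineK (dL k)) lee_fin /C (bigD1 k)//= lerDl.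
  by apply: sumr_ge0 => j _; rewrite fine_ge0// Lnorm_ge0.
pose K := (\int[nu]_s `|w s * (1 + `|a s|)|) * (n%:R * C).
have K0 : 0 <= K by rewrite mulr_ge0 ?mulr_ge0//; exact: Rintegral_ge0.
exists (e / (3 * (K + 1))); first by rewrite divr_gt0// mulr_gt0// ltr_wpDl.
move=> t t0 tr.
have mta : measurable_fun setT (fun s => t *: a s).
  apply: measurable_fun_rVP => i.
  under eq_fun do rewrite mxE.
  by apply: measurable_funM => //; exact: (measurableT_comp (measurable_coord i)).
pose T f := tavg nu w (fun s => t *: a s) f.
have mT f : f \in Lfun mu p%:E -> measurable_fun setT (T f).
  by move=> fL; apply: measurable_tavg => //; exact: Lfun_measurable fL.
have Tphi : (N (T phi \- (fun x => (\int[nu]_s w s) * phi x)) <= (t * K)%:E)%E.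
  rewrite /K mulrCA.
  apply: (tavg_diff p1 w_int mta (b := fun s => 1 + `|a s|)) => //.
  - by apply: measurable_funD => //; exact: measurable_norm_rV.
  - by rewrite mulr_ge0 ?mulr_ge0// ltW.
  - move=> s; have := Lnorm_translate_C1 (t *: a s) (tphi.1 1%N) C0 dL dC.
    move=> /le_trans; apply; rewrite lee_fin.
    apply: (le_trans (ler_wpM2r C0 (sum_coord_le_norm _))).
    rewrite normrZ gtr0_norm//.
    have -> : n%:R * (t * `|a s|) * C = t * (n%:R * C) * `|a s| by ring.
    by apply: ler_wpM2l; [rewrite !mulr_ge0// ltW|rewrite lerDr].
have gphiL : (g \- phi) \in Lfun mu p%:E by exact: LfunB.
have Tg : (N (T g \- T phi) <= (W * e')%:E)%E.
  rewrite -(eq_Lnorm_ae _ _ _ (tavgB p1 w_int mta gL phiL)).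
  - apply: (le_trans (tavg_norm p1 w_int mta gphiL)).
    by rewrite EFinM lee_wpmul2l// lee_fin.
  - exact: mT.
  - by apply: measurable_funB; exact: mT.
have Wphi : (N ((fun x => (\int[nu]_s w s) * phi x) \- (fun x => (\int[nu]_s w s) * g x))
    <= (W * e')%:E)%E.
  have -> : ((fun x => (\int[nu]_s w s) * phi x) \- (fun x => (\int[nu]_s w s) * g x)) =
    (fun x => (\int[nu]_s w s) * (phi \- g) x).
    by apply/funext => x /=; rewrite mulrBr.
  rewrite LnormZ_fun//; last exact: measurable_funB.
  rewrite EFinM Lnorm_distC; apply: lee_pmul => //; first exact: Lnorm_ge0.
  by rewrite lee_fin; exact: le_normr_Rintegral.
have mW f : f \in Lfun mu p%:E -> measurable_fun setT (fun x => (\int[nu]_s w s) * f x).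
  by move=> fL; apply: measurable_funM => //; exact: Lfun_measurable fL.
apply: (le_trans (Lnorm_triangle mu p1 (mT _ gL) (mT _ phiL) (mW _ gL))).
apply: (le_trans (leeD Tg (Lnorm_triangle mu p1 (mT _ phiL) (mW _ phiL) (mW _ gL)))).
apply: (le_trans (leeD (lexx _) (leeD Tphi Wphi))).
rewrite -!EFinD lee_fin.
have h1 : W * e' <= e / 3.
  have E1 : (W + 1) * e' = e / 3 by rewrite /e'; field; rewrite gt_eqF// ltr_wpDl.
  by move: E1 e'0; rewrite mulrDl mul1r => <- ?; rewrite lerDl ltW.
have h2 : t * K <= e / 3.
  have : t * (3 * (K + 1)) <= e by rewrite -ler_pdivlMr ?ltW// mulr_gt0// ltr_wpDl.
  by move: t0 K0; nra.
by lra.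
Qed.

End translation_estimates.

(** * Mollification *)

Section convolution.
Context {R : realType} {n : nat}.
Implicit Types (g h psi : 'rV[R]_n -> R) (x : 'rV[R]_n).

Local Notation mu := (lebesgue_rV R n).
Local Notation intble f := (mu.-integrable setT (EFin \o f)).
Local Notation e_ i := (delta_mx ord0 i : 'rV[R]_n).

Definition convol g psi x : R := \int[mu]_y (g y * psi (x - y)).

Lemma test_reflect psi x : test_function psi -> test_function (fun y => psi (x - y)).
Proof.
move=> tpsi; under eq_fun do rewrite addrC -scaleN1r.
by apply: test_function_affine => //; rewrite oppr_eq0 oner_neq0.
Qed.

Lemma test_lipschitz psi : test_function psi ->
  exists2 L : R, 0 <= L & forall a b, `|psi a - psi b| <= L * `|a - b|.
Proof.
move=> tpsi.
have /choice[M HM] : forall k, exists M, forall x, `|partial k psi x| <= M.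
  by move=> k; exact: Ckc_bounded (test_Ckc 0 (test_partial k tpsi)).
exists (\sum_k `|M k|); first exact: sumr_ge0.
move=> a b; have [w _] := @mean_value _ _ psi b (a - b)
  (fun i y => @Ck_derivable _ _ _ i _ y (tpsi.1 1%N)).
rewrite (_ : b + (a - b) = a); last by rewrite addrC subrK.
move=> ->; rewrite mulr_suml.
apply: (le_trans (ler_norm_sum _ _ _)); apply: ler_sum => k _.
rewrite normrM mulrC ler_pM//; last exact: coord_le_norm.
by rewrite (le_trans (HM _ _))// ler_norm.
Qed.

Let convol_bound g (D : 'rV[R]_n -> R) (c r : R) : loc_integrable g ->
  measurable_fun setT D -> (forall y, `|D y| <= c) ->
  (forall y, r < `|y| -> D y = 0) ->
  `|\int[mu]_y (g y * D y)| <= c * \int[mu]_y (`|g y| * \1_(normball r) y).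
Proof.
move=> lg mD Dc Dr.
have gD : intble (fun y => g y * D y) by exact: loc_intbleM lg mD Dc Dr.
have gK : intble (fun y => `|g y| * \1_(normball r) y).
  by apply: loc_intble_indic => //; exact: compact_norm_le.
apply: (le_trans (le_normr_Rintegral _ gD)) => //.
rewrite -RintegralZl//; apply: le_Rintegral => //.
- exact: intble_norm.
- exact: intbleZ.
- move=> y _; rewrite normrM mulrCA.
  have [yr|yr] := leP `|y| r; last first.
    rewrite Dr// normr0 mulr0 !mulr_ge0//.
    by rewrite (le_trans _ (Dc 0)).
  by rewrite indicE mem_set//= mulr1 ler_wpM2l.
Qed.

Let far_away (r : R) x (h y : 'rV[R]_n) : `|h| <= 1 -> r + `|x| + 1 < `|y| ->
  r < `|x + h - y|.
Proof.
move=> h1 yr.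
have : `|y| <= `|x| + `|h| + `|x + h - y|.
  rewrite [in leLHS](_ : y = x + h - (x + h - y)); last by rewrite subKr.
  apply: (le_trans (ler_normB _ _)).
  by rewrite lerD2r ler_normD.
by move: h1 yr; lra.
Qed.

Lemma convol_lipschitz g psi x : loc_integrable g -> test_function psi ->
  exists2 K : R, 0 <= K & forall h : 'rV[R]_n, `|h| <= 1 ->
    `|convol g psi (x + h) - convol g psi x| <= K * `|h|.
Proof.
move=> lg tpsi; have [L L0 psiL] := test_lipschitz tpsi.
have [r _ psir] := compact_support_bound tpsi.2.
pose K := \int[mu]_y (`|g y| * \1_(normball (r + `|x| + 1)) y).
exists (L * K) => [|h h1].
  by rewrite mulr_ge0//; apply: Rintegral_ge0 => y _; rewrite mulr_ge0.
rewrite /convol -RintegralB//; first last.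
- by apply: loc_intbleM_test => //; exact: test_reflect.
- by apply: loc_intbleM_test => //; exact: test_reflect.
under eq_Rintegral do rewrite -mulrBr.
rewrite mulrAC; apply: convol_bound => //.
- by apply: measurable_funB; apply: (Ck_measurable (k := 0));
    apply: (test_reflect _ tpsi).1.
- move=> y; apply: (le_trans (psiL _ _)).
  by rewrite opprB addrA subrK addrAC subrr add0r.
- move=> y yr; rewrite !psir ?subrr//; last exact: far_away.
  by rewrite -(addr0 x); apply: far_away => //; rewrite normr0.
Qed.

Lemma continuous_convol g psi : loc_integrable g -> test_function psi ->
  continuous (convol g psi).
Proof.
move=> lg tpsi x; have [K K0 gK] := convol_lipschitz x lg tpsi.
apply/(@cvgrPdist_le _ _ _ (nbhs (x : 'rV[R]_n))) => e e0; apply/nbhs_ballP.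
exists (Num.min 1 (e / (K + 1))) => [|y].
  by rewrite /= lt_min ltr01/= divr_gt0// ltr_wpDl.
rewrite -ball_normE/= => xy.
have -> : y = x + (y - x) by rewrite addrC subrK.
move: xy; rewrite lt_min => /andP[xy1 xye].
rewrite distrC; apply: (le_trans (gK _ _)); first by rewrite distrC ltW.
rewrite distrC; move: xye; rewrite ltr_pdivlMr ?ltr_wpDl// => /ltW.
by apply: le_trans; rewrite mulrC ler_wpM2l// lerDl.
Qed.

Let convol_taylor g psi k x : loc_integrable g -> test_function psi ->
  exists2 K : R, 0 <= K & forall t : R, `|t| <= 1 ->
    `|convol g psi (x + t *: e_ k) - convol g psi x - t * convol g (partial k psi) x|
      <= K * `|t| ^+ 2.
Proof.
move=> lg tpsi; have tkpsi := test_partial k tpsi.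
have [L L0 psiL] := test_lipschitz tkpsi.
have [r _ psir] := compact_support_bound tpsi.2.
have [r' _ psir'] := compact_support_bound tkpsi.2.
pose q := Num.max r r'.
pose K := \int[mu]_y (`|g y| * \1_(normball (q + `|x| + 1)) y).
exists (L * K) => [|t t1].
  by rewrite mulr_ge0//; apply: Rintegral_ge0 => y _; rewrite mulr_ge0.
have I1 z : intble (fun y => g y * psi (z - y)).
  by apply: loc_intbleM_test => //; exact: test_reflect.
have I2 z : intble (fun y => g y * partial k psi (z - y)).
  by apply: loc_intbleM_test => //; exact: test_reflect.
rewrite /convol -RintegralB// -RintegralZl//.
rewrite -RintegralB//; [|exact: intbleB|exact: intbleZ].
under eq_Rintegral do rewrite mulrCA -!mulrBr.
have te1 : `|t *: e_ k| <= 1.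
  by rewrite normrZ (le_trans (ler_wpM2l _ (norm_delta_le1 k)))// mulr1.
rewrite mulrAC; apply: convol_bound => //.
- apply: measurable_funB; first apply: measurable_funB.
  + by apply: (Ck_measurable (k := 0)); apply: (test_reflect _ tpsi).1.
  + by apply: (Ck_measurable (k := 0)); apply: (test_reflect _ tpsi).1.
  + apply: measurable_funM => //.
    by apply: (Ck_measurable (k := 0)); apply: (test_reflect _ tkpsi).1.
- move=> y; have -> : x + t *: e_ k - y = x - y + t *: e_ k by rewrite addrAC.
  have [s st ->] := @mvt_line _ _ psi k (x - y) t
    (fun y => @Ck_derivable _ _ _ k _ y (tpsi.1 1%N)).
  rewrite -mulrBr normrM expr2 mulrCA ler_wpM2l//.
  apply: (le_trans (psiL _ _)); rewrite addrAC subrr add0r normrZ.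
  rewrite ler_wpM2l// (le_trans _ st)// -[leRHS]mulr1 ler_wpM2l//.
  exact: norm_delta_le1.
- move=> y yr; rewrite !psir ?psir' ?mulr0 ?subrr//.
  + rewrite -(addr0 x) (le_lt_trans (_ : _ <= q)) ?le_max ?lexx ?orbT//.
    by apply: far_away => //; rewrite normr0.
  + rewrite -(addr0 x) (le_lt_trans (_ : _ <= q)) ?le_max ?lexx ?orbT//.
    by apply: far_away => //; rewrite normr0.
  + rewrite (le_lt_trans (_ : _ <= q)) ?le_max ?lexx ?orbT//.
    exact: far_away.
Qed.

Lemma partial_convol g psi k x : loc_integrable g -> test_function psi ->
  derivable (convol g psi) x (e_ k) /\
  partial k (convol g psi) x = convol g (partial k psi) x.
Proof.
move=> lg tpsi; have [K K0 gK] := convol_taylor k x lg tpsi.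
suff : h^-1 *: (convol g psi (h *: e_ k + x) - convol g psi x) @[h --> 0^'] -->
    convol g (partial k psi) x.
  by move=> cv; split; [apply/cvg_ex; eexists; exact: cv|exact/cvg_lim].
apply/cvgrPdist_le => e e0; near=> t.
have t0 : t != 0 by near: t; exact: nbhs_dnbhs_neq.
have tn0 : 0 < `|t| by rewrite normr_gt0.
have te : `|t| < Num.min 1 (e / (K + 1)).
  near: t; apply: dnbhs0_lt.
  by rewrite lt_min ltr01/= divr_gt0// ltr_wpDl.
move: te; rewrite lt_min => /andP[t1 te].
rewrite (addrC (t *: _)) distrC -(ler_pM2l tn0) -normrM mulrBr.
rewrite /GRing.scale/= mulVKf//.
apply: (le_trans (gK _ (ltW t1))); rewrite expr2 mulrCA ler_wpM2l//.
move: te; rewrite ltr_pdivlMr ?ltr_wpDl// => /ltW.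
by apply: le_trans; rewrite mulrC ler_wpM2l// lerDl.
Unshelve. all: by end_near. Qed.

(** Convolution moves all derivatives to the test function. *)
Lemma Ck_convol k g psi : loc_integrable g -> test_function psi ->
  Ck k (convol g psi).
Proof.
elim: k psi => [|k IH] psi lg tpsi; (split; first exact: continuous_convol) => // i.
split=> [x|]; first by have [] := partial_convol i x lg tpsi.
have -> : partial i (convol g psi) = convol g (partial i psi).
  by apply/funext => x; have [] := partial_convol i x lg tpsi.
by apply: IH => //; exact: test_partial.
Qed.

(** The kernel y |-> psi (x - y) is itself a test function, so derivatives may
    also be moved to g when it has weak ones. *)
Lemma partial_convol_weak g h psi k :
  is_weak_deriv (fun i => (i == k) : nat) g h -> test_function psi ->
  partial k (convol g psi) = convol h psi.
Proof.
move=> [lg lh gh] tpsi; apply/funext => x.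
have [_ ->] := partial_convol k x lg tpsi.
have tx := test_reflect x tpsi.
have E1 : multi_partial (fun i => (i == k) : nat) (fun y => psi (x - y)) =
    (fun y => - partial k psi (x - y)).
  rewrite (@multi_partial_perm _ _ _ [:: k]); last by case: tx.
    have E : (fun y => psi (x - y)) = (fun y => psi ((-1) *: y + x)).
      by apply/funext => y; rewrite scaleN1r addrC.
    rewrite /iter_partial/= E partial_affine; last first.
      by move=> z; exact: Ck_derivable (tpsi.1 1%N).
    by apply/funext => y; rewrite mulN1r scaleN1r (addrC _ x).
  by move=> i /=; rewrite addn0 eq_sym.
have S1 : mi_order (fun i => (i == k) : nat) = 1%N.
  by rewrite (@mi_order_count _ _ [:: k])// => i /=; rewrite addn0 eq_sym.
have EN : \int[mu]_y (g y * - partial k psi (x - y)) =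
    - \int[mu]_y (g y * partial k psi (x - y)).
  rewrite -mulN1r -RintegralZl//; last first.
    by apply: loc_intbleM_test => //; apply: test_reflect; exact: test_partial.
  by apply: eq_Rintegral => y _; rewrite mulN1r mulrN.
by have := gh _ tx; rewrite E1 S1 expr1 mulN1r EN => /oppr_inj.
Qed.

End convolution.

Section mollification.
Context {R : realType} {n : nat} (p : R) (p1 : 1 <= p).
Implicit Types (g h psi eta : 'rV[R]_n -> R).

Local Notation mu := (lebesgue_rV R n).
Local Notation N f := ('N[mu]_p%:E[EFin \o f%R])%E.

(** Were all integrals of test functions 0, the fundamental lemma applied to the
    constant 1 would make the whole space a null set. *)
Lemma mollifier_exists : exists2 eta : 'rV[R]_n -> R, test_function eta &
  \int[mu]_x eta x = 1.
Proof.
have [eta teta eta0] : exists2 eta : 'rV[R]_n -> R, test_function eta &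
    \int[mu]_x eta x != 0.
  apply: contrapT => no.
  have loc1 : loc_integrable (cst 1 : 'rV[R]_n -> R).
    by apply: continuous_loc_integrable; exact: cst_continuous.
  have : (cst 1 : 'rV[R]_n -> R) = cst 0 %[ae mu].
    apply: loc_integrable_eq0 => // phi tphi.
    apply: contrapT => /eqP H; apply: no; exists phi => //.
    by move: H; under eq_Rintegral do rewrite mul1r.
  move=> [A [mA A0 sub]].
  have AT : A = setT.
    apply/seteqP; split => // x _; apply: sub => /=.
    by move=> /(_ I)/eqP; rewrite oner_eq0.
  have := @lebesgue_rV_box R n (fun=> `[0, 1]%classic) (fun=> measurable_itv _).
  rewrite big1; last by move=> i _; rewrite lebesgue_measure_itv/= lte_fin ltr01 sube0.
  move=> B1; have : (mu [set x : 'rV[R]_n | forall i, `[0%R, 1%R]%classic (x ord0 i)] <= mu A)%E.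
    apply: le_measure; rewrite ?inE ?AT//.
    have -> : [set x : 'rV[R]_n | forall i, `[0, 1]%classic (x ord0 i)] =
        \bigcap_(i : 'I_n) (fun x : 'rV[R]_n => x ord0 i) @^-1` `[0, 1]%classic.
      by apply/seteqP; split => x /= h i; [move=> _|]; exact: h.
    apply: fin_bigcap_measurable => // i _.
    by rewrite -[X in measurable X]setTI; exact: measurable_coord.
  by rewrite A0 B1 lee_fin ler10.
exists (fun x => (\int[mu]_x eta x)^-1 * eta x); first exact: test_functionZ.
by rewrite RintegralZl ?mulVf//; exact: Ckc_intble (test_Ckc 0 teta).
Qed.

(** The two forms of a mollification: derivatives are read off the convolution,
    and bounds in L^p off the average of translates. *)
Lemma convol_tavg eta (t : R) g : 0 < t -> test_function eta ->
  loc_integrable g ->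
  convol g (fun y => t ^- n * eta (t^-1 *: y)) =
  tavg mu eta (fun z => t *: z) g.
Proof.
move=> t0 teta lg; apply/funext => x; rewrite /convol /tavg.
have tt : test_function (fun y => eta (t^-1 *: y)).
  under eq_fun do rewrite -[_ *: _]addr0.
  by apply: test_function_affine => //; rewrite invr_eq0 gt_eqF.
have tx := test_reflect x tt.
have mF : measurable_fun setT (fun y => g y * eta (t^-1 *: (x - y))).
  by apply: measurable_funM; [case: lg|exact: (Ck_measurable (tx.1 0%N))].
have nt0 : - t != 0 by rewrite oppr_eq0 gt_eqF.
under eq_Rintegral do rewrite mulrCA.
rewrite RintegralZl//; last exact: loc_intbleM_test.
have := Rintegral_affine_rV x nt0 mF.
rewrite normrN gtr0_norm// => <-; apply: eq_Rintegral => z _.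
rewrite mulrC scaleNr (addrC _ x) subKr scalerA mulVf ?scale1r// gt_eqF//.
Qed.

(** For each of the functions the scales that are good enough form a right
    neighbourhood of 0, and finitely many of these meet. *)
Lemma convol_approx (I : finType) (g : I -> 'rV[R]_n -> R) (e : R) :
  (forall i, g i \in Lfun mu p%:E) -> 0 < e ->
  exists2 psi, test_function psi & forall i,
    convol (g i) psi \in Lfun mu p%:E /\ (N (convol (g i) psi \- g i) <= e%:E)%E.
Proof.
move=> gL e0; have [eta teta eta1] := mollifier_exists.
have eta_int : mu.-integrable setT (EFin \o eta) by exact: Ckc_intble (test_Ckc 0 teta).
have mid : measurable_fun setT (fun z : 'rV[R]_n => z) by exact: measurable_id.
have eta_norm_int : mu.-integrable setT (EFin \o (fun z : 'rV[R]_n => eta z * (1 + `|z|))).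
  have [r r0 etar] := compact_support_bound teta.2.
  apply: (@le_intble _ _ _ _ _ (fun z => (1 + r) * `|eta z|)).
  - apply: measurable_funM; first exact: intble_measurable eta_int.
    by apply: measurable_funD => //; exact: measurable_norm_rV.
  - move=> z; rewrite normrM mulrC.
    have [zr|zr] := leP `|z| r; last by rewrite etar// normr0 !mulr0.
    by rewrite ler_wpM2r// ger0_norm ?addr_ge0// lerD2l.
  - by apply: intbleZ; exact: intble_norm.
have near_i i : \forall t \near 0^'+,
    (N (tavg mu eta (fun z => t *: z) (g i) \- g i) <= e%:E)%E.
  have [r r0 Hr] := tavg_approx p1 eta_int mid eta_norm_int (gL i) e0.
  near=> t; have := Hr t; rewrite eta1.
  by under [X in _ \- X]eq_fun do rewrite mul1r; apply; near: t;
    [exact: nbhs_right_gt|exact: nbhs_right_lt].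
have near_all : \forall t \near 0^'+, forall i,
    (N (tavg mu eta (fun z => t *: z) (g i) \- g i) <= e%:E)%E.
  exact: filter_forall.
near (0 : R)^'+ => t.
have t0 : 0 < t by [].
have mt : measurable_fun setT (fun z : 'rV[R]_n => t *: z).
  apply: measurable_fun_rVP => i.
  under eq_fun do rewrite mxE.
  by apply: measurable_funM => //; exact: measurable_coord.
exists (fun y => t ^- n * eta (t^-1 *: y)).
  apply: test_functionZ.
  under eq_fun do rewrite -[_ *: _]addr0.
  by apply: test_function_affine => //; rewrite invr_eq0 gt_eqF.
move=> i; rewrite convol_tavg//; last exact: (Lfun_loc_integrable p1 (gL i)).
split; first exact: tavg_Lfun.
by move: i; near: t.
Unshelve. all: by end_near. Qed.

Local Notation e_ i := (delta_mx ord0 i : 'rV[R]_n).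

(** The bound for C^1 functions passes to the limit, as mollification does not
    increase the norms of the partial derivatives by more than a given amount. *)
Lemma Lnorm_translate_weak g (v : 'I_n -> 'rV[R]_n -> R) (y : 'rV[R]_n) (C : R) :
  g \in Lfun mu p%:E -> (forall k, v k \in Lfun mu p%:E) ->
  (forall k, is_weak_deriv (fun i => (i == k) : nat) g (v k)) ->
  0 <= C -> (forall k, (N (v k) <= C%:E)%E) ->
  (N (fun x => (g (x - y) - g x)%R) <= ((\sum_(k < n) `|y ord0 k|) * C)%:E)%E.
Proof.
move=> gL vL gv C0 vC; set s := \sum_(k < n) _.
have s0 : 0 <= s by exact: sumr_ge0.
have mg := Lfun_measurable gL.
apply/lee_addgt0Pr => e e0.
pose d := e / (s + 2).
have d0 : 0 < d by rewrite divr_gt0// ltr_wpDl.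
pose G (i : option 'I_n) := if i is Some k then v k else g.
have GL i : G i \in Lfun mu p%:E by case: i.
have [psi tpsi psiG] := convol_approx GL d0.
have [UL Ug] := psiG None; rewrite /= in UL Ug.
set U := convol g psi in UL Ug.
have lg := Lfun_loc_integrable p1 gL.
have CU k : Ck k U by exact: Ck_convol.
have dU k : partial k U = convol (v k) psi by exact: partial_convol_weak.
have dUL k : partial k U \in Lfun mu p%:E by rewrite dU; have [] := psiG (Some k).
have mU := Lfun_measurable UL.
have dUC k : (N (partial k U) <= (C + d)%:E)%E.
  rewrite dU; have [wL wd] := psiG (Some k); rewrite /= in wL wd.
  have -> : convol (v k) psi = (fun x => (convol (v k) psi \- v k) x + v k x).
    by apply/funext => x /=; rewrite subrK.
  apply: (le_trans (LnormD mu p1 _ _)).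
  - by apply: measurable_funB; [exact: Lfun_measurable wL|exact: Lfun_measurable (vL k)].
  - exact: Lfun_measurable (vL k).
  by rewrite addeC EFinD leeD.
have Cd0 : 0 <= C + d by rewrite addr_ge0// ltW.
have UT := Lnorm_translate_C1 p1 y (CU 1%N) Cd0 dUL dUC.
have mgy := measurable_shift (- y) mg.
have mUy := measurable_shift (- y) mU.
have -> : (fun x => g (x - y) - g x) =
   (fun x => - (fun z => (U \- g) (z - y)) x + ((fun x => U (x - y) - U x) x + (U \- g) x)).
  by apply/funext => x /=; ring.
apply: (le_trans (LnormD mu p1 _ _)).
- by apply: measurable_funN; exact: measurable_funB.
- by apply: measurable_funD; exact: measurable_funB.
rewrite LnormN (Lnorm_shift p (- y) (measurable_funB mU mg)).
apply: (le_trans (leeD Ug (LnormD mu p1 (measurable_funB mUy mU) (measurable_funB mU mg)))).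
apply: (le_trans (leeD (lexx _) (leeD UT Ug))).
rewrite -!EFinD lee_fin.
have : d * (s + 2) = e by rewrite /d divfK// gt_eqF// ltr_wpDl.
by move=> <-; rewrite le_eqVlt; apply/orP; left; apply/eqP; rewrite -/s; ring.
Qed.

End mollification.

(** * Density of test functions in W^{2,p} *)

Section sobolev.
Context {R : realType} {n : nat} (p : R) (p1 : 1 <= p).
Implicit Types (u v f g phi : 'rV[R]_n -> R) (a : 'I_n -> nat).

Local Notation mu := (lebesgue_rV R n).
Local Notation N f := ('N[mu]_p%:E[EFin \o f%R])%E.
Local Notation mi1 i := (fun k : 'I_n => (k == i) : nat).
Local Notation mi2 i j := (fun k : 'I_n => ((k == i) + (k == j))%N).

Lemma mi_order1 (i : 'I_n) : mi_order (mi1 i) = 1%N.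
Proof. by rewrite (@mi_order_count _ _ [:: i])// => k /=; rewrite addn0 eq_sym. Qed.

Lemma mi_order2 (i j : 'I_n) : mi_order (mi2 i j) = 2%N.
Proof.
rewrite (@mi_order_count _ _ [:: i; j])// => k /=.
by rewrite addn0 eq_sym (eq_sym j).
Qed.

Lemma multi_partial0 f : multi_partial (fun=> 0%N) f = f.
Proof.
have /size0nil s0 : size (mi_list ((fun=> 0%N) : 'I_n -> nat)) = 0%N.
  by rewrite size_mi_list /mi_order big1.
by rewrite multi_partialE s0.
Qed.

Lemma multi_partial1 (i : 'I_n) f : Ck 1 f -> multi_partial (mi1 i) f = partial i f.
Proof.
move=> Cf; apply: (@multi_partial_perm _ _ _ [:: i]) => // k /=.
by rewrite addn0 eq_sym.
Qed.

Lemma multi_partial2 (i j : 'I_n) f : Ck 2 f ->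
  multi_partial (mi2 i j) f = partial i (partial j f).
Proof.
move=> Cf; apply: (@multi_partial_perm _ _ _ [:: i; j]) => // k /=.
by rewrite addn0 eq_sym (eq_sym j).
Qed.

Lemma mi_order_le2 a : (mi_order a <= 2)%N ->
  [\/ a = (fun=> 0%N), exists i, a = mi1 i | exists i j, a = mi2 i j].
Proof.
rewrite -size_mi_list; have := count_mi_list a.
case: (mi_list a) => [|i [|j [|//]]] /= ca _.
- by apply: Or31; apply/funext => k; rewrite -ca.
- by apply: Or32; exists i; apply/funext => k; rewrite -ca addn0 eq_sym.
- by apply: Or33; exists i, j; apply/funext => k; rewrite -ca addn0 eq_sym (eq_sym j).
Qed.

Lemma is_weak_deriv0 u : loc_integrable u -> is_weak_deriv (fun=> 0%N) u u.
Proof.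
move=> lu; split => // phi tphi.
by rewrite multi_partial0 /mi_order big1// expr0 mul1r.
Qed.

Lemma Wkp_weak_deriv k u a : Wkp k p u -> (mi_order a <= k)%N ->
  is_weak_deriv a u (weak_deriv a u).
Proof. by move=> [_ Wu] /Wu[v _]; exact: weak_derivP. Qed.

Lemma Wkp_Lfun k u a : Wkp k p u -> (mi_order a <= k)%N ->
  weak_deriv a u \in Lfun mu p%:E.
Proof.
move=> Wu ak; have [_ [mw _] _] := Wkp_weak_deriv Wu ak.
by have [v vL uv] := Wu.2 a ak; exact: (Lfun_ae mw (weak_deriv_ae uv) vL).
Qed.

Lemma Wkp_leq k l u : (k <= l)%N -> Wkp l p u -> Wkp k p u.
Proof. by move=> kl [uL Wu]; split => // a ak; apply: Wu; exact: leq_trans kl. Qed.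

Lemma Lnorm_le_Wkp_norm k u a : (mi_order a <= k)%N ->
  (N (weak_deriv a u) <= Wkp_norm k p u)%E.
Proof.
move=> ak.
have p0 : 0 < p by exact: lt_le_trans p1.
have ai i : (a i < k.+1)%N.
  by rewrite ltnS (leq_trans _ ak)// /mi_order (bigD1 i)//= leq_addr.
pose b : {ffun 'I_n -> 'I_k.+1} := [ffun i => Ordinal (ai i)].
have ba : (fun i => b i : nat) = a by apply/funext => i; rewrite ffunE.
rewrite /Wkp_norm (bigD1 b) ?ba//=.
have {1}-> : N (weak_deriv a u) = ((N (weak_deriv a u) `^ p) `^ p^-1)%E.
  by rewrite -poweRrM mulfV ?gt_eqF// poweRe1// Lnorm_ge0.
apply: le_poweR; [by rewrite invr_ge0 ltW|exact: poweR_ge0|].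
by rewrite leeDl// sume_ge0// => i _; exact: poweR_ge0.
Qed.

Lemma Wkp_norm_le k : exists2 K : R, 0 <= K & forall u (B : R), 0 <= B ->
  (forall a, (mi_order a <= k)%N -> (N (weak_deriv a u) <= B%:E)%E) ->
  (Wkp_norm k p u <= (K * B)%:E)%E.
Proof.
have p0 : 0 < p by exact: lt_le_trans p1.
pose P (b : {ffun 'I_n -> 'I_k.+1}) := (mi_order (fun i => b i : nat) <= k)%N.
exists ((\sum_(b | P b) 1) `^ p^-1) => [|u B B0 NB]; first exact: powR_ge0.
have -> : (\sum_(b | P b) (1 : R)) `^ p^-1 * B = (\sum_(b | P b) B `^ p) `^ p^-1.
  have -> : \sum_(b | P b) B `^ p = (\sum_(b | P b) 1) * B `^ p.
    by rewrite mulr_suml; under [RHS]eq_bigr do rewrite mul1r.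
  rewrite powRM ?powR_ge0//; last exact: sumr_ge0.
  by rewrite -powRrM mulfV ?gt_eqF// powRr1.
rewrite -poweR_EFin; apply: le_poweR; first by rewrite invr_ge0 ltW.
  by rewrite sume_ge0// => i _; exact: poweR_ge0.
rewrite -sumEFin; apply: lee_sum => b bk; rewrite -poweR_EFin.
by apply: le_poweR; [exact: ltW|exact: Lnorm_ge0|exact: NB].
Qed.

Lemma Wkp_lin k (c : R) u v : Wkp k p u -> Wkp k p v -> Wkp k p (c *: u + v).
Proof.
move=> Wu Wv; split; first exact: (LfunD p1 (LfunZ p1 c Wu.1) Wv.1).
move=> a ak; have [u' u'L uu'] := Wu.2 a ak; have [v' v'L vv'] := Wv.2 a ak.
exists (fun x => c * u' x + v' x); first exact: (LfunD p1 (LfunZ p1 c u'L) v'L).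
exact: is_weak_deriv_lin.
Qed.

Lemma weak_deriv_lin k (c : R) u v a : Wkp k p u -> Wkp k p v ->
  (mi_order a <= k)%N ->
  weak_deriv a (c *: u + v) =
    (fun x => c * weak_deriv a u x + weak_deriv a v x) %[ae mu].
Proof.
move=> Wu Wv ak; apply: weak_deriv_ae; apply: is_weak_deriv_lin.
  exact: Wkp_weak_deriv Wu ak.
exact: Wkp_weak_deriv Wv ak.
Qed.

Lemma Ckc_Wkp k u : Ckc k u -> Wkp k p u.
Proof.
move=> Cu; split; first exact: Ckc_Lfun Cu.
move=> a ak; exists (multi_partial a u); last first.
  by apply: Ck_weak_deriv; exact: Ck_leq ak Cu.1.
rewrite multi_partialE; apply: (@Ckc_Lfun _ _ _ p1 0); apply: Ckc_iter_partial.
by rewrite addn0 size_mi_list; split; [exact: Ck_leq ak Cu.1|exact: Cu.2].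
Qed.

End sobolev.

Section density.
Context {R : realType} {n : nat} (p : R) (p1 : 1 <= p).
Implicit Types (u v f g phi U : 'rV[R]_n -> R) (a : 'I_n -> nat).

Local Notation mu := (lebesgue_rV R n).
Local Notation N f := ('N[mu]_p%:E[EFin \o f%R])%E.
Local Notation mi1 i := (fun k : 'I_n => (k == i) : nat).
Local Notation mi2 i j := (fun k : 'I_n => ((k == i) + (k == j))%N).
Local Notation chi m := (@cutoff R n m.+1%:R).

Let chiE (m : nat) : chi m = (fun y => cutoff 1 (m.+1%:R^-1 *: y + 0)).
Proof.
by apply/funext => y; rewrite /cutoff invr1 scale1r addr0.
Qed.

Let partial_chi (i : 'I_n) m :
  partial i (chi m) = (fun y => m.+1%:R^-1 * partial i (cutoff 1) (m.+1%:R^-1 *: y + 0)).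
Proof.
rewrite chiE partial_affine// => x.
exact: (@Ck_derivable _ _ _ i _ x (Ck_cutoff 1 1)).
Qed.

Let partial2_chi (i j : 'I_n) m :
  partial i (partial j (chi m)) = (fun y => m.+1%:R^-1 *
    (m.+1%:R^-1 * partial i (partial j (cutoff 1)) (m.+1%:R^-1 *: y + 0))).
Proof.
have d1 k x : derivable (partial j (@cutoff R n 1)) x (delta_mx ord0 k).
  exact: (@Ck_derivable _ _ _ k _ x (Ck_partial j (Ck_cutoff 2 1))).
have Cc : Ck 1 (fun y => partial j (@cutoff R n 1) (m.+1%:R^-1 *: y + 0)).
  by apply: Ck_affine; exact: (Ck_partial j (Ck_cutoff 2 1)).
rewrite partial_chi; apply/funext => x.
have := @partialM _ _ i (cst m.+1%:R^-1) _ x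
  (@Ck_derivable _ _ _ i _ x (Ck_cst 1 _)) (@Ck_derivable _ _ _ i _ x Cc).
rewrite (_ : partial i (cst _) x = 0); last exact: derive_cst.
rewrite mulr0 addr0 => ->.
have E := congr1 (@^~ x) (partial_affine m.+1%:R^-1 0 (d1 i)).
congr (_ * _).
exact: E.
Qed.

Let chi_cvg x : chi m x @[m --> \oo] --> (1 : R).
Proof.
apply: cvg_near_cst; near=> m; apply: cutoff_eq1 => //.
have H : n%:R * `|x| ^+ 2 <= m.+1%:R.
  rewrite (@le_trans _ _ m%:R) ?ler_nat//.
  by near: m; exact: nbhs_infty_ger.
rewrite (le_trans H)// expr2 ler_peMl// ler1n.
Unshelve. all: by end_near. Qed.

Let chi_bound : exists C : R, [/\ 1 <= C, forall m x, `|chi m x| <= C,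
  forall i m x, `|partial i (chi m) x| <= C / m.+1%:R &
  forall i j m x, `|partial i (partial j (chi m)) x| <= C / m.+1%:R].
Proof.
have tc : test_function (cutoff 1 : 'rV[R]_n -> R) by exact: test_cutoff.
have /choice[M HM] : forall i, exists M, forall x, `|partial i (@cutoff R n 1) x| <= M.
  by move=> i; exact: Ckc_bounded (test_Ckc 0 (test_partial i tc)).
have /choice[L HL] : forall ij : 'I_n * 'I_n, exists M,
    forall x, `|partial ij.1 (partial ij.2 (@cutoff R n 1)) x| <= M.
  by move=> ij; exact: Ckc_bounded (test_Ckc 0 (test_partial _ (test_partial _ tc))).
have M0 i : 0 <= M i by rewrite (le_trans _ (HM i 0)).
have L0 i : 0 <= L i by rewrite (le_trans _ (HL i 0)).
have SM0 : 0 <= \sum_i M i by exact: sumr_ge0.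
have SL0 : 0 <= \sum_i L i by exact: sumr_ge0.
have CM i : M i <= 1 + \sum_i M i + \sum_i L i.
  have : M i <= \sum_i M i by rewrite (bigD1 i)//= lerDl sumr_ge0.
  by lra.
have CL i : L i <= 1 + \sum_i M i + \sum_i L i.
  have : L i <= \sum_i L i by rewrite (bigD1 i)//= lerDl sumr_ge0.
  by lra.
exists (1 + \sum_i M i + \sum_i L i); split.
- by lra.
- move=> m x; have /andP[c0 c1] := cutoff_itv m.+1%:R x.
  by rewrite ger0_norm// (le_trans c1)//; lra.
- move=> i m x; rewrite partial_chi normrM gtr0_norm// mulrC ler_wpM2r//.
  exact: le_trans (HM _ _) (CM _).
- move=> i j m x; rewrite partial2_chi normrM gtr0_norm// mulrC ler_wpM2r//.
  rewrite normrM gtr0_norm// -[leRHS]mul1r ler_pM//.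
    by rewrite invf_le1// ler1n.
  exact: le_trans (HL (i, j) _) (CL _).
Qed.


Let Lp_cvg (F : nat -> 'rV[R]_n -> R) f := [/\ forall m, measurable_fun setT (F m),
  measurable_fun setT f &
  forall e : R, 0 < e -> \forall m \near \oo, (N (F m \- f) <= e%:E)%E].

Let Lp_cvgD F G f g : Lp_cvg F f -> Lp_cvg G g ->
  Lp_cvg (fun m x => F m x + G m x) (fun x => f x + g x).
Proof.
move=> [mF mf Ff] [mG mg Gg]; split; first by move=> m; exact: measurable_funD.
  exact: measurable_funD.
move=> e e0; have e20 : 0 < e / 2 by exact: divr_gt0.
apply: filterS2 (Ff _ e20) (Gg _ e20) => m Fm Gm.
have -> : (fun x => F m x + G m x) \- (fun x => f x + g x) =
    (fun x => (F m \- f) x + (G m \- g) x).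
  by apply/funext => x /=; ring.
apply: (le_trans (LnormD mu p1 (measurable_funB (mF m) mf) (measurable_funB (mG m) mg))).
by rewrite (le_trans (leeD Fm Gm))// -EFinD -splitr.
Qed.

Let Lp_cvgM (theta : nat -> 'rV[R]_n -> R) (l C : R) f :
  (forall m, measurable_fun setT (theta m)) ->
  (forall m x, `|theta m x| <= C) -> (forall x, theta m x @[m --> \oo] --> l) ->
  f \in Lfun mu p%:E ->
  Lp_cvg (fun m x => theta m x * f x) (fun x => l * f x).
Proof.
move=> mt tC tl fL; have mf := Lfun_measurable fL.
have mtf m : measurable_fun setT (fun x => theta m x * f x) by exact: measurable_funM.
have mlf : measurable_fun setT (fun x => l * f x) by exact: measurable_funM.
split => // e e0.
have : (N ((fun x => theta m x * f x) \- (fun x => l * f x)) @[m --> \oo] --> 0)%E.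
  apply: (Lnorm_dominated p1 (g := fun x => (C + `|l|) * f x)) => //.
  - by move=> x; apply: cvgM; [exact: tl|exact: cvg_cst].
  - exact: LfunZ.
  - move=> m x /=; rewrite -mulrBl !normrM ler_wpM2r//.
    rewrite (le_trans (ler_normB _ _))// (le_trans _ (ler_norm _))//.
    by rewrite lerD2r.
move/fine_cvgP => [fin /cvgr0Pnorm_le /(_ _ e0)].
apply: filterS2 fin => m fin.
rewrite ger0_norm ?fine_ge0 ?Lnorm_ge0// => h.
by rewrite -(fineK fin) lee_fin.
Qed.

(** Multiplication by a wide cutoff perturbs a smooth function and its first and
    second derivatives little in L^p: the terms of the product rule in which the
    cutoff is differentiated carry a factor 1 / m. *)
Lemma cutoff_approx U (e : R) : (forall k, Ck k U) -> U \in Lfun mu p%:E ->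
  (forall i, partial i U \in Lfun mu p%:E) ->
  (forall i j, partial i (partial j U) \in Lfun mu p%:E) -> 0 < e ->
  exists phi, [/\ test_function phi, (N (phi \- U) <= e%:E)%E,
    forall i, (N (partial i phi \- partial i U) <= e%:E)%E &
    forall i j, (N (partial i (partial j phi) \- partial i (partial j U)) <= e%:E)%E].
Proof.
move=> CU UL dUL ddUL e0; have [C [C1 C0b C1b C2b]] := chi_bound.
have Cm m : C / m.+1%:R <= C.
  by rewrite ler_piMr ?(le_trans _ C1)// invf_le1// ler1n.
have Cgt0 : 0 <= C by exact: le_trans C1.
pose phi m := chi m \* U.
have tphi m : test_function (phi m).
  have := test_functionM CU (@test_cutoff R n m.+1%:R (ltr0Sn _ _)).
  by under eq_fun do rewrite mulrC.
have Cchi m k : Ck k (chi m) by exact: Ck_cutoff.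
have dphi i m x : partial i (phi m) x = chi m x * partial i U x + U x * partial i (chi m) x.
  apply: partialM; first exact: (@Ck_derivable _ _ _ i _ x (Cchi m 1%N)).
  exact: (@Ck_derivable _ _ _ i _ x (CU 1%N)).
have ddphi i j m x : partial i (partial j (phi m)) x =
    (chi m x * partial i (partial j U) x + partial j U x * partial i (chi m) x) +
    (U x * partial i (partial j (chi m)) x + partial j (chi m) x * partial i U x).
  have -> : partial j (phi m) = (chi m \* partial j U) \+ (U \* partial j (chi m)).
    by apply/funext => y; rewrite dphi.
  have CdU : Ck 1 (partial j U) by exact: (Ck_partial j (CU 2)).
  have Cdchi : Ck 1 (partial j (chi m)) by exact: (Ck_partial j (Cchi m 2)).
  rewrite {1}/partial deriveD.
  - congr (_ + _); apply: partialM.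
    + exact: (@Ck_derivable _ _ _ i _ x (Cchi m 1%N)).
    + exact: (@Ck_derivable _ _ _ i _ x CdU).
    + exact: (@Ck_derivable _ _ _ i _ x (CU 1%N)).
    + exact: (@Ck_derivable _ _ _ i _ x Cdchi).
  - exact: (@Ck_derivable _ _ _ i _ x (CkM (Cchi m 1%N) CdU)).
  - exact: (@Ck_derivable _ _ _ i _ x (CkM (CU 1%N) Cdchi)).
have inv_cvg (F : nat -> R) : (forall m, `|F m| <= C / m.+1%:R) -> F m @[m --> \oo] --> (0 : R).
  move=> FC; apply/norm_cvg0P.
  have cC : C / m.+1%:R @[m --> \oo] --> (0 : R).
    rewrite -[X in _ --> X](mulr0 C); apply: cvgM; [exact: cvg_cst|exact: cvg_harmonic].
  apply: (squeeze_cvgr _ (cvg_cst 0) cC).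
  by near=> m; rewrite normr_ge0/=.
have d1_cvg i x : partial i (chi m) x @[m --> \oo] --> (0 : R) by exact: inv_cvg.
have d2_cvg i j x : partial i (partial j (chi m)) x @[m --> \oo] --> (0 : R).
  exact: inv_cvg.
have phiE m x : phi m x = chi m x * U x by [].
clearbody phi.
have chiM f : f \in Lfun mu p%:E ->
    Lp_cvg (fun m x => chi m x * f x) (fun x => 1 * f x).
  move=> fL; apply: (Lp_cvgM _ C0b chi_cvg fL) => m.
  exact: (Ck_measurable (Cchi m 0%N)).
have d1M i f : f \in Lfun mu p%:E ->
    Lp_cvg (fun m x => partial i (chi m) x * f x) (fun x => 0 * f x).
  move=> fL; apply: (Lp_cvgM _ _ (d1_cvg i) fL) => m.
    exact: (Ck_measurable (Ck_partial i (Cchi m 1%N))).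
  by move=> x; exact: le_trans (C1b i m x) (Cm m).
have d2M i j f : f \in Lfun mu p%:E ->
    Lp_cvg (fun m x => partial i (partial j (chi m)) x * f x) (fun x => 0 * f x).
  move=> fL; apply: (Lp_cvgM _ _ (d2_cvg i j) fL) => m.
    exact: (Ck_measurable (Ck_partial i (Ck_partial j (Cchi m 2)))).
  by move=> x; exact: le_trans (C2b i j m x) (Cm m).
have L0 : \forall m \near \oo, (N (phi m \- U) <= e%:E)%E.
  have [_ _ /(_ _ e0)] := chiM _ UL.
  apply: filterS => m; congr (N _ <= _)%E; apply/funext => x /=.
  by rewrite mul1r phiE.
have alg1 (a b c d : R) : a * b + c * d - (1 * b + 0 * d) = a * b + d * c - b.
  by ring.
have alg2 (a b c d r s t q : R) :
    a * b + c * d + (r * s + t * q) - (1 * b + 0 * d + (0 * s + 0 * q)) =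
    a * b + d * c + (s * r + t * q) - b by ring.
have L1 i : \forall m \near \oo, (N (partial i (phi m) \- partial i U) <= e%:E)%E.
  have [_ _ /(_ _ e0)] := Lp_cvgD (chiM _ (dUL i)) (d1M i _ UL).
  apply: filterS => m; congr (N _ <= _)%E; apply/funext => x /=.
  by rewrite (dphi i m x); exact: alg1.
have L2 i j : \forall m \near \oo,
    (N (partial i (partial j (phi m)) \- partial i (partial j U)) <= e%:E)%E.
  have [_ _ /(_ _ e0)] := Lp_cvgD
    (Lp_cvgD (chiM _ (ddUL i j)) (d1M i _ (dUL j)))
    (Lp_cvgD (d2M i j _ UL) (d1M j _ (dUL i))).
  apply: filterS => m; congr (N _ <= _)%E; apply/funext => x /=.
  by rewrite (ddphi i j m x); exact: alg2.
have L1' : \forall m \near \oo, forall i, (N (partial i (phi m) \- partial i U) <= e%:E)%E.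
  exact: filter_forall.
have L2' : \forall m \near \oo, forall ij : 'I_n * 'I_n,
    (N (partial ij.1 (partial ij.2 (phi m)) \- partial ij.1 (partial ij.2 U)) <= e%:E)%E.
  by apply: filter_forall => -[i j]; exact: L2.
near \oo => m; exists (phi m); split => //.
- by near: m.
- by near: m.
- move=> i j; suff : forall ij : 'I_n * 'I_n,
    (N (partial ij.1 (partial ij.2 (phi m)) \- partial ij.1 (partial ij.2 U)) <= e%:E)%E.
    by move=> /(_ (i, j)).
  by near: m.
Unshelve. all: by end_near. Qed.

(** Mollify, then cut off. The mollifications of the weak derivatives are the
    derivatives of the mollification. *)
Lemma Wkp2_dense u (e : R) : Wkp 2 p u -> 0 < e ->
  exists2 phi, test_function phi & (Wkp_norm 2 p ((-1) *: phi + u)%R <= e%:E)%E.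
Proof.
move=> Wu e0; have [K K0 KW] := @Wkp_norm_le R n p p1 2.
pose d := e / (2 * (K + 1)).
have d0 : 0 < d by rewrite divr_gt0// mulr_gt0// ltr_wpDl.
pose I := option ('I_n + 'I_n * 'I_n)%type.
pose g (i : I) := match i with
  | None => u
  | Some (inl i) => weak_deriv (mi1 i) u
  | Some (inr (i, j)) => weak_deriv (mi2 i j) u
  end.
have uL := Wu.1; have lu := Lfun_loc_integrable p1 uL.
have o1 i : (mi_order (mi1 i) <= 2)%N by rewrite mi_order1.
have o2 i j : (mi_order (mi2 i j) <= 2)%N by rewrite mi_order2.
have gL i : g i \in Lfun mu p%:E.
  case: i => [[i|[i j]]|] //=; first exact: Wkp_Lfun Wu (o1 i).
  exact: Wkp_Lfun Wu (o2 i j).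
have [psi tpsi psig] := convol_approx p1 gL d0.
pose U := convol u psi.
have dU i : partial i U = convol (g (Some (inl i))) psi.
  by apply: partial_convol_weak => //; exact: Wkp_weak_deriv Wu (o1 i).
have ddU i j : partial j (partial i U) = convol (g (Some (inr (i, j)))) psi.
  rewrite dU; apply: partial_convol_weak => //.
  exact: is_weak_deriv_partial (Wkp_weak_deriv Wu (o1 i)) (Wkp_weak_deriv Wu (o2 i j)).
have CU k : Ck k U by exact: Ck_convol.
have [phi [tphi N0 N1 N2]] : exists phi, [/\ test_function phi,
    (N (phi \- U) <= d%:E)%E,
    forall i, (N (partial i phi \- partial i U) <= d%:E)%E &
    forall i j, (N (partial i (partial j phi) \- partial i (partial j U)) <= d%:E)%E].
  apply: cutoff_approx => //.
  - by have [] := psig None.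
  - by move=> i; rewrite dU; have [] := psig (Some (inl i)).
  - by move=> i j; rewrite ddU; have [] := psig (Some (inr (j, i))).
have Cphi k : Ckc k phi by exact: test_Ckc.
exists phi => //; have Wphi := Ckc_Wkp p1 (Cphi 2).
apply: (@le_trans _ _ (K * (d + d))%:E); last first.
  have E : (K + 1) * (d + d) = e.
    by rewrite /d; field; rewrite gt_eqF// ltr_wpDl.
  by rewrite lee_fin -E ler_wpM2r ?lerDl// addr_ge0// ltW.
apply: KW => [|a a2]; first by rewrite addr_ge0// ltW.
have main (i : I) (D : 'rV[R]_n -> R) : measurable_fun setT D ->
    is_weak_deriv a phi D -> is_weak_deriv a u (g i) ->
    (N (D \- convol (g i) psi) <= d%:E)%E ->
    (N (weak_deriv a ((-1) *: phi + u)%R) <= (d + d)%:E)%E.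
  move=> mD phiD ug ND; have [cL Nc] := psig i.
  have mc := Lfun_measurable cL; have mg := Lfun_measurable (gL i).
  have W := is_weak_deriv_lin (-1) phiD ug.
  have [_ [mw _] _] := weak_derivP W.
  rewrite (eq_Lnorm_ae _ mw _ (weak_deriv_ae W)); last first.
    by apply: measurable_funD => //; exact: measurable_funM.
  have -> : (fun x => -1 * D x + g i x) = g i \- D by apply/funext => x /=; ring.
  rewrite Lnorm_distC (le_trans (Lnorm_triangle mu p1 mD mc mg))//.
  by rewrite EFinD leeD.
have [a0|[i a1]|[i [j a2']]] := mi_order_le2 a2; subst a.
- apply: (main None phi) => //.
  + exact: (Ck_measurable (tphi.1 0%N)).
  + by apply: is_weak_deriv0; apply: continuous_loc_integrable; exact: (Ck_continuous (tphi.1 0%N)).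
  + exact: is_weak_deriv0.
- apply: (main (Some (inl i)) (partial i phi)) => //.
  + exact: (Ck_measurable (Ck_partial i (tphi.1 1%N))).
  + rewrite -(multi_partial1 i (tphi.1 1%N)); apply: Ck_weak_deriv.
    by rewrite mi_order1; exact: (tphi.1 1%N).
  + exact: Wkp_weak_deriv Wu (o1 i).
  + by rewrite -dU.
- apply: (main (Some (inr (i, j))) (partial j (partial i phi))) => //.
  + exact: (Ck_measurable (Ck_partial j (Ck_partial i (tphi.1 2)))).
  + rewrite partialC; last exact: tphi.1.
    rewrite -(multi_partial2 i j (tphi.1 2)); apply: Ck_weak_deriv.
    by rewrite mi_order2; exact: (tphi.1 2).
  + exact: Wkp_weak_deriv Wu (o2 i j).
  + by rewrite -ddU.
Qed.

End density.

(** * The kernel of the Taylor remainder *)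

Section product_integrals.
Context d1 d2 (X : measurableType d1) (Y : measurableType d2) {R : realType}.
Context (m1 : {sigma_finite_measure set X -> \bar R}).
Context (m2 : {sigma_finite_measure set Y -> \bar R}).

(** The product measure under a name of its own, which carries the structure of
    sigma-finite measure. *)
Definition sfprod : set (X * Y) -> \bar R := (m1 \x m2)%E.

HB.instance Definition _ := Measure.copy sfprod (m1 \x m2)%E.

Let sfprod_sigma_finite : sigma_finite setT sfprod.
Proof.
have /sigma_finiteP[A [TA ndA Aoo]] := sigma_finiteT m1.
have /sigma_finiteP[B [TB ndB Boo]] := sigma_finiteT m2.
exists (fun k => A k `*` B k) => [|k].
  apply/esym; apply/seteqP; split => // -[x y] _.
  have : setT x by []; have : setT y by [].
  rewrite {1}TB {1}TA => -[k _ Bky] [l _ Alx]; exists (maxn k l) => //; split => /=.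
    by have /subsetPset := ndA _ _ (leq_maxr k l); exact.
  by have /subsetPset := ndB _ _ (leq_maxl k l); exact.
have [mA Ak] := Aoo k; have [mB Bk] := Boo k; split; first exact: measurableX.
by rewrite /sfprod product_measure1E// lte_mul_pinfty// ge0_fin_numE.
Qed.

HB.instance Definition _ := Measure_isSigmaFinite.Build _ _ _ sfprod
  sfprod_sigma_finite.

Lemma intble_tensor (f : X -> R) (g : Y -> R) :
  m1.-integrable setT (EFin \o f) -> m2.-integrable setT (EFin \o g) ->
  sfprod.-integrable setT (EFin \o (fun s => f s.1 * g s.2)).
Proof.
move=> fi gi; have mf := intble_measurable fi; have mg := intble_measurable gi.
have mfg : measurable_fun setT (fun s : X * Y => f s.1 * g s.2).
  apply: measurable_funM.
    exact: (measurableT_comp mf measurable_fst).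
  exact: (measurableT_comp mg measurable_snd).
apply/integrable12ltyP; first exact/measurable_EFinP.
have -> : (\int[m1]_x \int[m2]_y `|(EFin \o (fun s : X * Y => f s.1 * g s.2)%R) (x, y)| =
    \int[m1]_x (`|f x| * \int[m2]_y `|g y|)%R%:E)%E.
  apply: eq_integral => x _; rewrite EFinM EFin_Rintegral; last exact: intble_norm.
  rewrite -ge0_integralZl//.
  - by apply: eq_integral => y _; rewrite /= normrM EFinM.
  - by apply/measurable_EFinP; exact: measurableT_comp.
apply: intble_lty => [x|].
  by rewrite mulr_ge0//; exact: Rintegral_ge0.
under [X in _ \o X]eq_fun do rewrite mulrC.
by apply: intbleZ; exact: intble_norm.
Qed.

Lemma Rintegral_prod2 (f : X * Y -> R) :
  sfprod.-integrable setT (EFin \o f) ->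
  (forall y, m1.-integrable setT (EFin \o (fun x => f (x, y)))) ->
  \int[sfprod]_s f s = \int[m2]_y \int[m1]_x f (x, y).
Proof.
move=> fi fiy; rewrite /Rintegral -(integral21_prod_meas1 fi); congr fine.
by apply: eq_integral => y _; exact: esym (EFin_Rintegral (fiy y)).
Qed.

Lemma Rintegral_tensor (f : X -> R) (g : Y -> R) :
  m1.-integrable setT (EFin \o f) -> m2.-integrable setT (EFin \o g) ->
  \int[sfprod]_s (f s.1 * g s.2) = (\int[m1]_x f x) * \int[m2]_y g y.
Proof.
move=> fi gi; rewrite Rintegral_prod2; [|exact: intble_tensor|]; last first.
  move=> y; have := intbleZ (g y) fi.
  by under [X in _ \o X]eq_fun do rewrite mulrC.
rewrite mulrC -RintegralZr//; apply: eq_Rintegral => y _.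
by rewrite -RintegralZl//; apply: eq_Rintegral => x _; rewrite mulrC.
Qed.

End product_integrals.

Section kernel.
Context {R : realType} {n : nat} (rho : 'rV[R]_n -> R).

Local Notation mu := (lebesgue_rV R n).
Local Notation lam := (@lebesgue_measure R).
Local Notation nu := (sfprod (@lebesgue_measure R) (lebesgue_rV R n)).
Local Notation intble f := (mu.-integrable setT (EFin \o f)).
Local Notation unit_indic := (\1_(`[0%R, 1%R]%classic) : measurableTypeR R -> R).

Lemma enorm_sqnorm (x : 'rV[R]_n) : enorm x ^+ 2 = sqnorm x.
Proof. by rewrite sqr_sqrtr ?sqnorm_ge0. Qed.

Lemma norm_le_enorm (x : 'rV[R]_n) : `|x| <= enorm x.
Proof.
rewrite -(ler_pXn2r (ltn0Sn 1)) ?nnegrE ?sqrtr_ge0//.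
by rewrite enorm_sqnorm norm_le_sqnorm.
Qed.

Lemma enormZ (c : R) (x : 'rV[R]_n) : enorm (c *: x) = `|c| * enorm x.
Proof.
by rewrite /enorm -/(sqnorm _) sqnormZ sqrtrM ?sqr_ge0// sqrtr_sqr.
Qed.

Lemma enorm_eq0 (x : 'rV[R]_n) : enorm x = 0 -> x = 0.
Proof.
move=> x0; apply/normr0_eq0; apply/eqP; rewrite eq_le normr_ge0 andbT.
by rewrite -x0 norm_le_enorm.
Qed.

(** The kernel times z_i z_j is rho times this bounded function; it is 0 at the
    origin, where the inverse of 0 is 0. *)
Definition direction (i j : 'I_n) (z : 'rV[R]_n) : R :=
  z ord0 i * z ord0 j / enorm z ^+ 2.

Lemma direction_le1 i j z : `|direction i j z| <= 1.
Proof.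
rewrite /direction enorm_sqnorm.
have [->|z0] := eqVneq z 0.
  by rewrite !mxE mul0r mul0r normr0.
have zn : 0 < `|z| by rewrite normr_gt0.
have s0 : 0 < sqnorm z by rewrite (lt_le_trans _ (norm_le_sqnorm z))// exprn_gt0.
rewrite normrM normfV (gtr0_norm s0) ler_pdivrMr// mul1r normrM.
apply: le_trans (norm_le_sqnorm z); rewrite expr2.
by apply: ler_pM => //; exact: coord_le_norm.
Qed.

Lemma measurable_direction i j : measurable_fun setT (direction i j).
Proof.
apply: measurable_funM.
  by apply: measurable_funM; exact: measurable_coord.
apply: measurable_funV_ge0; first by move=> x; rewrite enorm_sqnorm sqnorm_ge0.
under eq_fun do rewrite enorm_sqnorm.
exact: (Ck_measurable (Ck_sqnorm 0)).
Qed.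

Hypothesis mrho : measurable_fun setT rho.
Hypothesis rho_ge0 : forall z, 0 <= rho z.
Hypothesis rho_int : intble (fun z => rho z * (1 + `|z|)).

Lemma rho_intble : intble rho.
Proof.
apply: (le_intble mrho _ rho_int) => z.
by rewrite ger0_norm// ler_peMr// lerDl.
Qed.

Lemma rho_direction_intble i j : intble (fun z => rho z * direction i j z).
Proof.
have mrd : measurable_fun setT (fun z => rho z * direction i j z).
  by apply: measurable_funM => //; exact: measurable_direction.
apply: (le_intble mrd _ rho_intble) => z.
by rewrite normrM (ger0_norm (rho_ge0 z)) ler_piMr// direction_le1.
Qed.

(** The weight of the pair (t, z) in the integral form of the second-order
    remainder; the derivatives are then evaluated at x minus eps times [ray]. *)
Definition taylor_kernel i j (s : measurableTypeR R * 'rV[R]_n) : R :=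
  (unit_indic s.1 * (1 - s.1)) * (rho s.2 * direction i j s.2).

Definition ray (s : measurableTypeR R * 'rV[R]_n) : 'rV[R]_n := (s.1 : R) *: s.2.

Lemma measurable_ray : measurable_fun setT ray.
Proof.
apply: measurable_fun_rVP => i.
under eq_fun do rewrite mxE.
apply: measurable_funM; first exact: measurable_fst.
exact: (measurableT_comp (measurable_coord i) measurable_snd).
Qed.

Lemma intble_remaining : lam.-integrable setT
  (EFin \o (fun t : measurableTypeR R => unit_indic t * (1 - t))).
Proof.
apply: (@intble_unit _ (fun t => 1 - t)) => t.
by apply: cvgB; [exact: cvg_cst|exact: cvg_id].
Qed.

Lemma taylor_kernel_intble i j : nu.-integrable setT (EFin \o taylor_kernel i j).
Proof. exact: intble_tensor intble_remaining (rho_direction_intble i j). Qed.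

Lemma taylor_kernel_ray_intble i j :
  nu.-integrable setT (EFin \o (fun s => taylor_kernel i j s * (1 + `|ray s|))).
Proof.
have mk := intble_measurable (taylor_kernel_intble i j).
apply: (@le_intble _ _ _ _ _ (fun s => unit_indic s.1 * (rho s.2 * (1 + `|s.2|)))).
- apply: measurable_funM => //; apply: measurable_funD => //.
  by apply: measurable_norm_rV; exact: measurable_ray.
- move=> [t z]; rewrite /taylor_kernel/ray/= indicE.
  case: (boolP (t \in _)) => [/set_mem|_]; last by rewrite !mul0r normr0.
  rewrite /= in_itv/= => /andP[t0 t1]; rewrite !mul1r.
  move: (direction i j z) (direction_le1 i j z) => d d1; rewrite !normrM.
  rewrite (ger0_norm (rho_ge0 z)) normrZ (ger0_norm t0).
  rewrite (ger0_norm (_ : 0 <= 1 - t)) ?subr_ge0//.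
  rewrite (ger0_norm (_ : 0 <= 1 + t * `|z|)) ?addr_ge0 ?mulr_ge0//.
  have a1 : (1 - t) * (rho z * `|d|) <= rho z.
    rewrite mulrCA ler_piMr// mulr_ile1 ?subr_ge0//.
    by rewrite lerBlDr lerDl.
  apply: ler_pM => //; first by rewrite !mulr_ge0// subr_ge0.
    by rewrite addr_ge0// mulr_ge0.
  by rewrite lerD2l ler_piMl.
- exact: intble_tensor intble_unit_indic rho_int.
Qed.

Lemma Rintegral_taylor_kernel i j :
  \int[nu]_s taylor_kernel i j s = momentum_matrix rho i j.
Proof.
have -> := Rintegral_tensor intble_remaining (rho_direction_intble i j).
have -> : \int[lam]_t (unit_indic t * (1 - t)) = 2^-1.
  have dG (t : R) : is_derive t (1 : R) (fun s => s - 2^-1 * s ^+ 2) (1 - t).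
    have -> : (fun s : R => s - 2^-1 * s ^+ 2) = (id - 2^-1 *: (id ^+ 2)) by [].
    apply: is_derive_eq; rewrite expr1 /GRing.scale/= !mulr1 mulrA mulVf ?mul1r//.
  rewrite -(FTC_unit dG); last first.
    by move=> t; apply: cvgB; [exact: cvg_cst|exact: cvg_id].
  by rewrite expr1n expr0n/=; lra.
rewrite mxE; congr (_ * _); apply: eq_Rintegral => z _.
by rewrite /J_kernel /direction mulrA mulrAC.
Qed.

End kernel.

(** * Taylor's formula and the principal value *)

Section taylor.
Context {R : realType} {n : nat}.

Local Notation lam := (@lebesgue_measure R).
Local Notation unit_indic := (\1_(`[0%R, 1%R]%classic) : measurableTypeR R -> R).

Lemma taylor_formula (u : 'rV[R]_n -> R) (x h : 'rV[R]_n) : Ck 2 u ->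
  u (x - h) = u x - \sum_(i < n) h ord0 i * partial i u x +
    \sum_(i < n) \sum_(j < n) h ord0 i * h ord0 j *
      \int[lam]_t ((unit_indic t * (1 - t)) * partial j (partial i u) (x - t *: h)).
Proof.
move=> Cu.
have cline : continuous (fun t : R => x - t *: h).
  move=> t; apply: cvgB; first exact: cvg_cst.
  by apply: (@continuousZl _ _ _ (fun t : R => t)); exact: cvg_id.
have cpart k l : continuous (fun t : R => partial l (partial k u) (x - t *: h)).
  move=> t; apply: (@continuous_comp _ _ _ (fun t : R => x - t *: h) (partial l (partial k u))).
    exact: cline.
  exact: (Ck_continuous (Ck_partial l (Ck_partial k Cu))).
have cpart1 k : continuous (fun t : R => partial k u (x - t *: h)).
  move=> t; apply: (@continuous_comp _ _ _ (fun t : R => x - t *: h) (partial k u)).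
    exact: cline.
  exact: (Ck_continuous (Ck_partial k Cu)).
pose I k l := \int[lam]_t ((unit_indic t * (1 - t)) * partial l (partial k u) (x - t *: h)).
have int2 k l : lam.-integrable setT (EFin \o (fun t : measurableTypeR R =>
    unit_indic t * ((1 - t) * partial l (partial k u) (x - t *: h)))).
  apply: (@intble_unit _ (fun t => (1 - t) * _)) => t.
  by apply: cvgM; [apply: cvgB; [exact: cvg_cst|exact: cvg_id]|exact: (cpart k l t)].
(* Integration by parts on each line segment, against 1 - t. *)
have line_part k : \int[lam]_t (unit_indic t * partial k u (x - t *: h)) =
    partial k u x - \sum_(l < n) h ord0 l * I k l.
  pose G' (t : R) := - partial k u (x - t *: h) -
    \sum_(l < n) h ord0 l * ((1 - t) * partial l (partial k u) (x - t *: h)).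
  have dG (t : R) : is_derive t (1 : R) (fun s => (1 - s) * partial k u (x - s *: h)) (G' t).
    have C1 : Ck 1 (partial k u) by exact: (Ck_partial k Cu).
    have [d1 d2] := C1_derive (x + t *: (- h)) (- h) C1.
    have D := is_derive_line d1; rewrite d2 in D.
    have -> : (fun s : R => (1 - s) * partial k u (x - s *: h)) =
        (cst 1 - id) * (fun s : R => partial k u (x + s *: (- h))).
      apply/funext => s.
      by rewrite -[RHS]/((1 - s) * partial k u (x + s *: - h)) scalerN.
    apply: is_derive_eq. rewrite /GRing.scale/= sub0r mulrN1 addrC.
      have -> : (cst 1 - id) t = 1 - t by [].
      rewrite -[scalemx t (- h)]/(t *: (- h)) scalerN.
    rewrite /G'; congr (_ + _).
    rewrite mulr_sumr -sumrN; apply: eq_bigr => l _.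
    by rewrite mxE mulNr mulrN mulrCA.
  have cG' : continuous G'.
    move=> t; apply: cvgB; first by apply: cvgN; exact: (cpart1 k t).
    apply: cvg_big => [|l _]; first exact: add_continuous.
    apply: cvgM; first exact: cvg_cst.
    by apply: cvgM; [apply: cvgB; [exact: cvg_cst|exact: cvg_id]|exact: (cpart k l t)].
  have := FTC_unit dG cG'.
  rewrite subrr mul0r subr0 mul1r scale0r subr0 sub0r => E.
  have int1 : lam.-integrable setT (EFin \o (fun t : measurableTypeR R =>
      unit_indic t * partial k u (x - t *: h))).
    by apply: intble_unit; exact: cpart1.
  have E2 : \int[lam]_t (unit_indic t * G' t) =
      - (\int[lam]_t (unit_indic t * partial k u (x - t *: h))) -
      \sum_(l < n) h ord0 l * I k l.
    have -> : \sum_(l < n) h ord0 l * I k l = \int[lam]_t (\sum_(l < n)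
        h ord0 l * (unit_indic t * ((1 - t) * partial l (partial k u) (x - t *: h)))).
      rewrite Rintegral_sum; last by move=> l; exact: intbleZ.
      apply: eq_bigr => l _; rewrite RintegralZl//; congr (_ * _).
      by apply: eq_Rintegral => t _; rewrite mulrA.
    rewrite -mulN1r -RintegralZl// -RintegralB//.
    - apply: eq_Rintegral => t _; rewrite mulrBr mulr_sumr mulN1r mulrN; congr (_ - _).
      by apply: eq_bigr => l _; rewrite mulrCA.
    - exact: intbleZ.
    - by apply: intble_sum => l; exact: intbleZ.
  by move: E; rewrite E2; move: (\sum_(l < n) _) => S /eqP; rewrite -subr_eq0 => /eqP E; lra.
have := C1_increment x h (CkS Cu) => /eqP; rewrite subr_eq => /eqP ->.
rewrite addrC -[RHS]addrA; congr (_ + _).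
rewrite [RHS]addrC -sumrB; apply: eq_bigr => k _.
have -> : \int[lam]_t (- h ord0 k * unit_indic t * partial k u (x - t *: h)) =
    - h ord0 k * \int[lam]_t (unit_indic t * partial k u (x - t *: h)).
  rewrite -RintegralZl//; first by apply: eq_Rintegral => t _; rewrite mulrA.
  by apply: intble_unit; exact: cpart1.
rewrite line_part mulrBr !mulNr opprK addrC; congr (_ - _).
by rewrite mulr_sumr; apply: eq_bigr => l _; rewrite mulrA.
Qed.

End taylor.

Section principal_value.
Context {R : realType} {n : nat} (rho : 'rV[R]_n -> R).

Local Notation mu := (lebesgue_rV R n).
Local Notation lam := (@lebesgue_measure R).
Local Notation nu := (sfprod (@lebesgue_measure R) (lebesgue_rV R n)).
Local Notation intble f := (mu.-integrable setT (EFin \o f)).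
Local Notation unit_indic := (\1_(`[0%R, 1%R]%classic) : measurableTypeR R -> R).

Hypothesis mrho : measurable_fun setT rho.
Hypothesis rho_ge0 : forall z, 0 <= rho z.
Hypothesis rho_even : forall z, rho (- z) = rho z.
Hypothesis rho_int : intble (fun z => rho z * (1 + `|z|)).
Context (eps : R) (eps0 : 0 < eps) (u : 'rV[R]_n -> R) (Cu : Ckc 2 u) (x : 'rV[R]_n).

Let second i j := partial j (partial i u).

Let linear_part (z : 'rV[R]_n) : R :=
  rho z / enorm z ^+ 2 * (eps^-1 * \sum_(i < n) z ord0 i * partial i u x).

Let remainder (z : 'rV[R]_n) : R :=
  \sum_(i < n) \sum_(j < n) (rho z * direction i j z) *
    \int[lam]_t ((unit_indic t * (1 - t)) * second i j (x - t *: (eps *: z))).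

(** The integrand at y = x - eps z, up to the Jacobian, split by Taylor's formula. *)
Let difference_quotient z :
  rho z / (eps * enorm z) ^+ 2 * (u x - u (x - eps *: z)) =
  linear_part z - remainder z.
Proof.
have e0 : eps != 0 by rewrite gt_eqF.
rewrite (taylor_formula x (eps *: z) Cu.1) /linear_part /remainder.
have -> : \sum_(i < n) (eps *: z) ord0 i * partial i u x =
    eps * \sum_(i < n) z ord0 i * partial i u x.
  by rewrite mulr_sumr; apply: eq_bigr => i _; rewrite mxE mulrA.
set I := fun i j => \int[lam]_t ((unit_indic t * (1 - t)) * second i j (x - t *: (eps *: z))).
have -> : \sum_(i < n) \sum_(j < n) (eps *: z) ord0 i * (eps *: z) ord0 j * I i j =
    eps ^+ 2 * \sum_(i < n) \sum_(j < n) z ord0 i * z ord0 j * I i j.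
  rewrite mulr_sumr; apply: eq_bigr => i _; rewrite mulr_sumr; apply: eq_bigr => j _.
  by rewrite !mxE; ring.
have -> : \sum_(i < n) \sum_(j < n) rho z * direction i j z * I i j =
    rho z / enorm z ^+ 2 * \sum_(i < n) \sum_(j < n) z ord0 i * z ord0 j * I i j.
  rewrite mulr_sumr; apply: eq_bigr => i _; rewrite mulr_sumr; apply: eq_bigr => j _.
  by rewrite /direction; ring.
rewrite exprMn invfM; move: (\sum_(i < n) _) (\sum_(i < n) _) (enorm z ^- 2) => A B c.
by field.
Qed.

Let K (r : R) (z : 'rV[R]_n) : R := \1_[set z | r <= eps * enorm z] z.

Let measurable_enorm : measurable_fun setT (@enorm R n).
Proof.
apply: (measurableT_comp (continuous_measurable_fun (@sqrt_continuous R))).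
exact: (Ck_measurable (Ck_sqnorm 0)).
Qed.

Let mK r : measurable_fun setT (K r).
Proof.
apply: measurable_indic; rewrite -[X in measurable X]setTI.
have -> : [set z | r <= eps * enorm z] = (fun z : 'rV[R]_n => eps * enorm z) @^-1` `[r, +oo[.
  by apply/seteqP; split => z /=; rewrite in_itv/= andbT.
by apply: measurable_funM.
Qed.

Let K_itv r z : 0 <= K r z <= 1.
Proof. by rewrite /K indicE; case: (_ \in _); rewrite ler01 lexx. Qed.

Let mlinear : measurable_fun setT linear_part.
Proof.
apply: measurable_funM.
  apply: measurable_funM => //; apply: measurable_funV_ge0 => [z|].
    exact: sqr_ge0.
  exact: measurable_funX.
apply: measurable_funM => //; apply: measurable_sum => i.
by apply: measurable_funM => //; exact: measurable_coord.
Qed.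

Let linear_intble r : 0 < r -> intble (fun z => K r z * linear_part z).
Proof.
move=> r0; pose C := \sum_(i < n) `|partial i u x|.
have mKl : measurable_fun setT (fun z => K r z * linear_part z).
  exact: measurable_funM.
apply: (le_intble mKl (g := fun z => r^-1 * C * rho z)).
  move=> z; rewrite /K indicE; case: (boolP (z \in _)) => [/set_mem/= rz|_]; last first.
    rewrite mul0r normr0 !mulr_ge0 ?invr_ge0 ?(ltW r0)//.
    by apply: sumr_ge0.
  have ez : 0 < enorm z by rewrite -(pmulr_rgt0 _ eps0) (lt_le_trans r0).
  rewrite mul1r /linear_part !normrM (ger0_norm (rho_ge0 z)).
  rewrite normfV normrX (gtr0_norm ez) (gtr0_norm (_ : 0 < eps^-1)) ?invr_gt0//.
  have sC : `|\sum_(i < n) z ord0 i * partial i u x| <= enorm z * C.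
    rewrite mulr_sumr (le_trans (ler_norm_sum _ _ _))//; apply: ler_sum => i _.
    rewrite normrM ler_wpM2r// (le_trans (coord_le_norm _ _))//.
    exact: norm_le_enorm.
  have C0 : 0 <= C by exact: sumr_ge0.
  have -> : r^-1 * C * rho z = rho z * (r^-1 * C) by rewrite mulrC.
  rewrite -mulrA ler_wpM2l//.
  apply: (@le_trans _ _ (enorm z ^- 2 * (eps^-1 * (enorm z * C)))).
    by rewrite ler_wpM2l ?invr_ge0 ?sqr_ge0// ler_wpM2l// invr_ge0 ltW.
  have -> : enorm z ^- 2 * (eps^-1 * (enorm z * C)) = (eps * enorm z)^-1 * C.
    by field; rewrite !gt_eqF.
  by rewrite ler_wpM2r// lef_pV2// posrE mulr_gt0.
by apply: intbleZ; exact: rho_intble.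
Qed.

(** The gradient term is odd. *)
Let linear_cancels r : 0 < r -> \int[mu]_z (K r z * linear_part z) = 0.
Proof.
move=> r0; have m1 : (- 1 : R) != 0 by rewrite oppr_eq0 oner_neq0.
have mf : measurable_fun setT (fun z => K r z * linear_part z).
  by apply: measurable_funM.
have := Rintegral_affine_rV 0 m1 mf.
rewrite normrN1 expr1n invr1 mul1r.
have -> : \int[mu]_z (K r (-1 *: z + 0) * linear_part (-1 *: z + 0)) =
    - \int[mu]_z (K r z * linear_part z).
  rewrite -[RHS]mulN1r -RintegralZl//; last exact: linear_intble.
  apply: eq_Rintegral => z _; rewrite addr0 scaleN1r.
  have eN : enorm (- z) = enorm z by rewrite -scaleN1r enormZ normrN1 mul1r.
  have KN : K r (- z) = K r z.
    rewrite /K !indicE; congr ((nat_of_bool _)%:R).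
    by apply/idP/idP => /set_mem h; apply/mem_set; move: h; rewrite /= eN.
  rewrite KN /linear_part eN rho_even mulN1r -!mulrN; congr (_ * (_ * (_ * _))).
  by rewrite -sumrN; apply: eq_bigr => i _; rewrite mxE mulNr.
by lra.
Qed.

Let second_bounded : exists M : R, forall i j y, `|second i j y| <= M.
Proof.
have /choice[M HM] : forall ij : 'I_n * 'I_n, exists M, forall y, `|second ij.1 ij.2 y| <= M.
  by move=> ij; exact: Ckc_bounded (Ckc_partial ij.2 (Ckc_partial ij.1 Cu)).
exists (\sum_ij M ij) => i j y; rewrite (le_trans (HM (i, j) y))//.
rewrite (bigD1 (i, j))//= lerDl; apply: sumr_ge0 => ij _.
by rewrite (le_trans _ (HM ij 0)).
Qed.

Let second_cont i j : continuous (second i j).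
Proof. exact: (Ck_continuous (Ck_partial j (Ck_partial i Cu.1))). Qed.

Let ray_eq (t : R) (z : 'rV[R]_n) : x - eps *: (t *: z) = x - t *: (eps *: z).
Proof. by rewrite !scalerA mulrC. Qed.

Let measurable_second i j : measurable_fun setT
  (fun zt : 'rV[R]_n * measurableTypeR R => second i j (x - (zt.2 : R) *: (eps *: zt.1))).
Proof.
apply: (measurableT_comp (continuous_measurable_rV (@second_cont i j))).
apply: measurable_fun_rVP => k.
under eq_fun do rewrite !mxE.
apply: measurable_funB => //; apply: measurable_funM; first exact: measurable_snd.
apply: measurable_funM => //.
exact: (measurableT_comp (measurable_coord k) measurable_fst).
Qed.

Let inner i j z :=
  \int[lam]_t ((unit_indic t * (1 - t)) * second i j (x - t *: (eps *: z))).

Let inner_intble i j z : lam.-integrable setT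
  (EFin \o (fun t : measurableTypeR R =>
    (unit_indic t * (1 - t)) * second i j (x - (t : R) *: (eps *: z)))).
Proof.
have [M HM] := second_bounded.
under [X in _ \o X]eq_fun do rewrite mulrC.
apply: intbleM_bounded (@intble_remaining R); last by move=> t; exact: HM.
have mz : measurable_fun setT (fun t : measurableTypeR R => (z, t)).
  exact: measurable_fun_pair.
exact: (measurableT_comp (@measurable_second i j) mz).
Qed.

Let inner_bound M : (forall i j y, `|second i j y| <= M) -> forall i j z,
  `|inner i j z| <= \int[lam]_t (M * `|unit_indic t * (1 - t)|).
Proof.
move=> HM i j z; apply: (le_trans (le_normr_Rintegral _ (inner_intble i j z))) => //.
apply: le_Rintegral => //.
- exact: intble_norm.
- by apply: intbleZ; exact: intble_norm (@intble_remaining R).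
- by move=> t _; rewrite normrM mulrC ler_wpM2r.
Qed.

Let remainder_intble : intble remainder.
Proof.
have [M HM] := second_bounded.
apply: intble_sum => i; apply: intble_sum => j.
rewrite -[X in _.-integrable _ X]/(EFin \o (fun z => rho z * direction i j z * inner i j z)).
under [X in _ \o X]eq_fun do rewrite mulrC.
apply: intbleM_bounded (rho_direction_intble mrho rho_ge0 rho_int i j).
  exact: (measurable_Rintegral_param (@intble_remaining R) (@measurable_second i j)).
exact: (inner_bound HM).
Qed.

Let operator_value := \sum_(i < n) \sum_(j < n)
  tavg nu (taylor_kernel rho i j) (fun s => eps *: ray s) (second i j) x.

Let remainder_value : \int[mu]_z remainder z = operator_value.
Proof.
have [M HM] := second_bounded.
have term_intble i j : intble (fun z => rho z * direction i j z * inner i j z).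
  under [X in _ \o X]eq_fun do rewrite mulrC.
  apply: intbleM_bounded (rho_direction_intble mrho rho_ge0 rho_int i j).
    exact: (measurable_Rintegral_param (@intble_remaining R) (@measurable_second i j)).
  exact: (inner_bound HM).
rewrite /remainder Rintegral_sum; last first.
  by move=> i; apply: intble_sum => j; exact: term_intble.
apply: eq_bigr => i _; rewrite Rintegral_sum; last by move=> j; exact: term_intble.
apply: eq_bigr => j _.
rewrite /tavg Rintegral_prod2.
- apply: eq_Rintegral => z _; have <- := RintegralZl (rho z * direction i j z) measurableT (inner_intble i j z).
  apply: eq_Rintegral => t _; rewrite /taylor_kernel /ray/= ray_eq.
  by rewrite mulrA (mulrC (rho z * _)).
- under [X in _ \o X]eq_fun do rewrite mulrC.
  apply: intbleM_bounded (taylor_kernel_intble mrho rho_ge0 rho_int i j); last first.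
    by move=> s; exact: HM.
  apply: (measurableT_comp (continuous_measurable_rV (@second_cont i j))).
  apply: measurable_fun_rVP => k.
  under eq_fun do rewrite !mxE.
  apply: measurable_funB => //; apply: measurable_funM => //.
  apply: measurable_funM; first exact: measurable_fst.
  exact: (measurableT_comp (measurable_coord k) measurable_snd).
- move=> z; have := intbleZ (rho z * direction i j z) (inner_intble i j z).
  congr (integrable _ _ (EFin \o _)); apply/funext => t.
  by rewrite /taylor_kernel /ray/= ray_eq mulrA (mulrC (rho z * _)).
Qed.

Let truncated_remainder_cvg :
  \int[mu]_z (K r z * remainder z) @[r --> 0^'+] --> operator_value.
Proof.
rewrite -remainder_value; apply/cvg_at_rightP => r [r0 rcvg].
apply: (dominated_cvg_R (g := fun z => `|remainder z|)).
- by move=> m; apply: measurable_funM => //; exact: intble_measurable remainder_intble.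
- move=> z; have [->|z0] := eqVneq z 0.
    have -> : remainder 0 = 0.
      rewrite /remainder big1// => i _; rewrite big1// => j _.
      by rewrite /direction mxE mul0r mul0r mulr0 mul0r.
    by under eq_fun do rewrite mulr0; exact: cvg_cst.
  have ez : 0 < eps * enorm z.
    rewrite mulr_gt0// lt_neqAle sqrtr_ge0 andbT eq_sym.
    by apply: contra z0 => /eqP/enorm_eq0 ->.
  apply: cvg_near_cst; near=> m.
  rewrite /K indicE mem_set ?mul1r//=.
  near: m; have /cvgrPdist_le /(_ _ ez) := rcvg.
  apply: filterS => m; rewrite sub0r normrN => /(le_trans _); apply.
  exact: ler_norm.
- exact: intble_norm remainder_intble.
- move=> m z; rewrite normrM ler_piMl//.
  by have /andP[K0 K1] := K_itv (r m) z; rewrite ger0_norm.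
Unshelve. all: by end_near. Qed.

Let truncatedE r : 0 < r ->
  truncated_op rho eps u x r = (- \int[mu]_z (K r z * remainder z))%:E.
Proof.
move=> r0; pose H z := K r z * (linear_part z - remainder z).
have Kr_int : intble (fun z => K r z * remainder z).
  apply: (@intbleM_bounded _ _ _ _ (K r) remainder 1) => //.
  by move=> z; have /andP[K0 K1] := K_itv r z; rewrite ger0_norm.
have HE : H = (fun z => K r z * linear_part z - K r z * remainder z).
  by apply/funext => z; rewrite /H mulrBr.
have H_int : intble H by rewrite HE; apply: intbleB => //; exact: linear_intble.
have c0 : - eps^-1 != 0 by rewrite oppr_eq0 invr_eq0 gt_eqF.
have e0 : eps != 0 by rewrite gt_eqF.
have Ha_int : intble (fun y => H ((- eps^-1) *: y + eps^-1 *: x)).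
  exact: (integrable_affine_rV (eps^-1 *: x) c0 H_int).
rewrite /truncated_op integral_mkcond.
transitivity (\int[mu]_y (eps ^- n * H ((- eps^-1) *: y + eps^-1 *: x))%:E)%E.
  apply: eq_integral => y _; rewrite patchE.
  have zE : (- eps^-1) *: y + eps^-1 *: x = eps^-1 *: (x - y).
    by rewrite scalerBr scaleNr addrC.
  rewrite zE; set z := eps^-1 *: (x - y).
  have xyz : x - y = eps *: z by rewrite scalerA mulfV// scale1r.
  have yz : y = x - eps *: z by rewrite -xyz subKr.
  have ez : enorm (x - y) = eps * enorm z by rewrite xyz enormZ gtr0_norm.
  rewrite /H /K indicE -difference_quotient.
  have -> : (y \in [set y | r <= enorm (x - y)]) = (z \in [set z | r <= eps * enorm z]).
    by apply/idP/idP => /set_mem h; apply/mem_set; move: h; rewrite /= ez.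
  case: ifP => _; last by rewrite mul0r mulr0.
  rewrite mul1r /J_scaled /rho_scaled -/z ez -yz; congr EFin; ring.
rewrite -EFin_Rintegral; last exact: intbleZ.
rewrite RintegralZl// (Rintegral_affine_rV _ c0); last exact: intble_measurable H_int.
rewrite normrN gtr0_norm ?invr_gt0// exprVn invrK mulrA mulVf ?mul1r ?expf_neq0//.
rewrite HE RintegralB//; last exact: linear_intble.
by rewrite linear_cancels// sub0r.
Qed.

Lemma truncated_op_cvg :
  truncated_op rho eps u x r @[r --> 0^'+] --> (- operator_value)%:E.
Proof.
have : (- \int[mu]_z (K r z * remainder z))%:E @[r --> 0^'+] --> (- operator_value)%:E.
  apply: cvg_EFin; first by near=> r.
  by apply: cvgN; exact: truncated_remainder_cvg.
apply: cvg_trans; apply: near_eq_cvg; near=> r.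
by rewrite truncatedE.
Unshelve. all: by end_near. Qed.

End principal_value.

(** * The nonlocal operator on W^{2,p} *)

Section nonlocal_operator.
Context {R : realType} {n : nat} (p : R) (p1 : 1 <= p) (rho : 'rV[R]_n -> R).
Implicit Types (u v : 'rV[R]_n -> R) (eps : R).

Local Notation mu := (lebesgue_rV R n).
Local Notation N f := ('N[mu]_p%:E[EFin \o f%R])%E.
Local Notation nu := (sfprod (@lebesgue_measure R) (lebesgue_rV R n)).
Local Notation intble f := (mu.-integrable setT (EFin \o f)).
Local Notation mi1 i := (fun k : 'I_n => (k == i) : nat).
Local Notation mi2 i j := (fun k : 'I_n => ((k == i) + (k == j))%N).

(** Two bounded extensions agree on test functions, hence, by density, on
    W^{2,p}. *)
Lemma nonlocal_extension_unique eps T T' u :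
  is_nonlocal_extension rho eps p T -> is_nonlocal_extension rho eps p T' ->
  Wkp 2 p u -> T u = T' u %[ae mu].
Proof.
move=> [TL Tlin [C TC] Tpv] [T'L T'lin [C' T'C] T'pv] Wu.
have mT v : Wkp 2 p v -> measurable_fun setT (T v) by move=> /TL/Lfun_measurable.
have mT' v : Wkp 2 p v -> measurable_fun setT (T' v) by move=> /T'L/Lfun_measurable.
have mTT := measurable_funB (mT _ Wu) (mT' _ Wu).
suff N0 : (N (T u \- T' u) = 0)%E.
  have := Lnorm0_ae p1 mTT N0.
  by apply: filterS => x /(_ I)/= /eqP; rewrite subr_eq0 => /eqP.
apply/eqP; rewrite eq_le Lnorm_ge0 andbT; apply/lee_addgt0Pr => e e0; rewrite add0e.
pose d := e / (`|C| + `|C'| + 1).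
have D0 : 0 < `|C| + `|C'| + 1 by rewrite ltr_wpDl// addr_ge0.
have d0 : 0 < d by rewrite divr_gt0.
have [phi tphi phid] := Wkp2_dense p1 Wu d0.
have Cphi : Ckc 2 phi by exact: test_Ckc.
have Wphi := Ckc_Wkp p1 Cphi.
set D : 'rV[R]_n -> R := (-1) *: phi + u in phid.
have WD : Wkp 2 p D by exact: Wkp_lin.
have Tphi : T phi = T' phi %[ae mu].
  apply: filterS2 (Tpv _ Cphi) (T'pv _ Cphi) => x h h' _.
  have PF : ProperFilter (0 : R)^'+ by exact: at_right_proper_filter.
  have /(_ PF) E := cvg_lim (@ereal_hausdorff R) h.
  have /(_ PF) := cvg_lim (@ereal_hausdorff R) h'.
  by rewrite E => -[].
have TTD : (T u \- T' u) = (T D \- T' D) %[ae mu].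
  have := Tlin (-1) _ _ Wphi Wu; have := T'lin (-1) _ _ Wphi Wu; rewrite -/D.
  move=> lin' lin; apply: filterS3 lin lin' Tphi => x /(_ I) E /(_ I) E' /(_ I) Ep _.
  rewrite /= E E'.
  rewrite -[((-1) *: T phi + T u) x]/(-1 * T phi x + T u x).
  rewrite -[((-1) *: T' phi + T' u) x]/(-1 * T' phi x + T' u x) Ep; ring.
rewrite (eq_Lnorm_ae _ mTT (measurable_funB (mT _ WD) (mT' _ WD)) TTD).
apply: (le_trans (LnormB mu p1 (mT _ WD) (mT' _ WD))).
have bound c (S : 'rV[R]_n -> R) : (N S <= c%:E * Wkp_norm 2 p D)%E -> (N S <= (`|c| * d)%:E)%E.
  move=> h; apply: (le_trans h); rewrite EFinM.
  apply: (@le_trans _ _ (`|c|%:E * Wkp_norm 2 p D)%E).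
    by rewrite lee_wpmul2r ?poweR_ge0// lee_fin ler_norm.
  by rewrite lee_wpmul2l.
apply: (le_trans (leeD (bound _ _ (TC _ WD)) (bound _ _ (T'C _ WD)))).
rewrite -EFinD lee_fin -mulrDl.
have <- : (`|C| + `|C'| + 1) * d = e by rewrite /d mulrC divfK// gt_eqF.
by rewrite ler_wpM2r ?lerDl// ltW.
Qed.

Hypothesis mrho : measurable_fun setT rho.
Hypothesis rho_ge0 : forall z, 0 <= rho z.
Hypothesis rho_even : forall z, rho (- z) = rho z.
Hypothesis rho_int : intble (fun z => rho z * (1 + `|z|)).

Let kernel i j := taylor_kernel rho i j.
Let kernel_int i j : nu.-integrable setT (EFin \o kernel i j) :=
  taylor_kernel_intble mrho rho_ge0 rho_int i j.

Let measurable_eray eps : measurable_fun setT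
  (fun s : measurableTypeR R * 'rV[R]_n => eps *: ray s).
Proof.
apply: measurable_fun_rVP => i.
under eq_fun do rewrite mxE.
apply: measurable_funM => //.
exact: (measurableT_comp (measurable_coord i) (@measurable_ray R n)).
Qed.

(** Taylor's formula makes the principal value an absolutely convergent average of
    translates of the second derivatives; in this form the operator makes sense
    on all of W^{2,p}. *)
Definition taylor_op eps u (x : 'rV[R]_n) : R :=
  - \sum_(i < n) \sum_(j < n)
      tavg nu (kernel i j) (fun s => eps *: ray s) (weak_deriv (mi2 i j) u) x.

Let o2 (i j : 'I_n) : (mi_order (mi2 i j) <= 2)%N.
Proof. by rewrite mi_order2. Qed.

Let wL u i j : Wkp 2 p u -> weak_deriv (mi2 i j) u \in Lfun mu p%:E.
Proof. by move=> Wu; exact: Wkp_Lfun Wu (o2 i j). Qed.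

Let tL eps u i j : Wkp 2 p u ->
  tavg nu (kernel i j) (fun s => eps *: ray s) (weak_deriv (mi2 i j) u) \in Lfun mu p%:E.
Proof.
move=> Wu.
exact: (tavg_Lfun p1 (kernel_int i j) (measurable_eray eps) (wL i j Wu)).
Qed.

Let Lfun_sum (I : Type) (r : seq I) (F : I -> 'rV[R]_n -> R) :
  (forall i, F i \in Lfun mu p%:E) -> (fun x => \sum_(i <- r) F i x) \in Lfun mu p%:E.
Proof.
move=> FL; elim: r => [|i r IH].
  under eq_fun do rewrite big_nil.
  apply/(Lfun_normP mu p); split; first exact: measurable_cst.
  by rewrite Lnorm_fun0.
under eq_fun do rewrite big_cons.
exact: LfunD.
Qed.

Let Lfun_opp f : f \in Lfun mu p%:E -> (fun x => - f x) \in Lfun mu p%:E.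
Proof. by move=> fL; under eq_fun do rewrite -mulN1r; exact: LfunZ. Qed.

Lemma taylor_op_Lfun eps u : Wkp 2 p u -> taylor_op eps u \in Lfun mu p%:E.
Proof.
by move=> Wu; apply: Lfun_opp; apply: Lfun_sum => i; apply: Lfun_sum => j; exact: tL.
Qed.

Let ae_pair (P : 'I_n -> 'I_n -> 'rV[R]_n -> Prop) :
  (forall i j, {ae mu, forall x, P i j x}) -> {ae mu, forall x, forall i j, P i j x}.
Proof.
move=> H; have : {ae mu, forall x, forall ij : 'I_n * 'I_n, P ij.1 ij.2 x}.
  by apply: filter_forall => -[i j]; exact: H.
by apply: filterS => x Px i j; exact: (Px (i, j)).
Qed.

Let Lnorm_sum2 (F : 'I_n -> 'I_n -> 'rV[R]_n -> R) :
  (forall i j, F i j \in Lfun mu p%:E) ->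
  (N (fun x => - \sum_(i < n) \sum_(j < n) F i j x) <=
   \sum_(i < n) \sum_(j < n) N (F i j))%E.
Proof.
move=> FL; rewrite LnormN; apply: (le_trans (Lnorm_sum mu p1 _ _)) => [i|].
  by apply: Lfun_measurable; exact: Lfun_sum.
apply: lee_sum => i _; apply: Lnorm_sum => // j.
exact: Lfun_measurable (FL i j).
Qed.

Lemma taylor_op_extension eps : 0 < eps ->
  is_nonlocal_extension rho eps p (taylor_op eps).
Proof.
move=> eps0; split.
- by move=> u; exact: taylor_op_Lfun.
- move=> c u v Wu Wv.
  have H i j : tavg nu (kernel i j) (fun s => eps *: ray s) (weak_deriv (mi2 i j) (c *: u + v)) =
      (fun x => c * tavg nu (kernel i j) (fun s => eps *: ray s) (weak_deriv (mi2 i j) u) x +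
        tavg nu (kernel i j) (fun s => eps *: ray s) (weak_deriv (mi2 i j) v) x) %[ae mu].
    have Wuv := Wkp_lin p1 c Wu Wv.
    have linL := LfunD p1 (LfunZ p1 c (wL i j Wu)) (wL i j Wv).
    have := tavg_ae p1 (kernel_int i j) (measurable_eray eps) (wL i j Wuv) linL
      (weak_deriv_lin c Wu Wv (o2 i j)).
    have := tavg_lin p1 (kernel_int i j) (measurable_eray eps) c (wL i j Wu) (wL i j Wv).
    by apply: filterS2 => x /(_ I) E /(_ I) E' _; rewrite E' E.
  apply: filterS (ae_pair H) => x Hx _.
  rewrite /taylor_op.
  under eq_bigr => i _.
    under eq_bigr => j _ do rewrite (Hx i j I).
    rewrite big_split/= -mulr_sumr.
    over.
  rewrite big_split/= -mulr_sumr opprD -mulrN.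
  by [].
- exists (\sum_(i < n) \sum_(j < n) \int[nu]_s `|kernel i j s|) => u Wu.
  apply: (le_trans (Lnorm_sum2 (fun i j => tL eps i j Wu))).
  rewrite -sumEFin ge0_sume_distrl => [|i _]; last first.
    by rewrite lee_fin; apply: sumr_ge0 => j _; exact: Rintegral_ge0.
  apply: lee_sum => i _.
  rewrite -sumEFin ge0_sume_distrl => [|j _]; last by rewrite lee_fin Rintegral_ge0.
  apply: lee_sum => j _.
  apply: (le_trans (tavg_norm p1 (kernel_int i j) (measurable_eray eps) (wL i j Wu))).
  rewrite lee_wpmul2l ?lee_fin ?Rintegral_ge0//.
  exact: (Lnorm_le_Wkp_norm p1 u (o2 i j)).
- move=> u Cu; have Wu := Ckc_Wkp p1 Cu.
  have H i j : tavg nu (kernel i j) (fun s => eps *: ray s) (weak_deriv (mi2 i j) u) =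
      tavg nu (kernel i j) (fun s => eps *: ray s) (partial j (partial i u)) %[ae mu].
    apply: (tavg_ae p1 (kernel_int i j) (measurable_eray eps) (wL i j Wu)).
      exact: Ckc_Lfun p1 _ _ (Ckc_partial j (Ckc_partial i Cu)).
    rewrite partialC; last exact: Cu.1.
    rewrite -(multi_partial2 i j Cu.1); apply: weak_deriv_ae.
    by apply: Ck_weak_deriv; rewrite mi_order2; exact: Cu.1.
  apply: filterS (ae_pair H) => x Hx.
  have -> : taylor_op eps u x = - \sum_(i < n) \sum_(j < n)
      tavg nu (kernel i j) (fun s => eps *: ray s) (partial j (partial i u)) x.
    congr (- _); apply: eq_bigr => i _; apply: eq_bigr => j _; exact: Hx.
  exact: truncated_op_cvg.
Qed.

Lemma nonlocal_op_taylor eps u : 0 < eps -> Wkp 2 p u ->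
  nonlocal_op rho eps p u = taylor_op eps u %[ae mu] /\
  nonlocal_op rho eps p u \in Lfun mu p%:E.
Proof.
move=> eps0 Wu; have ext := taylor_op_extension eps0.
have ext' : is_nonlocal_extension rho eps p (nonlocal_op rho eps p).
  by apply: xgetPex; exists (taylor_op eps).
split; first exact: nonlocal_extension_unique ext' ext Wu.
by case: ext' => + _ _ _; apply.
Qed.

Let limit_term u i j := fun x => momentum_matrix rho i j * weak_deriv (mi2 i j) u x.

Lemma nonlocal_op_error eps u : 0 < eps -> Wkp 2 p u ->
  (N (nonlocal_op rho eps p u \- local_op rho u) <=
   \sum_(i < n) \sum_(j < n)
     N (tavg nu (kernel i j) (fun s => eps *: ray s) (weak_deriv (mi2 i j) u) \-
        limit_term u i j))%E.
Proof.
move=> eps0 Wu; have [E nL] := nonlocal_op_taylor eps0 Wu.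
have lL i j : limit_term u i j \in Lfun mu p%:E by exact: LfunZ (wL i j Wu).
have mloc : measurable_fun setT (local_op rho u).
  apply: Lfun_measurable (Lfun_opp _); apply: Lfun_sum => i.
  by apply: Lfun_sum => j; exact: lL.
have mtay := Lfun_measurable (taylor_op_Lfun eps Wu).
rewrite (eq_Lnorm_ae _ (measurable_funB (Lfun_measurable nL) mloc)
  (measurable_funB mtay mloc)); last first.
  by apply: filterS E => x /(_ I) E _ /=; rewrite E.
have -> : taylor_op eps u \- local_op rho u = (fun x => - \sum_(i < n) \sum_(j < n)
    (tavg nu (kernel i j) (fun s => eps *: ray s) (weak_deriv (mi2 i j) u) \-
        limit_term u i j) x).
  apply/funext => x /=; rewrite /taylor_op /local_op -opprD -sumrN -big_split/=.
  congr (- _); apply: eq_bigr => i _; rewrite -sumrN -big_split/=.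
  by apply: eq_bigr.
by apply: Lnorm_sum2 => i j; apply: LfunB => //; exact: tL.
Qed.

Let momentumE i j : \int[nu]_s kernel i j s = momentum_matrix rho i j.
Proof. exact: Rintegral_taylor_kernel. Qed.

Lemma nonlocal_op_cvg u : Wkp 2 p u ->
  (N (nonlocal_op rho eps p u \- local_op rho u) @[eps --> 0^'+] --> 0)%E.
Proof.
move=> Wu.
have small (e : R) : 0 < e -> \forall eps \near 0^'+,
    (N (nonlocal_op rho eps p u \- local_op rho u) <= e%:E)%E.
  move=> e0; pose d := e / (n * n).+1%:R.
  have d0 : 0 < d by rewrite divr_gt0.
  have H (ij : 'I_n * 'I_n) : \forall eps \near 0^'+,
      (N (tavg nu (kernel ij.1 ij.2) (fun s => eps *: ray s) (weak_deriv (mi2 ij.1 ij.2) u) \-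
        limit_term u ij.1 ij.2) <= d%:E)%E.
    case: ij => i j /=.
    have [r r0 Hr] := tavg_approx p1 (kernel_int i j) (@measurable_ray R n)
      (taylor_kernel_ray_intble mrho rho_ge0 rho_int i j) (wL i j Wu) d0.
    near=> eps; have := Hr eps; rewrite momentumE; apply; near: eps.
      exact: nbhs_right_gt.
    exact: nbhs_right_lt.
  have {}H := filter_forall _ H.
  near=> eps.
  have eps0 : 0 < eps by [].
  apply: (le_trans (nonlocal_op_error eps0 Wu)).
  apply: (@le_trans _ _ (\sum_(i < n) \sum_(j < n) d%:E)%E).
    apply: lee_sum => i _; apply: lee_sum => j _.
    suff : forall ij : 'I_n * 'I_n,
        (N (tavg nu (kernel ij.1 ij.2) (fun s => eps *: ray s) (weak_deriv (mi2 ij.1 ij.2) u) \-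
          limit_term u ij.1 ij.2) <= d%:E)%E by move=> /(_ (i, j)).
    by near: eps; exact: H.
  rewrite (_ : \sum_(i < n) _ = (n%:R * (n%:R * d))%:E)%E; last first.
    under eq_bigr do rewrite sumEFin.
    rewrite sumEFin; congr EFin.
    under eq_bigr do rewrite sumr_const card_ord -mulr_natl.
    by rewrite sumr_const card_ord !mulr_natl.
  rewrite lee_fin mulrA -natrM.
  have <- : (n * n).+1%:R * d = e by rewrite /d mulrC divfK.
  by rewrite ler_wpM2r ?(ltW d0)// ler_nat.
apply/fine_cvgP; split.
  have := small 1 ltr01; apply: filterS => eps h.
  by rewrite ge0_fin_numE ?Lnorm_ge0// (le_lt_trans h)// ltry.
apply/cvgr0Pnorm_le => e e0; have := small _ e0; apply: filterS => eps h.
rewrite /= ger0_norm ?fine_ge0 ?Lnorm_ge0// -lee_fin fineK//.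
by rewrite ge0_fin_numE ?Lnorm_ge0// (le_lt_trans h)// ltry.
Unshelve. all: by end_near. Qed.

(** Displacing a second derivative of u by t eps z costs at most n eps |z| times
    the norm of its weak partial derivatives, and rho absorbs the factor |z|. *)
Lemma nonlocal_op_rate : exists2 C : R, 0 < C & forall eps u, 0 < eps -> Wkp 3 p u ->
  (N (nonlocal_op rho eps p u \- local_op rho u) <= (C * eps)%:E * Wkp_norm 3 p u)%E.
Proof.
pose A i j := \int[nu]_s `|kernel i j s * (1 + `|ray s|)|.
have A0 i j : 0 <= A i j by exact: Rintegral_ge0.
pose C := \sum_(i < n) \sum_(j < n) A i j * n%:R.
have C0 : 0 <= C by apply: sumr_ge0 => i _; apply: sumr_ge0 => j _; rewrite mulr_ge0.
exists (C + 1) => [|eps u eps0 Wu]; first by rewrite ltr_wpDl.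
have Ceps0 : 0 < (C + 1) * eps by rewrite mulr_gt0// ltr_wpDl.
have W0 : (0 <= Wkp_norm 3 p u)%E by exact: poweR_ge0.
have [Woo|Wfin] := eqVneq (Wkp_norm 3 p u) +oo%E.
  by rewrite Woo gt0_muley ?lte_fin// leey.
have {}Wfin : Wkp_norm 3 p u \is a fin_num by rewrite ge0_fin_numE// lt_neqAle Wfin leey.
have := fineK Wfin; set W := fine _ => WE.
have W0' : 0 <= W by rewrite fine_ge0.
have Wu2 : Wkp 2 p u by exact: Wkp_leq Wu.
apply: (le_trans (nonlocal_op_error eps0 Wu2)).
rewrite -WE -EFinM.
apply: (@le_trans _ _ (\sum_(i < n) \sum_(j < n) (A i j * (eps * n%:R * W))%:E)%E).
  apply: lee_sum => i _; apply: lee_sum => j _.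
  have wLij := wL i j Wu2.
  have c0 : 0 <= eps * n%:R * W by rewrite !mulr_ge0// ltW.
  have mb : measurable_fun setT (fun s : measurableTypeR R * 'rV[R]_n => 1 + `|ray s|).
    by apply: measurable_funD => //; apply: measurable_norm_rV; exact: measurable_ray.
  have b0 (s : measurableTypeR R * 'rV[R]_n) : 0 < 1 + `|ray s| by rewrite ltr_pwDl.
  have := tavg_diff p1 (kernel_int i j) (measurable_eray eps) wLij mb b0
    (taylor_kernel_ray_intble mrho rho_ge0 rho_int i j) c0.
  rewrite momentumE; apply => s.
  pose b k := fun l : 'I_n => ((l == i) + (l == j) + (l == k))%N.
  have ob k : (mi_order (b k) <= 3)%N.
    rewrite (@mi_order_count _ _ [:: i; j; k])// => l /=.
    by rewrite addn0 addnA eq_sym (eq_sym j) (eq_sym k).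
  apply: (le_trans (@Lnorm_translate_weak _ _ _ p1 _ (fun k => weak_deriv (b k) u)
    (eps *: ray s) W wLij _ _ W0' _)).
  - by move=> k; exact: Wkp_Lfun Wu (ob k).
  - move=> k; apply: is_weak_deriv_partial (Wkp_weak_deriv Wu2 (o2 i j)) _.
    exact: Wkp_weak_deriv Wu (ob k).
  - by move=> k; rewrite WE; exact: Lnorm_le_Wkp_norm.
  rewrite lee_fin (le_trans (ler_wpM2r W0' (sum_coord_le_norm _)))//.
  rewrite normrZ gtr0_norm//.
  have -> : n%:R * (eps * `|ray s|) * W = eps * n%:R * W * `|ray s| by ring.
  by apply: ler_wpM2l => //; rewrite lerDr.
under eq_bigr do rewrite sumEFin.
rewrite sumEFin lee_fin.
have -> : \sum_(i < n) \sum_(j < n) A i j * (eps * n%:R * W) = C * eps * W.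
  rewrite /C !mulr_suml; apply: eq_bigr => i _; rewrite !mulr_suml.
  by apply: eq_bigr => j _; ring.
by rewrite ler_wpM2r// ler_wpM2r ?ltW// ltrDl.
Qed.

End nonlocal_operator.

(** * Borel and even versions of the kernel *)

Section null_sets.
Context d (T : measurableType d) {R : realType} (mu : {measure set T -> \bar R}).
Import HBNNSimple.
Local Open Scope ereal_scope.

(** The original kernel need not be Borel, so its integrals are handled as what
    they are, suprema over the simple functions below the integrand. *)
Lemma ge0_le_integral_sup (f g : T -> \bar R) : (forall x, 0 <= f x) ->
  (forall x, f x <= g x) -> \int[mu]_x f x <= \int[mu]_x g x.
Proof.
move=> f0 fg; have g0 x : 0 <= g x by exact: le_trans (f0 x) (fg x).
rewrite !ge0_integralTE//; apply: le_ereal_sup => _ [h /= hf <-].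
by exists h => //= x; exact: le_trans (hf x) (fg x).
Qed.

Let ge0_le_integral_off_null (E : set T) (f g : T -> \bar R) :
  measurable E -> mu E = 0 -> (forall x, 0 <= f x) -> (forall x, 0 <= g x) ->
  (forall x, ~ E x -> f x = g x) -> \int[mu]_x f x <= \int[mu]_x g x.
Proof.
move=> mE E0 f0 g0 fg; rewrite [leLHS]ge0_integralTE//.
apply: ub_ereal_sup => _ [h /= hf <-].
have [h' h'E] : exists h' : {nnsfun T >-> R}, forall x, h' x = (h x * \1_(~` E) x)%R.
  by exists (proj_nnsfun h (measurableC mE)).
have -> : sintegral mu h = \int[mu]_x (h' x)%:E.
  rewrite -integralT_nnsfun; apply: ge0_ae_eq_integral => //.
  - by apply/measurable_EFinP.
  - by apply/measurable_EFinP.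
  - by move=> x _; rewrite lee_fin.
  - by move=> x _; rewrite lee_fin.
  - exists E; split => // x /= H; apply: contrapT => Ex; apply: H => _.
    by rewrite h'E indicE mem_set// mulr1.
apply: ge0_le_integral_sup => x; first by rewrite lee_fin.
rewrite h'E indicE; case: (boolP (x \in _)) => [/set_mem Ex|_].
  by rewrite mulr1 -fg.
by rewrite mulr0.
Qed.

Lemma integral_off_null (D E : set T) (f g : T -> \bar R) :
  measurable E -> mu E = 0 -> (forall x, ~ E x -> f x = g x) ->
  \int[mu]_(x in D) f x = \int[mu]_(x in D) g x.
Proof.
move=> mE E0 fg.
suff H F G : (forall x, 0 <= F x) -> (forall x, 0 <= G x) ->
    (forall x, ~ E x -> F x = G x) -> \int[mu]_x F x = \int[mu]_x G x.
  rewrite integral_mkcond [RHS]integral_mkcond integralE [RHS]integralE.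
  by congr (_ - _); apply: H => // x Ex; rewrite ?funeposE ?funenegE !patchE fg.
move=> F0 G0 FG; apply/eqP; rewrite eq_le; apply/andP; split.
  exact: (ge0_le_integral_off_null mE E0).
by apply: (ge0_le_integral_off_null mE E0) => // x Ex; rewrite FG.
Qed.

Lemma completed_set_borel (A : set T) :
  (completed_algebra_gen mu).-sigma.-measurable A ->
  exists2 B, measurable B & mu.-negligible ((A `\` B) `|` (B `\` A)).
Proof.
move: A; apply: smallest_sub.
  split.
  - exists set0 => //; rewrite set0D setUid; exact: negligible_set0.
  - move=> A [B mB AB]; exists (~` B); first exact: measurableC.
    apply: negligibleS AB => x /= [[[_ nA] nnB]|[nB nTA]].
      by right; split => //; apply: contrapT.
    by left; split => //; apply: contrapT => nA; apply: nTA.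
  - move=> A H; have /choice[B HB] : forall k, exists B, measurable B /\
        mu.-negligible ((A k `\` B) `|` (B `\` A k)).
      by move=> k; have [B mB AB] := H k; exists B.
    exists (\bigcup_k B k); first by apply: bigcupT_measurable => k; case: (HB k).
    have := negligible_bigcup (fun k => (HB k).2).
    apply: negligibleS => x [[[k _ Akx] nB]|[[k _ Bkx] nA]].
      by exists k => //; left; split => // Bkx; apply: nB; exists k.
    by exists k => //; right; split => // Akx; apply: nA; exists k.
move=> _ [B mB [N nN] <-]; exists B => //.
by apply: negligibleS nN => x [[[|//]]|[Bx]] // => /not_orP[].
Qed.

End null_sets.

Section regular_version.
Context {R : realType} {n : nat}.
Implicit Types (rho : 'rV[R]_n -> R).

Local Notation mu := (lebesgue_rV R n).

(** Off one null set, a Lebesgue measurable function is Borel: rational rays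
    suffice to test measurability. *)
Lemma lebesgue_measurable_off_null f : lebesgue_measurable_fun f ->
  exists E : set 'rV[R]_n, [/\ measurable E, mu E = 0%E & measurable_fun (~` E) f].
Proof.
move=> mf.
have ray_measurable (q : rat) : exists B : set 'rV[R]_n, measurable B /\
    mu.-negligible (([set x | ratr q < f x] `\` B) `|` (B `\` [set x | ratr q < f x])).
  suff /completed_set_borel[B mB AB] :
      (completed_algebra_gen mu).-sigma.-measurable [set x | ratr q < f x].
    by exists B.
  have := mf measurableT `]ratr q, +oo[%classic (measurable_itv _).
  rewrite setTI; congr (_ _); apply/seteqP; split => x /=; rewrite in_itv/= andbT//.
have [B HB] := choice ray_measurable.
pose N q := ([set x | ratr q < f x] `\` B q) `|` (B q `\` [set x | ratr q < f x]).
have : mu.-negligible (\bigcup_k if unpickle k is Some q then N q else set0).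
  apply: negligible_bigcup => k; case: (unpickle k) => [q|]; first by case: (HB q).
  exact: negligible_set0.
move=> [E [mE E0 NE]]; exists E; split => //.
have BE q x : ~ E x -> B q x <-> ratr q < f x.
  move=> Ex; have nN : ~ N q x.
    move=> Nx; apply: Ex; apply: NE; exists (pickle q); first exact: I.
    by rewrite (@pickleK rat q); exact: Nx.
  split=> [Bx|fx]; apply: contrapT => h; apply: nN; [right|left]; by split.
apply: (measurability _ (RGenOInfty.measurableE R)) => _ [_ [r ->] <-].
have -> : ~` E `&` f @^-1` `]r, +oo[%classic =
    \bigcup_(q : rat) (if r <= ratr q then ~` E `&` B q else set0).
  apply/seteqP; split => x /=.
    rewrite in_itv/= andbT => -[Ex rf].
    have [q] := rat_in_itvoo rf; rewrite in_itv/= => /andP[rq qf].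
    by exists q => //; rewrite ltW//; split => //; exact/BE.
  move=> [q _]; case: ifPn => // rq [Ex /(BE _ _ Ex) qf]; split => //.
  by rewrite in_itv/= andbT (le_lt_trans rq).
apply: bigcupT_measurable_rat => q; case: ifPn => // _.
by apply: measurableI; [exact: measurableC|case: (HB q)].
Qed.

Lemma null_affine (E : set 'rV[R]_n) (c : R) (h : 'rV[R]_n) : c != 0 ->
  measurable E -> mu E = 0%E ->
  measurable [set y | E (c *: y + h)] /\ mu [set y | E (c *: y + h)] = 0%E.
Proof.
move=> c0 mE E0.
have mA : measurable [set y | E (c *: y + h)].
  by rewrite -[X in measurable X]setTI; exact: measurable_affine_rV.
split => //.
have E1 : (\int[mu]_x (\1_E x)%:E = 0)%E by rewrite integral_indic// setIT.
have := @ge0_integral_affine_rV R n c h (fun x => (\1_E x)%:E) c0.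
rewrite E1 mule0 => <-.
- by rewrite -[LHS](congr1 mu (setIT _)) -integral_indic.
- by apply/measurable_EFinP; exact: measurable_indic.
- by move=> x; rewrite lee_fin.
Qed.

(** The points where the kernel fails to be Borel or even lie in a symmetric
    null set, on which it is replaced by 0. *)
Lemma regular_version rho : (forall x, 0 <= rho x) ->
  lebesgue_measurable_fun rho -> {ae mu, forall x, rho x = rho (- x)} ->
  exists E : set 'rV[R]_n, exists rho' : 'rV[R]_n -> R,
    [/\ measurable E /\ mu E = 0%E, forall x, ~ E x -> rho' x = rho x,
      measurable_fun setT rho', forall x, rho' (- x) = rho' x &
      forall x, 0 <= rho' x <= rho x].
Proof.
move=> rho0 mrho [A [mA A0 Aeven]].
have [B [mB B0 Brho]] := lebesgue_measurable_off_null mrho.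
have mAB : measurable (A `|` B) by exact: measurableU.
have AB0 : mu (A `|` B) = 0%E by exact: null_set_setU.
have m1 : (-1 : R) != 0 by rewrite oppr_eq0 oner_neq0.
have [mN N0] := null_affine 0 m1 mAB AB0.
pose E := (A `|` B) `|` [set y | (A `|` B) (-1 *: y + 0)].
have mE : measurable E by exact: measurableU.
have EN x : E (- x) <-> E x.
  by rewrite /E /= !addr0 !scaleN1r opprK; split => -[]; [right|left|right|left].
exists E, (rho \_ (~` E)); split.
- by split => //; exact: null_set_setU.
- by move=> x Ex; rewrite patchE mem_set.
- apply/(measurable_restrictT _ (measurableC mE)).
  by apply: measurable_funS Brho => [|x Ex Bx]; [exact: measurableC|apply: Ex; left; right].
- move=> x; rewrite !patchE; have [Ex|Ex] := pselect (E x).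
    have /EN Ex' := Ex.
    by rewrite !memNset//=; apply.
  have Ex' : ~ E (- x) by move=> /EN.
  rewrite !mem_set//; apply/esym; apply: contrapT => H; apply: Ex; left; left.
  exact: Aeven.
- by move=> x; rewrite patchE; case: ifP => _; rewrite ?lexx ?rho0.
Qed.

Context (rho rho' : 'rV[R]_n -> R) (E : set 'rV[R]_n).
Hypothesis nullE : measurable E /\ mu E = 0%E.
Hypothesis rhoE : forall x, ~ E x -> rho' x = rho x.

Lemma momentum_matrix_off_null : momentum_matrix rho' = momentum_matrix rho.
Proof.
apply/matrixP => i j; rewrite !mxE; congr (_ * fine _).
apply: (integral_off_null _ nullE.1 nullE.2) => x Ex.
by rewrite /J_kernel rhoE.
Qed.

Lemma truncated_op_off_null eps : 0 < eps -> truncated_op rho' eps = truncated_op rho eps.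
Proof.
move=> eps0; apply/funext => u; apply/funext => x; apply/funext => r.
have c0 : - eps^-1 != 0 by rewrite oppr_eq0 invr_eq0 gt_eqF.
have [mA A0] := null_affine (eps^-1 *: x) c0 nullE.1 nullE.2.
apply: (integral_off_null _ mA A0) => y Ey.
rewrite /J_scaled /rho_scaled rhoE// => H; apply: Ey => /=.
by rewrite scaleNr addrC -scalerBr.
Qed.

Lemma nonlocal_op_off_null eps p : 0 < eps ->
  nonlocal_op rho' eps p = nonlocal_op rho eps p.
Proof.
by move=> eps0; rewrite /nonlocal_op /is_nonlocal_extension truncated_op_off_null.
Qed.

Lemma local_op_off_null : local_op rho' = local_op rho.
Proof. by rewrite /local_op momentum_matrix_off_null. Qed.

End regular_version.

(** * Convergence and rate *)

Theorem theorem3p3 (R : realType) (n : nat) (n_gt0 : (0 < n)%N)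
    (rho : 'rV[R]_n -> R)
    (rho_ge0 : forall x, 0 <= rho x)
    (rho_neq0 : exists x, rho x != 0)
    (rho_meas : lebesgue_measurable_fun rho)
    (rho_even : {ae lebesgue_rV R n, forall x, rho x = rho (- x)})
    (rho_int :
      (\int[lebesgue_rV R n]_x (rho x * (1 + enorm x))%:E < +oo)%E)
    (p : R) (p_ge1 : 1 <= p) :
  (forall u : 'rV[R]_n -> R, Wkp 2 p u ->
     'N[lebesgue_rV R n]_p%:E
       [EFin \o (nonlocal_op rho eps p u \- local_op rho u)%R]%E
       @[eps --> 0^'+] --> 0%E) /\
  (exists2 C : R, 0 < C &
     forall (eps : R) (u : 'rV[R]_n -> R), 0 < eps -> Wkp 3 p u ->
       ('N[lebesgue_rV R n]_p%:E
          [EFin \o (nonlocal_op rho eps p u \- local_op rho u)%R]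
        <= (C * eps)%:E * Wkp_norm 3 p u)%E).
Proof.
have [E [rho' [nullE rhoE mrho' rho'_even rho'_le]]] :=
  regular_version rho_ge0 rho_meas rho_even.
have rho'_ge0 x : 0 <= rho' x by have /andP[] := rho'_le x.
have rho'_int : (lebesgue_rV R n).-integrable setT
    (EFin \o (fun z => rho' z * (1 + `|z|))).
  apply: ge0_intbleP.
  - apply: measurable_funM => //; apply: measurable_funD => //.
    exact: measurable_norm_rV.
  - by move=> x; rewrite mulr_ge0.
  - apply: le_lt_trans rho_int; apply: ge0_le_integral_sup => x.
      by rewrite lee_fin mulr_ge0.
    rewrite lee_fin ler_pM//; first by have /andP[] := rho'_le x.
    by rewrite lerD2l norm_le_enorm.
have nonlocalE := nonlocal_op_off_null nullE rhoE p.
rewrite -(local_op_off_null nullE rhoE); split.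
  move=> u Wu.
  have := nonlocal_op_cvg p_ge1 mrho' rho'_ge0 rho'_even rho'_int Wu.
  apply: cvg_trans; apply: near_eq_cvg; near=> eps.
  by rewrite nonlocalE.
have [C C0 HC] := nonlocal_op_rate p_ge1 mrho' rho'_ge0 rho'_even rho'_int.
exists C; first exact: C0.
move=> eps u eps0 Wu.
by have := HC eps u eps0 Wu; rewrite (nonlocalE eps eps0).
Unshelve. all: by end_near. Qed.
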